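(* Let $X\in S_{pol}$, with the notation $\Gamma_1,\ldots,\Gamma_N$, $\delta_i$, $(x,y)$, $l_i$, etc. of the context. Pick any collection of (not necessarily pairwise distinct) polynomials $f_{ij}\in\mathbb{C}[x,y]$, $1\le i\le N$, $0\le j\le l_i$, such that for all $i,j$: (i) $f_{ij}=0$ is a curve with one place at infinity; and (ii) $f_{ij}$ has a degree-wise Puiseux root $\phi_{ij}$ (which is unique up to conjugacy) such that the Puiseux pairs of $\phi_{ij}$ are $(q_{i,1},p_{i,1}),\ldots,(q_{i,j},p_{i,j})$, and $\phi_{ij}=[\phi_i(x)]_{>r_{i,j+1}}+$ terms with degree (in $x$) less than or equal to $r_{i,j+1}$. Let $N':=\sum_{i=1}^N(l_i+1)$. For all $\vec\gamma:=(\gamma_{ij})_{i,j}\in\mathbb{Z}_{\ge0}^{N'}$ and $\alpha,\beta\in\mathbb{Z}_{\ge0}$, define $g_{\alpha\beta\vec\gamma}:=x^\alpha y^\beta\prod_{i,j}f_{ij}^{\gamma_{ij}}\in\mathbb{C}[x,y]$. Then: (1) The elements $(f_{ij})_{\vec\delta(f_{ij})}$ ($1\le i\le N$, $0\le j\le l_i$), together with $(x)_{\vec\delta(x)}$, $(y)_{\vec\delta(y)}$ and $(1)_{\vec e_j}$, $1\le j\le N$, generate the Cox ring $\mathcal{R}(X)$ as a $\mathbb{C}$-algebra. (2) Let $\vec d:=(d_1,\ldots,d_N)\in\mathbb{Z}^N$. Let $\mathcal{E}_{\vec d}$ be the collection of all $(\alpha,\beta,\vec\gamma)\in\mathbb{Z}_{\ge0}\times\mathbb{Z}_{\ge0}\times\mathbb{Z}_{\ge0}^{N'}$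 such that $\alpha\delta_k(x)+\beta\delta_k(y)+\sum_{i,j}\gamma_{ij}\delta_k(f_{ij})\le d_k$ for all $k$, $1\le k\le N$. Then $\Gamma(X,\mathcal{O}(\sum d_j\Gamma_j))$ is generated as a vector space over $\mathbb{C}$ by $\{g_{\alpha\beta\vec\gamma}:(\alpha,\beta,\vec\gamma)\in\mathcal{E}_{\vec d}\}$. (3) Let $\vec d:=(d_1,\ldots,d_N)\in\mathbb{Z}^N$. Define $\mathcal{E}'_{\vec d}$ to be the set of all $(a,b)\in\mathbb{Z}_{\ge0}^2$ such that $b=\beta+\sum_{i,j}\gamma_{ij}\deg_y(f_{ij})=\deg_y(g_{a\beta\vec\gamma})$ for some $\beta\in\mathbb{Z}_{\ge0}$ and $\vec\gamma\in\mathbb{Z}_{\ge0}^{N'}$ with $(a,\beta,\vec\gamma)\in\mathcal{E}_{\vec d}$. Then $\dim\Gamma(X,\mathcal{O}(\sum d_j\Gamma_j))=|\mathcal{E}'_{\vec d}|$. For each $(a,b)\in\mathcal{E}'_{\vec d}$, pick any $\beta\in\mathbb{Z}_{\ge0}$ and $\vec\gamma\in\mathbb{Z}_{\ge0}^{N'}$ such that $(a,\beta,\vec\gamma)\in\mathcal{E}_{\vec d}$ and $b=\deg_y(g_{a\beta\vec\gamma})$, and define $g_{a,b}:=g_{a\beta\vec\gamma}$. Then $\{g_{a,b}:(a,b)\in\mathcal{E}'_{\vec d}\}$ is a basis of $\Gamma(X,\mathcal{O}(\sum d_j\Gamma_j))$.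
   Context: All varieties are over $\mathbb{C}$. Degree-wise Puiseux series. $\mathbb{C}\langle\langle x\rangle\rangle:=\bigcup_{p\ge1}\mathbb{C}((x^{-1/p}))$. The polydromy order of $\phi$ is the smallest $p\ge1$ with $\phi\in\mathbb{C}((x^{-1/p}))$; if $\phi=\sum_q a_qx^{q/p}$ with $p$ the polydromy order, its conjugates are $\sum_q a_q\zeta^{jq}x^{q/p}$, $1\le j\le p$, with $\zeta$ a primitive $p$-th root of unity. $[\phi]_{>r}$ (resp. $[\phi]_{\ge r}$) is the sum of the terms of $\phi$ of degree $>r$ (resp. $\ge r$). The Puiseux pairs of $\phi$ are the unique sequence of pairs of relatively prime integers $(q_1,p_1),\ldots,(q_k,p_k)$ such that the polydromy order is $p_1\cdots p_k$ and for each $j$: $p_j\ge2$, $[\phi]_{>q_j/(p_1\cdots p_j)}\in\mathbb{C}((x^{-1/(p_1\cdots p_{j-1})}))$, and $[\phi]_{\ge q_j/(p_1\cdots p_j)}\notin\mathbb{C}((x^{-1/(p_1\cdots p_{j-1})}))$. A degree-wise Puiseux root of $f\in\mathbb{C}[x,y]$ is $\psi\in\mathbb{C}\langle\langle x\rangle\rangle$ with $f(x,\psi(x))=0$. A curve in $\mathbb{C}^2$ has one place at infinity if its closure in $\mathbb{P}^2$ meets the line at infinity at only one point and its germ there is irreducible. Semidegrees. Let $X$ be a normal complete surface containing $U=\mathbb{C}^2$ as a dense open subset, and $\Gamma_1,\ldots,\Gamma_N$ the irreducible components of $X\setminus U$. The semidegree $\delta_i$ is the function on nonzero $f\in\mathbb{C}(X)=\mathbb{C}(x,y)$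 giving the order of pole of $f$ along $\Gamma_i$. Fix polynomial coordinates $(x,y)$ on $U$ with $\delta_i(x)>0$ for each $i$. For each $i$ there are $\phi_i\in\mathbb{C}[x^{1/\delta_i(x)},x^{-1/\delta_i(x)}]$ and $r_i\in\frac1{\delta_i(x)}\mathbb{Z}$, $r_i$ smaller than all exponents appearing in $\phi_i$, such that $\delta_i(f)=\delta_i(x)\deg_x(f(x,\phi_i(x)+\xi x^{r_i}))$ for all nonzero $f\in\mathbb{C}(x,y)$, $\xi$ an indeterminate; $\tilde\phi_i(x,\xi):=\phi_i(x)+\xi x^{r_i}$ is the generic degree-wise Puiseux series of $\delta_i$. If $(q_{i,1},p_{i,1}),\ldots,(q_{i,l_i},p_{i,l_i})$ are the Puiseux pairs of $\phi_i$ and $r_i=q_{i,l_i+1}/(p_{i,1}\cdots p_{i,l_i}p_{i,l_i+1})$ with $p_{i,l_i+1}\ge1$, $\gcd(q_{i,l_i+1},p_{i,l_i+1})=1$, then $(q_{i,1},p_{i,1}),\ldots,(q_{i,l_i+1},p_{i,l_i+1})$ are the formal Puiseux pairs of $\tilde\phi_i$. Put $r_{i,j}:=q_{i,j}/(p_{i,1}\cdots p_{i,j})$, $1\le j\le l_i+1$ (so $r_{i,l_i+1}=r_i$). Key forms. For a semidegree $\delta$ on $\mathbb{C}(x,y)$ (i.e. the function on nonzero $f\in\mathbb{C}(x,y)$ giving the order of pole of $f$ along an irreducible component of $X'\setminus U$, for some normal complete surface $X'$ containing $U=\mathbb{C}^2$ as a dense open subset) with $\delta(x)>0$, the sequence of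 key forms is the (unique, finite) sequence $f_0,\ldots,f_n\in\mathbb{C}[x,x^{-1},y]$ such that, with $\omega_j:=\delta(f_j)$: (P0) $f_0=x$, $f_1=y$; (P1) for $1\le j<n$, $\omega_{j+1}<\alpha_j\omega_j=\sum_{i=0}^{j-1}\beta_{j,i}\omega_i$, where $\alpha_j=\min\{\alpha\in\mathbb{Z}_{>0}:\alpha\omega_j\in\mathbb{Z}\omega_0+\cdots+\mathbb{Z}\omega_{j-1}\}$ and $\beta_{j,i}\in\mathbb{Z}$ with $0\le\beta_{j,i}<\alpha_i$ for $1\le i<j$; (P2) for $1\le j<n$, $f_{j+1}=f_j^{\alpha_j}-\theta_jf_0^{\beta_{j,0}}\cdots f_{j-1}^{\beta_{j,j-1}}$ for some $\theta_j\in\mathbb{C}^*$; (P3) if $\omega$ is the weighted degree on $B=\mathbb{C}[x,x^{-1},y_1,\ldots,y_n]$ with weights $\omega_0$ for $x$, $\omega_j$ for $y_j$, then $\delta(g)=\min\{\omega(G):G\in B,\ G(x,f_1,\ldots,f_n)=g\}$ for all nonzero $g\in\mathbb{C}[x,x^{-1},y]$. $X\in S_{pol}$ means that for each $i$ all key forms of $\delta_i$ are polynomials (in $\mathbb{C}[x,y]$). Cox ring. $\mathcal{R}(X):=\bigoplus_{(d_1,\ldots,d_N)\in\mathbb{Z}^N}\Gamma(X,\mathcal{O}(\sum d_j\Gamma_j))$. Sections are identified with their restrictions to $\mathbb{C}^2$, so $\Gamma(X,\mathcal{O}(\sum d_j\Gamma_j))=\{f\in\mathbb{C}[x,y]:f=0\text{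 or }\delta_j(f)\le d_j\ \forall j\}$. For $f$ in this space, $(f)_{\vec d}$ denotes the copy of $f$ in the $\vec d$-th graded component of $\mathcal{R}(X)$. $\vec e_j$ is the $j$-th unit vector of $\mathbb{Z}^N$ and $\vec\delta(f):=(\delta_1(f),\ldots,\delta_N(f))$. *)

(* Defs.v *)
From mathcomp Require Import all_boot all_order all_algebra.
From mathcomp Require Import boolp classical_sets functions cardinality fsbigop.
From mathcomp Require Import reals.
From mathcomp Require Export complex.
From mathcomp Require Import mpoly.

Set Implicit Arguments.
Unset Strict Implicit.
Unset Printing Implicit Defensive.

Import Order.TTheory GRing.Theory Num.Theory.
Local Open Scope classical_set_scope.
Local Open Scope ring_scope.

(* F[x,y] is encoded as F[x][y]: the coefficient of x^a y^b in f is f`_b`_a,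
   and deg_y f = (size f).-1. *)
Notation Pxy F := {poly {poly F}}.
Notation Kxy F := {fraction {poly {poly F}}}.

Definition var_x (F : fieldType) : Pxy F := 'X%:P.
Definition var_y (F : fieldType) : Pxy F := 'X.
Definition cstP (F : fieldType) (c : F) : Pxy F := c%:P%:P.
Arguments var_x {F}.
Arguments var_y {F}.

Definition toK (F : fieldType) (f : Pxy F) : Kxy F := tofrac f.
Definition cstK (F : fieldType) (c : F) : Kxy F := toK (cstP c).

Definition deg_y (F : fieldType) (f : Pxy F) : nat := (size f).-1.

(* Formal sums indexed by an abelian group G are represented by their
   coefficient function G -> A.  The product of two of them is the convolution;
   \sum_(a \in setT) is the sum over the finite support of the summand (this
   support is finite for Puiseux series and for finitely supported functions). *)

Definition mono (G : zmodType) (A : nzRingType) (d : G) (c : A) : G -> A :=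
  fun e => if e == d then c else 0.

Definition conv (G : zmodType) (A : nzRingType) (u v : G -> A) : G -> A :=
  fun e => \sum_(a \in [set: G]) u a * v (e - a).

Definition conv_pow (G : zmodType) (A : nzRingType) (u : G -> A) (n : nat) :
  G -> A := iter n (conv u) (mono 0 1).

(* phi : rat -> A stands for the series \sum_e phi(e) x^e. *)

(* membership in A((x^{-1/p})) *)
Definition in_laurent (A : nzRingType) (p : nat) (phi : rat -> A) : Prop :=
  (forall e, phi e != 0 -> e * p%:R \is a Num.int) /\
  (exists M : rat, forall e, M < e -> phi e = 0).

Definition is_puiseux (A : nzRingType) (phi : rat -> A) : Prop :=
  exists2 p : nat, (0 < p)%N & in_laurent p phi.

Definition is_polydromy (A : nzRingType) (phi : rat -> A) (p : nat) : Prop :=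
  [/\ (0 < p)%N, in_laurent p phi
    & forall p' : nat, (0 < p')%N -> in_laurent p' phi -> (p <= p')%N].

Definition trunc_gt (A : nzRingType) (phi : rat -> A) (r : rat) : rat -> A :=
  fun e => if r < e then phi e else 0.
Definition trunc_ge (A : nzRingType) (phi : rat -> A) (r : rat) : rat -> A :=
  fun e => if r <= e then phi e else 0.

(* A sequence (q_1,p_1),...,(q_k,p_k) is a seq (int * nat), indexed from 0. *)

(* p_1 ... p_j *)
Definition prod_p (s : seq (int * nat)) (j : nat) : nat :=
  \prod_(qp <- take j s) qp.2.

(* r_{j+1} = q_{j+1} / (p_1 ... p_{j+1}) *)
Definition char_exp (s : seq (int * nat)) (j : nat) : rat :=
  (nth (0, 1%N) s j).1%:~R / (prod_p s j.+1)%:R.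

Definition puiseux_pairs (A : nzRingType) (phi : rat -> A)
    (s : seq (int * nat)) : Prop :=
  is_polydromy phi (prod_p s (size s)) /\
  forall j, (j < size s)%N ->
    let qp := nth (0, 1%N) s j in
    [/\ coprime `|qp.1|%N qp.2, (2 <= qp.2)%N,
        in_laurent (prod_p s j) (trunc_gt phi (char_exp s j))
      & ~ in_laurent (prod_p s j) (trunc_ge phi (char_exp s j))].

Definition peval (A : nzRingType) (f : {poly {poly A}}) (phi : rat -> A) :
    rat -> A :=
  fun e => \sum_(b < size f) \sum_(a < size (f`_b)%R)
             f`_b`_a * conv_pow phi b (e - a%:R).

Definition is_puiseux_root (F : fieldType) (f : Pxy F) (psi : rat -> F) : Prop :=
  is_puiseux psi /\ forall e, peval f psi e = 0.

Definition has_deg_x (A : nzRingType) (phi : rat -> A) (r : rat) : Prop :=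
  phi r != 0 /\ forall e, r < e -> phi e = 0.

Definition tot_deg (F : fieldType) (f : Pxy F) : nat :=
  \max_(b < size f | f`_b != 0) ((size (f`_b)%R).-1 + b)%N.

(* The points of the line at infinity z = 0 of P^2 are [1 : c : 0], encoded as
   Some c, and [0 : 1 : 0], encoded as None.  With H the homogenization of f,
   local_eq f (Some c) is H(1, c + u, v) and local_eq f None is H(u, 1, v),
   where u is the inner and v the outer variable; the line is v = 0. *)
Definition local_eq (F : fieldType) (f : Pxy F) (P : option F) : Pxy F :=
  let d := tot_deg f in
  \sum_(b < size f) \sum_(a < size (f`_b)%R)
    cstP (f`_b`_a) * 'X ^+ (d - a - b) *
    (match P with
     | Some c => (('X + c%:P) ^+ b)%:P
     | None => ('X ^+ a)%:P
     end).

Definition meets_infinity (F : fieldType) (f : Pxy F) (P : option F) : Prop :=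
  (local_eq f P)`_0`_0 = 0.

(* The germ at the origin of G(u,v) = 0 is irreducible: G is an irreducible
   element of the ring F[[u,v]] (whose units are the series with nonzero
   constant term). *)
Definition irreducible_germ (F : fieldType) (G : Pxy F) : Prop :=
  [/\ G != 0, G`_0`_0 = 0
    & forall A B : nat -> nat -> F,
        (forall m n, G`_n`_m =
           \sum_(i < m.+1) \sum_(j < n.+1) A i j * B (m - i)%N (n - j)%N) ->
        A 0%N 0%N != 0 \/ B 0%N 0%N != 0].

Definition one_place_at_infinity (F : fieldType) (f : Pxy F) : Prop :=
  exists P : option F,
    [/\ meets_infinity f P, forall P', meets_infinity f P' -> P' = P
      & irreducible_germ (local_eq f P)].

(* An integral separated scheme of finite type over F with function field
   K = F(x,y) is identified with the set of the local rings of its points,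
   viewed as subrings of K (a "model" of K in the sense of Zariski-Samuel,
   vol. II, ch. VI, sect. 17). *)

Definition is_subalg (F : fieldType) (A : set (Kxy F)) : Prop :=
  [/\ forall c : F, A (cstK c),
      forall a b, A a -> A b -> A (a + b)
    & forall a b, A a -> A b -> A (a * b)].

Definition is_prime_ideal (F : fieldType) (A p : set (Kxy F)) : Prop :=
  [/\ p `<=` A /\ p 0, ~ p 1, forall a b, p a -> p b -> p (a + b),
      forall a b, A a -> p b -> p (a * b)
    & forall a b, A a -> A b -> p (a * b) -> p a \/ p b].

Definition localize (F : fieldType) (A p : set (Kxy F)) : set (Kxy F) :=
  [set z | exists a b, [/\ A a, A b, ~ p b & z = a / b]].

(* the local rings of the points of Spec A *)
Definition Spec_points (F : fieldType) (A : set (Kxy F)) : set (set (Kxy F)) :=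
  [set O | exists2 p, is_prime_ideal A p & O = localize A p].

Definition is_affine_model (F : fieldType) (A : set (Kxy F)) : Prop :=
  (exists s : seq (Kxy F), A = smallest (@is_subalg F) [set z | z \in s]) /\
  (forall z, exists a b, [/\ A a, A b, b != 0 & z = a / b]).

Definition max_ideal (F : fieldType) (O : set (Kxy F)) : set (Kxy F) :=
  [set z | O z /\ (z = 0 \/ ~ O z^-1)].

Definition is_valuation_ring (F : fieldType) (V : set (Kxy F)) : Prop :=
  is_subalg V /\ forall z, V z \/ V z^-1.

Definition dominated_by (F : fieldType) (O V : set (Kxy F)) : Prop :=
  O `<=` V /\ max_ideal O `<=` max_ideal V.

Definition is_integrally_closed (F : fieldType) (O : set (Kxy F)) : Prop :=
  forall (z : Kxy F) (P : {poly Kxy F}),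
    P \is monic -> (forall i, O P`_i) -> root P z -> O z.

Definition plane_ring (F : fieldType) : set (Kxy F) := range (@toK F).

(* the local rings of the points of U = Spec F[x,y] *)
Definition plane_points (F : fieldType) : set (set (Kxy F)) :=
  Spec_points (@plane_ring F).

(* The fields express, in this order: X is covered by finitely many affine
   models; X is separated and complete (valuative criteria); X is normal; U is
   contained in X.  Then U is automatically open and dense in X. *)
Record normal_complete_surface (F : fieldType) (X : set (set (Kxy F))) : Prop :=
  NormalCompleteSurface {
  ncs_cover : exists (n : nat) (A : 'I_n -> set (Kxy F)),
    (forall i, is_affine_model (A i)) /\
    X = [set O | exists i, Spec_points (A i) O];
  ncs_separated : forall V O1 O2, is_valuation_ring V -> X O1 -> X O2 ->
    dominated_by O1 V -> dominated_by O2 V -> O1 = O2;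
  ncs_complete : forall V, is_valuation_ring V ->
    exists2 O, X O & dominated_by O V;
  ncs_normal : forall O, X O -> is_integrally_closed O;
  ncs_plane : @plane_points F `<=` X }.

(* A point lies in the closure of another one iff its local ring is contained in
   that of the other.  Hence the generic points of the irreducible components of
   X \ U are the points of X \ U whose local rings are maximal; components are
   identified with the local rings of their generic points. *)
Definition component_at_infinity (F : fieldType) (X : set (set (Kxy F)))
    (O : set (Kxy F)) : Prop :=
  [/\ X O, ~ plane_points O
    & forall O', X O' -> ~ plane_points O' -> O `<=` O' -> O' = O].

Definition components_at_infinity (F : fieldType) (X : set (set (Kxy F)))
    (N : nat) (Gamma : 'I_N -> set (Kxy F)) : Prop :=
  injective Gamma /\
  forall O, component_at_infinity X O <-> exists i, Gamma i = O.

(* delta is the order of pole along the component with local ring O, that is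
   minus the valuation of O; t is a uniformizer. *)
Definition is_semidegree_along (F : fieldType) (O : set (Kxy F))
    (delta : Kxy F -> int) : Prop :=
  exists t : Kxy F, [/\ t != 0, max_ideal O t
    & forall f, f != 0 -> exists u, [/\ O u, O u^-1 & f = u * t ^ (- delta f)]].

(* phi(x) + xi x^r, where the coefficient ring is F[xi] *)
Definition generic_series (F : fieldType) (phi : rat -> F) (r : rat) :
    rat -> {poly F} :=
  fun e => (phi e)%:P + mono r 'X e.

Definition lift_xi (F : fieldType) (f : Pxy F) : {poly {poly {poly F}}} :=
  map_poly (map_poly polyC) f.

(* deg_x(f(x, phi(x) + xi x^r)) of a quotient f = g/h of polynomials is the
   difference of the degrees for g and h. *)
Definition is_generic_puiseux (F : fieldType) (delta : Kxy F -> int)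
    (phi : rat -> F) (r : rat) : Prop :=
  let dx := delta (toK var_x) in
  [/\ finite_set [set e | phi e != 0] /\
        (forall e, phi e != 0 -> e * dx%:~R \is a Num.int),
      r * dx%:~R \is a Num.int,
      forall e, phi e != 0 -> r < e
    & forall g h : Pxy F, g != 0 -> h != 0 ->
        exists dg dh : rat,
          [/\ has_deg_x (peval (lift_xi g) (generic_series phi r)) dg,
              has_deg_x (peval (lift_xi h) (generic_series phi r)) dh
            & (delta (toK g / toK h))%:~R = dx%:~R * (dg - dh)]].

Definition formal_puiseux_pairs (A : nzRingType) (phi : rat -> A) (r : rat)
    (l : nat) (s : l.+1.-tuple (int * nat)) : Prop :=
  let qp := nth (0, 1%N) s l in
  [/\ puiseux_pairs phi (take l s), r = char_exp s l, (1 <= qp.2)%N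
    & coprime `|qp.1|%N qp.2].

Definition in_lattice (omega : nat -> int) (j : nat) (z : int) : Prop :=
  exists c : nat -> int, z = \sum_(i < j) c i * omega i.

(* membership in F[x, x^-1, y] *)
Definition is_laurent_xy (F : fieldType) (z : Kxy F) : Prop :=
  exists (P : Pxy F) (k : nat), z = toK P / toK var_x ^+ k.

(* An element of B = F[x, x^-1, y_1, ..., y_n] is written as P * x^-k with P a
   polynomial in the n+1 variables x, y_1, ..., y_n; its value at (f_0, ..., f_n)
   is B_eval f P k. *)
Definition B_eval (F : fieldType) (n : nat) (f : nat -> Kxy F)
    (P : {mpoly F[n.+1]}) (k : nat) : Kxy F :=
  mmap (@cstK F) (fun i : 'I_n.+1 => f i) P / f 0%N ^+ k.

Definition B_weight (F : fieldType) (n : nat) (omega : nat -> int)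
    (P : {mpoly F[n.+1]}) (k : nat) (w : int) : Prop :=
  let wt (m : 'X_{1..n.+1}) : int :=
    (\sum_(i < n.+1) (m i)%:Z * omega i) - k%:Z * omega 0%N in
  (exists2 m, m \in msupp P & wt m = w) /\
  (forall m, m \in msupp P -> wt m <= w).

(* f_0, ..., f_n are the values at 0, ..., n of f. *)
Definition is_key_forms (F : fieldType) (delta : Kxy F -> int) (n : nat)
    (f : nat -> Kxy F) : Prop :=
  let omega j := delta (f j) in
  [/\ (1 <= n)%N /\ (forall j, (j <= n)%N -> is_laurent_xy (f j)),
      f 0%N = toK var_x /\ f 1%N = toK var_y,
      exists (alpha : nat -> nat) (beta : nat -> nat -> int) (theta : nat -> F),
      forall j, (1 <= j < n)%N ->
      [/\ [/\ (0 < alpha j)%N, in_lattice omega j ((alpha j)%:Z * omega j)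
            & forall a : nat, (0 < a)%N -> in_lattice omega j (a%:Z * omega j) ->
                (alpha j <= a)%N],
          omega j.+1 < (alpha j)%:Z * omega j
            /\ (alpha j)%:Z * omega j = \sum_(i < j) beta j i * omega i,
          forall i, (1 <= i < j)%N -> 0 <= beta j i < (alpha i)%:Z
        & theta j != 0 /\
          f j.+1 = f j ^+ alpha j - cstK (theta j) * \prod_(i < j) f i ^ beta j i]
    & forall g : Kxy F, g != 0 -> is_laurent_xy g ->
      (exists (P : {mpoly F[n.+1]}) (k : nat),
          B_eval f P k = g /\ B_weight omega P k (delta g)) /\
      (forall (P : {mpoly F[n.+1]}) (k : nat) (w : int),
          B_eval f P k = g -> B_weight omega P k w -> delta g <= w)].

Definition in_S_pol (F : fieldType) (N : nat) (delta : 'I_N -> Kxy F -> int) :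
    Prop :=
  forall i, exists (n : nat) (f : nat -> Kxy F),
    is_key_forms (delta i) n f /\ forall j, (j <= n)%N -> plane_ring (f j).

Definition lin_span (F : fieldType) (I : choiceType) (A : set I) (g : I -> Pxy F) :
    set (Pxy F) :=
  [set f | exists (s : seq I) (c : I -> F),
     (forall i, i \in s -> A i) /\ f = \sum_(i <- s) cstP (c i) * g i].

Definition lin_free (F : fieldType) (I : choiceType) (A : set I) (g : I -> Pxy F) :
    Prop :=
  forall (s : seq I) (c : I -> F), uniq s -> (forall i, i \in s -> A i) ->
    \sum_(i <- s) cstP (c i) * g i = 0 -> forall i, i \in s -> c i = 0.

Definition is_basis (F : fieldType) (I : choiceType) (A : set I) (g : I -> Pxy F)
    (V : set (Pxy F)) : Prop :=
  lin_span A g = V /\ lin_free A g.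

Definition has_dim (F : fieldType) (V : set (Pxy F)) (n : nat) : Prop :=
  exists b : nat -> Pxy F, is_basis `I_n b V.

Definition sections (F : fieldType) (N : nat) (delta : 'I_N -> Kxy F -> int)
    (d : {ffun 'I_N -> int}) : set (Pxy F) :=
  [set f | f = 0 \/ forall j, delta j (toK f) <= d j].

(* The element \sum_d (f_d)_d of the direct sum is the function d |-> f_d; its
   product is conv, and (f)_d is mono d f. *)
Definition cox_ring (F : fieldType) (N : nat) (delta : 'I_N -> Kxy F -> int) :
    set ({ffun 'I_N -> int} -> Pxy F) :=
  [set u | finite_set [set d | u d != 0] /\ forall d, sections delta d (u d)].

Definition is_graded_subalg (F : fieldType) (N : nat)
    (M : set ({ffun 'I_N -> int} -> Pxy F)) : Prop :=
  [/\ M (mono 0 1), forall (c : F) u, M u -> M (fun d => cstP c * u d),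
      forall u v, M u -> M v -> M (fun d => u d + v d)
    & forall u v, M u -> M v -> M (conv u v)].

Definition delta_vec (F : fieldType) (N : nat) (delta : 'I_N -> Kxy F -> int)
    (f : Pxy F) : {ffun 'I_N -> int} := [ffun k => delta k (toK f)].

Definition unit_vec (N : nat) (j : 'I_N) : {ffun 'I_N -> int} :=
  [ffun k => (k == j)%:Z].

Definition IJ (N : nat) (l : 'I_N -> nat) : finType :=
  {i : 'I_N & 'I_(l i).+1}.

Definition cox_generators (F : fieldType) (N : nat)
    (delta : 'I_N -> Kxy F -> int) (l : 'I_N -> nat) (f : IJ l -> Pxy F) :
    set ({ffun 'I_N -> int} -> Pxy F) :=
  [set u | [\/ exists ij, u = mono (delta_vec delta (f ij)) (f ij),
               u = mono (delta_vec delta var_x) var_x,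
               u = mono (delta_vec delta var_y) var_y
             | exists j, u = mono (unit_vec j) 1]].

(* triples ((alpha, beta), gamma) *)
Definition exps (N : nat) (l : 'I_N -> nat) : choiceType :=
  (nat * nat * {ffun IJ l -> nat})%type.

Definition g_mon (F : fieldType) (N : nat) (l : 'I_N -> nat) (f : IJ l -> Pxy F)
    (e : exps l) : Pxy F :=
  let: (a, b, gamma) := e in
  var_x ^+ a * var_y ^+ b * \prod_(ij : IJ l) f ij ^+ gamma ij.

Definition E_set (F : fieldType) (N : nat) (delta : 'I_N -> Kxy F -> int)
    (l : 'I_N -> nat) (f : IJ l -> Pxy F) (d : {ffun 'I_N -> int}) :
    set (exps l) :=
  [set e : exps l | forall k, e.1.1%:Z * delta k (toK var_x)
       + e.1.2%:Z * delta k (toK var_y)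
       + \sum_(ij : IJ l) (e.2 ij)%:Z * delta k (toK (f ij)) <= d k].

Definition E'_set (F : fieldType) (N : nat) (delta : 'I_N -> Kxy F -> int)
    (l : 'I_N -> nat) (f : IJ l -> Pxy F) (d : {ffun 'I_N -> int}) :
    set (nat * nat) :=
  [set ab | exists (beta : nat) (gamma : {ffun IJ l -> nat}),
     [/\ E_set delta f d (ab.1, beta, gamma),
         ab.2 = (beta + \sum_(ij : IJ l) gamma ij * deg_y (f ij))%N
       & ab.2 = deg_y (g_mon f (ab.1, beta, gamma))]].

(* Main.v *)
Require Import Defs.
From HB Require Import structures.
From mathcomp Require Import all_boot all_order all_algebra.
From mathcomp Require Import boolp classical_sets functions cardinality fsbigop.
From mathcomp Require Import reals trigo.
From mathcomp Require Import ring lra zify.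

(* Write a polynomial g as its leading coefficient in y times the product of the
   y - psi over its Puiseux roots psi.  Then delta_k(g) / delta_k(x) is the degree
   of that coefficient plus the sum over psi of deg_x(phi_k + xi x^(r_k) - psi).
   In a conjugacy class of roots let c be the smallest of these degrees, over all k
   and all conjugates, attained by psi and by k = i.  If j is the least index with
   r_(i,j+1) <= c, then psi, phi_i and phi_ij agree in all degrees > c.  Hence the
   number p_(i,1) ... p_(i,j) of conjugates of phi_ij divides that of psi, and
   replacing psi by phi_ij increases none of the degrees.  Since f_ij has one place
   at infinity, it is, up to a constant, the product of the y - psi over the
   conjugates psi of phi_ij.  So some monomial in x, y and the f_ij has the leading
   term (in y, then in x) of g and satisfies delta_k <= delta_k(g) for all k, and
   induction on leading terms gives the bases. *)

Set Implicit Arguments.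
Unset Strict Implicit.
Unset Printing Implicit Defensive.
Import Order.TTheory GRing.Theory Num.Theory.
Local Open Scope classical_set_scope.
Local Open Scope ring_scope.

(** * Puiseux series *)

(** The minimality of c makes the replacement harmless: psi and phi_ij differ only in degrees at
    most c, and no conjugate of psi has degree below c along any generic series, so the ultrametric
    inequality bounds each new degree by the old one, for all k at once. Divisibility makes the
    degrees in y match: a class of n conjugates is exchanged for n / (p_1 ... p_j) copies of f_ij,
    and since the leading coefficients of the f_ij in y are constants, the leading monomial of g is
    kept.

    The delicate point is that an irreducible germ at infinity yields a single conjugacy class and a
    constant leading coefficient. At [1 : c : 0] the local equation is a polynomial in u = y/x - c
    over C[1/x], and its factors over C((1/x)) give factors of the germ. At [0 : 1 : 0] the same
    argument describes x as a series in y, and this expansion has to be inverted.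

    Conjugation is an action of the natural numbers on all Puiseux series at once, whatever their
    denominators; no root of unity has to be chosen for each denominator. *)

Section Convolution.
Variables (G : zmodType) (A : nzRingType).
Implicit Types u v : G -> A.

(** [conv] is a sum over all of [G], meaningful through the finite support of its summand; any
    duplicate-free list containing that support computes it. *)
Lemma conv_seq u v e (s : seq G) : uniq s ->
  (forall a, a \notin s -> u a * v (e - a) = 0) ->
  conv u v e = \sum_(a <- s) u a * v (e - a).
Proof.
move=> us hs; rewrite fsbig_seq //; apply/esym/fsbig_widen => //.
by move=> a [_ /= /negP]; exact: hs.
Qed.

Lemma conv_mono d (c : A) v e : conv (mono d c) v e = c * v (e - d).
Proof.
rewrite (@conv_seq _ _ _ [:: d]) // ?big_seq1 /mono ?eqxx // => a.
by rewrite inE => /negPf ->; rewrite mul0r.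
Qed.

End Convolution.

Section Lattice.
Variable A : nzRingType.
Implicit Types (phi : rat -> A) (U V : nat -> A) (p : nat) (m : int).

(** The elements of (1/p)Z that are at most m/p, numbered downwards. With p and m fixed, a series is
    a sequence of coefficients and identities between series become identities between sequences. *)
Definition lat_pt p m (k : nat) : rat := (m%:~R - k%:R) / p%:R.

(* The series x^(m/p) \sum_k U_k x^(-k/p). *)
Definition lat p m U : rat -> A := fun e =>
  let z := m%:~R - e * p%:R in if z \is a Num.nat then U (Num.truncn z) else 0.

Lemma lat_ptK p m k : (0 < p)%N -> m%:~R - lat_pt p m k * p%:R = k%:R.
Proof.
by move=> p0; rewrite /lat_pt divfK ?pnatr_eq0 -?lt0n // opprB addrC subrK.
Qed.

Lemma lat_in p m U k : (0 < p)%N -> lat p m U (lat_pt p m k) = U k.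
Proof. by move=> p0; rewrite /lat lat_ptK // natr_nat natrK. Qed.

Lemma lat_supp p m U e : (0 < p)%N -> lat p m U e != 0 ->
  exists k, e = lat_pt p m k.
Proof.
move=> p0; rewrite /lat; case: ifP; last by rewrite eqxx.
move=> /natrP[k hk] _; exists k; rewrite /lat_pt -hk opprB addrC subrK mulfK //.
by rewrite pnatr_eq0 -lt0n.
Qed.

Lemma eq_lat p m U phi : (0 < p)%N -> (forall k, phi (lat_pt p m k) = U k) ->
  (forall e, phi e != 0 -> exists k, e = lat_pt p m k) -> phi = lat p m U.
Proof.
move=> p0 h1 h2; apply/funext => e.
have [ez|/h2[k ->]] := eqVneq (phi e) 0; last by rewrite h1 lat_in.
have [->//|/(lat_supp p0)[k ek]] := eqVneq (lat p m U e) 0.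
by rewrite ek lat_in // -h1 -ek.
Qed.

Lemma in_laurent_lat p m U : (0 < p)%N -> in_laurent p (lat p m U).
Proof.
move=> p0; have p0' : p%:R != 0 :> rat by rewrite pnatr_eq0 -lt0n.
split.
  move=> e /(lat_supp p0)[k ->]; rewrite /lat_pt divfK //.
  by rewrite rpredB // ?natr_int // intr_int.
exists (m%:~R / p%:R) => e he; apply/eqP; apply: contraTT he => /(lat_supp p0)[k ->].
by rewrite -leNgt /lat_pt ler_pdivrMr ?ltr0n // divfK // gerBl.
Qed.

Lemma in_laurent_mono p phi q : (0 < q)%N -> in_laurent p phi ->
  in_laurent (p * q) phi.
Proof.
move=> q0 [h1 h2]; split => // e /h1 he; rewrite natrM mulrA rpredM //.
exact: natr_int.
Qed.

(** Every large enough [m] is allowed, so that several series can be written over one common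
    lattice. *)
Lemma laurent_lat p phi : (0 < p)%N -> in_laurent p phi ->
  exists m0 : int, forall m, m0 <= m ->
    phi = lat p m (fun k => phi (lat_pt p m k)).
Proof.
move=> p0 [h1 [M hM]]; have p0' : 0 < p%:R :> rat by rewrite ltr0n.
exists (Num.ceil (M * p%:R)) => m hm; apply: eq_lat => // e he.
have /intrP[z hz] := h1 _ he.
have heM : e <= M by rewrite leNgt; apply: contra he => /hM ->.
have zm : z <= m.
  rewrite -(ler_int rat) -hz; apply: le_trans (_ : M * p%:R <= _).
    by rewrite ler_pM2r.
  by apply: le_trans (ceil_ge _) _; rewrite ler_int.
exists `|m - z|%N; rewrite /lat_pt -[`|_|%N%:R]/(`|m - z|%N%:Z%:~R).
by rewrite abszE ger0_norm ?subr_ge0 // -intrB subKr -hz mulfK // gt_eqF.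
Qed.

Definition cauchy U V : nat -> A := fun n => \sum_(i < n.+1) U i * V (n - i)%N.

(** Below order [N] the Cauchy product is a product of truncated polynomials; associativity and
    commutativity are inherited from polynomials in this way. *)
Lemma cauchyE U V n (N : nat) : (n < N)%N ->
  cauchy U V n = ((\poly_(i < N) U i) * (\poly_(i < N) V i))`_n.
Proof.
move=> nN; rewrite coefM; apply: eq_bigr => i _.
by rewrite !coef_poly (leq_ltn_trans _ nN) ?(leq_ltn_trans _ nN) ?leq_subr -1?ltnS.
Qed.

Lemma cauchyA U V W : cauchy U (cauchy V W) = cauchy (cauchy U V) W.
Proof.
apply/funext => n; have trunc X Y : \poly_(i < n.+1) cauchy X Y i =
    \poly_(i < n.+1) ((\poly_(i < n.+1) X i) * (\poly_(i < n.+1) Y i))`_i.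
  by apply/polyP => i; rewrite !coef_poly; case: ltnP => // /cauchyE ->.
rewrite !(@cauchyE _ _ _ n.+1) // !trunc.
pose T (X : nat -> A) := \poly_(i < n.+1) X i.
transitivity (T U * (T V * T W))`_n.
  rewrite !coefM; apply: eq_bigr => i _; congr (_ * _).
  by rewrite coef_poly ltnS leq_subr.
rewrite mulrA !coefM; apply: eq_bigr => i _; congr (_ * _).
by rewrite coef_poly ltn_ord.
Qed.

Lemma cauchyDl U U' V : cauchy (fun k => U k + U' k) V =
  (fun k => cauchy U V k + cauchy U' V k).
Proof.
apply/funext => n; rewrite -big_split; apply: eq_bigr => i _.
by rewrite mulrDl.
Qed.

Lemma lat_pt_sub p m m' (k i : nat) : (0 < p)%N -> (i <= k)%N ->
  lat_pt p (m + m') k - lat_pt p m i = lat_pt p m' (k - i)%N.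
Proof. by move=> p0 ik; rewrite /lat_pt -mulrBl natrB // intrD; congr (_ / _); ring. Qed.

Lemma lat_pt_inj p m : (0 < p)%N -> injective (lat_pt p m).
Proof.
move=> p0 i j h; apply/eqP; rewrite -(eqr_nat rat); apply/eqP.
by rewrite -(lat_ptK m i p0) h lat_ptK.
Qed.

Lemma conv_lat p m m' U V : (0 < p)%N ->
  conv (lat p m U) (lat p m' V) = lat p (m + m') (cauchy U V).
Proof.
move=> p0; apply: eq_lat => // [k|e he].
  rewrite (@conv_seq _ _ _ _ _ [seq lat_pt p m i | i <- iota 0 k.+1]).
  - have -> : iota 0 k.+1 = index_iota 0 k.+1 by rewrite /index_iota subn0.
    rewrite big_map big_mkord.
    apply: eq_bigr => i _; rewrite lat_in // lat_pt_sub ?lat_in //.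
    by rewrite -ltnS.
  - by rewrite map_inj_uniq ?iota_uniq //; apply: lat_pt_inj.
  move=> a ha; apply/eqP; apply: contraNT ha => ha.
  have /(lat_supp p0)[i ai] : lat p m U a != 0.
    by apply: contraNneq ha => ->; rewrite mul0r.
  have /(lat_supp p0)[j aj] : lat p m' V (lat_pt p (m + m') k - a) != 0.
    by apply: contraNneq ha => ->; rewrite mulr0.
  rewrite ai map_f // mem_iota add0n ltnS /=; rewrite -(ler_nat rat).
  have p0' : 0 < p%:R :> rat by rewrite ltr0n.
  move: aj; rewrite ai /lat_pt -mulrBl => /divIf -/(_ (lt0r_neq0 p0')).
  rewrite intrD => h; have -> : k%:R = i%:R + j%:R :> rat by lra.
  by rewrite lerDl ler0n.
apply: contrapT => ne; move: he; rewrite /conv fsbig1 ?eqxx // => a _.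
apply/eqP; rewrite -[_ == 0]negbK; apply/negP => ha; apply: ne.
have /(lat_supp p0)[i ai] : lat p m U a != 0.
  by apply: contraNneq ha => ->; rewrite mul0r.
have /(lat_supp p0)[j aj] : lat p m' V (e - a) != 0.
  by apply: contraNneq ha => ->; rewrite mulr0.
exists (i + j)%N; rewrite -(subrK a e) aj ai /lat_pt -mulrDl natrD intrD.
by congr (_ / _); ring.
Qed.

Lemma lat_add p m U V :
  (fun e => lat p m U e + lat p m V e) = lat p m (fun k => U k + V k).
Proof. by apply/funext => e; rewrite /lat /=; case: ifP; rewrite ?addr0. Qed.

Lemma is_puiseux_lat p m U : (0 < p)%N -> is_puiseux (lat p m U).
Proof. by move=> p0; exists p => //; apply: in_laurent_lat. Qed.

Lemma is_puiseux_lat2 phi psi : is_puiseux phi -> is_puiseux psi ->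
  exists p m U V, [/\ (0 < p)%N, phi = lat p m U & psi = lat p m V].
Proof.
move=> [p p0 hp] [q q0 hq]; exists (p * q)%N.
have pq0 : (0 < p * q)%N by rewrite muln_gt0 p0.
have [m hm] := laurent_lat pq0 (in_laurent_mono q0 hp).
have [m' hm'] : exists m0 : int, forall m, m0 <= m ->
    psi = lat (p * q) m (fun k => psi (lat_pt (p * q) m k)).
  by apply: laurent_lat => //; rewrite mulnC; apply: in_laurent_mono.
exists (Num.max m m'); eexists; eexists; split; first exact: pq0.
  by apply: hm; rewrite le_max lexx.
by apply: hm'; rewrite le_max lexx orbT.
Qed.

Lemma is_puiseux_lat3 phi psi chi :
  is_puiseux phi -> is_puiseux psi -> is_puiseux chi ->
  exists p m U V W,
    [/\ (0 < p)%N, phi = lat p m U, psi = lat p m V & chi = lat p m W].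
Proof.
move=> [p p0 hp] [q q0 hq] [r r0 hr]; exists (p * q * r)%N.
have pq0 : (0 < p * q * r)%N by rewrite !muln_gt0 p0 q0.
have [m hm] := laurent_lat pq0 (in_laurent_mono r0 (in_laurent_mono q0 hp)).
have [m' hm'] : exists m0 : int, forall m, m0 <= m ->
    psi = lat (p * q * r) m (fun k => psi (lat_pt (p * q * r) m k)).
  apply: laurent_lat => //; rewrite (mulnC p).
  exact: in_laurent_mono r0 (in_laurent_mono p0 hq).
have [m'' hm''] : exists m0 : int, forall m, m0 <= m ->
    chi = lat (p * q * r) m (fun k => chi (lat_pt (p * q * r) m k)).
  by apply: laurent_lat => //; rewrite mulnC; apply: in_laurent_mono; rewrite ?muln_gt0 ?p0.
exists (Num.max m (Num.max m' m'')); do 3! eexists; split; first exact: pq0.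
- by apply: hm; rewrite !le_max lexx.
- by apply: hm'; rewrite !le_max lexx !orbT.
by apply: hm''; rewrite !le_max lexx !orbT.
Qed.

Lemma is_puiseux_mono d (c : A) : is_puiseux (mono d c).
Proof.
exists `|denq d|%N; first by rewrite absz_gt0 denq_neq0.
split; last first.
  by exists d => e de; rewrite /mono gt_eqF.
move=> e; rewrite /mono; case: (e =P d) => [-> _|_]; last by rewrite eqxx.
by rewrite -[_%:R]/(`|denq d|%N%:Z%:~R) absz_denq -numqE intr_int.
Qed.

End Lattice.

(** Membership is stated as a boolean, so that this is a subtype of the coefficient functions and
    equality is equality of coefficients. *)
Record puiseux (A : nzRingType) :=
  Puiseux { pser :> rat -> A; _ : `[< is_puiseux pser >] }.

Section PuiseuxRing.
Variable A : comNzRingType.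

HB.instance Definition _ := [isSub for @pser A].
HB.instance Definition _ := gen_eqMixin (puiseux A).
HB.instance Definition _ := gen_choiceMixin (puiseux A).

Lemma puiseuxP (u : puiseux A) : is_puiseux u.
Proof. by case: u => u /= /asboolP. Qed.

Definition mkP (phi : rat -> A) (h : is_puiseux phi) : puiseux A :=
  Puiseux (introT (asboolP _) h).

Lemma puis_ext (u v : puiseux A) : (forall e, u e = v e) -> u = v.
Proof. by move=> h; apply/val_inj/funext. Qed.

Lemma is_puiseuxD (u v : puiseux A) : is_puiseux (fun e => u e + v e).
Proof.
have [p [m [U [V [p0 -> ->]]]]] := is_puiseux_lat2 (puiseuxP u) (puiseuxP v).
by rewrite lat_add; apply: is_puiseux_lat.
Qed.

Lemma is_puiseuxN (u : puiseux A) : is_puiseux (fun e => - u e).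
Proof.
have [p p0 [h1 [M h2]]] := puiseuxP u; exists p => //; split.
  by move=> e; rewrite oppr_eq0 => /h1.
by exists M => e /h2 ->; rewrite oppr0.
Qed.

Lemma is_puiseuxM (u v : puiseux A) : is_puiseux (conv u v).
Proof.
have [p [m [U [V [p0 -> ->]]]]] := is_puiseux_lat2 (puiseuxP u) (puiseuxP v).
by rewrite conv_lat //; apply: is_puiseux_lat.
Qed.

Definition monoP (d : rat) (c : A) : puiseux A := mkP (is_puiseux_mono d c).

Definition addP u v := mkP (is_puiseuxD u v).
Definition oppP u := mkP (is_puiseuxN u).
Definition mulP u v := mkP (is_puiseuxM u v).

Fact addPA : associative addP.
Proof. by move=> u v w; apply: puis_ext => e /=; rewrite addrA. Qed.
Fact addPC : commutative addP.
Proof. by move=> u v; apply: puis_ext => e /=; rewrite addrC. Qed.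
Fact add0P : left_id (monoP 0 0) addP.
Proof. by move=> u; apply: puis_ext => e /=; rewrite /mono; case: ifP; rewrite add0r. Qed.
Fact addNP : left_inverse (monoP 0 0) oppP addP.
Proof. by move=> u; apply: puis_ext => e /=; rewrite /mono; case: ifP; rewrite addNr. Qed.

HB.instance Definition _ := GRing.isZmodule.Build (puiseux A) addPA addPC add0P addNP.

Fact mulPA : associative mulP.
Proof.
move=> u v w; apply/val_inj => /=.
have [p [m [U [V [W [p0 -> -> ->]]]]]] :=
  is_puiseux_lat3 (puiseuxP u) (puiseuxP v) (puiseuxP w).
by rewrite !conv_lat // cauchyA addrA.
Qed.
Fact mulPC : commutative mulP.
Proof.
move=> u v; apply/val_inj => /=.
have [p [m [U [V [p0 -> ->]]]]] := is_puiseux_lat2 (puiseuxP u) (puiseuxP v).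
rewrite !conv_lat //; congr lat; apply/funext => n.
rewrite !(@cauchyE _ _ _ n n.+1) //.
by rewrite mulrC.
Qed.
Fact mul1P : left_id (monoP 0 1) mulP.
Proof. by move=> u; apply: puis_ext => e /=; rewrite conv_mono mul1r subr0. Qed.
Fact mulPDl : left_distributive mulP +%R.
Proof.
move=> u v w; apply/val_inj => /=; rewrite /addP /mkP /=.
have [p [m [U [V [W [p0 -> -> ->]]]]]] :=
  is_puiseux_lat3 (puiseuxP u) (puiseuxP v) (puiseuxP w).
by rewrite lat_add !conv_lat // cauchyDl lat_add.
Qed.
Fact oneP_neq0 : monoP 0 1 != 0.
Proof.
apply/eqP => /(congr1 (fun u : puiseux A => u 0)) /=; rewrite /mono eqxx.
by move/eqP; rewrite oner_eq0.
Qed.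

HB.instance Definition _ := GRing.Zmodule_isComNzRing.Build (puiseux A)
  mulPA mulPC mul1P mulPDl oneP_neq0.

Lemma pcoefD (u v : puiseux A) e : (u + v) e = u e + v e.
Proof. by []. Qed.
Lemma pcoefN (u : puiseux A) e : (- u) e = - u e.
Proof. by []. Qed.
Lemma pcoefB (u v : puiseux A) e : (u - v) e = u e - v e.
Proof. by []. Qed.
Lemma pcoef0 e : (0 : puiseux A) e = 0.
Proof. by rewrite /= /mono; case: ifP. Qed.
Lemma pcoef1 e : (1 : puiseux A) e = (e == 0)%:R.
Proof. by rewrite /= /mono; case: ifP. Qed.
Lemma pserM (u v : puiseux A) : pser (u * v) = conv u v.
Proof. by []. Qed.
Lemma pcoef_sum I (s : seq I) (P : pred I) (F : I -> puiseux A) e :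
  (\sum_(i <- s | P i) F i) e = \sum_(i <- s | P i) F i e.
Proof.
elim/big_rec2: _ => [|i y x _ <-]; first exact: pcoef0.
by rewrite pcoefD.
Qed.
Lemma pserX (u : puiseux A) n : pser (u ^+ n) = conv_pow u n.
Proof. by elim: n => // n IH; rewrite exprS pserM IH. Qed.

Lemma coef_monoM d c (v : puiseux A) e : (monoP d c * v) e = c * v (e - d).
Proof. exact: conv_mono. Qed.

Lemma monoPM d d' c c' : monoP d c * monoP d' c' = monoP (d + d') (c * c').
Proof.
apply: puis_ext => e; rewrite coef_monoM /= /mono subr_eq addrC.
by case: ifP; rewrite ?mulr0.
Qed.

Lemma coef_latM p m m' U V (u v : puiseux A) : (0 < p)%N ->
  pser u = lat p m U -> pser v = lat p m' V ->
  pser (u * v) = lat p (m + m') (cauchy U V).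
Proof. by move=> p0; rewrite pserM => -> ->; apply: conv_lat. Qed.

End PuiseuxRing.

(** * Degree of Puiseux series *)

(** Course-of-values recursion: the approximation [G n] is already correct below [n], and the
    solution is read off the diagonal. *)
Lemma strong_recursion (T : Type) (x0 : T) (step : nat -> (nat -> T) -> T) :
  (forall k g g', (forall i, (i < k)%N -> g i = g' i) ->
     step k g = step k g') ->
  exists g, forall k, g k = step k g.
Proof.
move=> hs.
pose G := fix G n : nat -> T :=
  if n is k.+1 then fun i => if i == k then step k (G k) else G k i
  else fun=> x0.
have GE n i : (i < n)%N -> G n i = G i.+1 i.
  elim: n => // n IH; rewrite ltnS leq_eqVlt => /orP[/eqP->//|lin].
  by rewrite -IH //= ltn_eqF.
exists (fun k => G k.+1 k) => k; rewrite /= eqxx; apply: hs => i ik.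
by rewrite GE.
Qed.

Section Degree.
Variable A : comNzRingType.
Implicit Types u v : puiseux A.

(** A degree bound that also covers the zero series, unlike [has_deg_x]. *)
Definition dle u r := forall e, r < e -> u e = 0.

Lemma dleW u r s : r <= s -> dle u r -> dle u s.
Proof. by move=> rs h e /(le_lt_trans rs); exact: h. Qed.

Lemma dleD u v r : dle u r -> dle v r -> dle (u + v) r.
Proof. by move=> hu hv e he; rewrite pcoefD hu // hv // addr0. Qed.

Lemma dleN u r : dle u r -> dle (- u) r.
Proof. by move=> hu e he; rewrite pcoefN hu // oppr0. Qed.

Lemma dleB u v r : dle u r -> dle v r -> dle (u - v) r.
Proof. by move=> hu hv; apply/dleD/dleN. Qed.

Lemma dle0 r : dle 0 r.
Proof. by move=> e _; apply: pcoef0. Qed.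

Lemma dle_sum I (s : seq I) (P : pred I) (F : I -> puiseux A) r :
  (forall i, P i -> dle (F i) r) -> dle (\sum_(i <- s | P i) F i) r.
Proof. move=> h; apply: (big_ind (fun u => dle u r)) => //; first exact: dle0.
by move=> *; apply: dleD. Qed.

Lemma dle_monoP r c : dle (monoP r c) r.
Proof. by move=> e re /=; rewrite /mono gt_eqF. Qed.

Lemma dle1 : dle 1 0.
Proof. exact: dle_monoP. Qed.

Lemma coefM_top u v r s : dle u r -> dle v s -> (u * v) (r + s) = u r * v s.
Proof.
move=> hu hv; rewrite pserM (@conv_seq _ _ _ _ _ [:: r]) ?big_seq1 //.
  by rewrite addrC addKr.
move=> a; rewrite inE => ar; have [|ra|/eqP] := ltgtP a r; last by rewrite (negPf ar).
  by move=> h; rewrite hv ?mulr0 //; lra.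
by rewrite hu ?mul0r.
Qed.

Lemma dleM u v r s : dle u r -> dle v s -> dle (u * v) (r + s).
Proof.
move=> hu hv e he; rewrite pserM (@conv_seq _ _ _ _ _ [::]) ?big_nil // => a _.
have [ra|ra] := ltP r a; first by rewrite hu ?mul0r.
by rewrite hv ?mulr0 //; lra.
Qed.

Lemma dleX u r n : dle u r -> dle (u ^+ n) (r *+ n).
Proof.
move=> h; elim: n => [|n IH]; first by rewrite mulr0n; apply: dle1.
by rewrite exprS mulrS; apply: dleM.
Qed.

Lemma has_deg_le u r s : has_deg_x u r -> dle u s -> r <= s.
Proof. by move=> [h _] hs; rewrite leNgt; apply: contra h => /hs ->. Qed.

Lemma has_deg_inj u r s : has_deg_x u r -> has_deg_x u s -> r = s.
Proof.
move=> hr hs; apply: le_anti.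
by rewrite (has_deg_le hr hs.2) (has_deg_le hs hr.2).
Qed.

Lemma has_deg_neq0 u r : has_deg_x u r -> u != 0.
Proof. by move=> [h _]; apply: contraNneq h => ->; rewrite pcoef0. Qed.

Lemma has_deg_monoP r (c : A) : c != 0 -> has_deg_x (monoP r c) r.
Proof. by move=> c0; split; [rewrite /= /mono eqxx|apply: dle_monoP]. Qed.

Lemma has_deg1 : has_deg_x (1 : puiseux A) 0.
Proof. exact/has_deg_monoP/oner_neq0. Qed.

Lemma has_degN u r : has_deg_x u r -> has_deg_x (- u : puiseux A) r.
Proof. by move=> [h1 h2]; split; [rewrite pcoefN oppr_eq0|apply: dleN]. Qed.

Lemma has_degD u v r s : has_deg_x u r -> dle v s -> s < r ->
  has_deg_x (u + v : puiseux A) r.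
Proof.
move=> [h1 h2] hv sr; split; first by rewrite pcoefD (hv r) ?addr0.
by apply: dleD => //; apply: dleW hv; apply: ltW.
Qed.

(** The exponents lie on a lattice bounded above and numbered downwards, so the largest exponent is
    a least index. *)
Lemma has_deg_ex u : u != 0 -> exists r, has_deg_x u r.
Proof.
move=> u0; have [p p0 hp] := puiseuxP u.
have [m /(_ m (lexx _)) hm] := laurent_lat p0 hp.
have supp e : u e != 0 -> exists k, e = lat_pt p m k.
  by rewrite hm; apply: lat_supp.
have p0' : 0 < p%:R :> rat by rewrite ltr0n.
have exk : exists k, u (lat_pt p m k) != 0.
  apply: contrapT => ne; move: u0; apply/negP; rewrite negbK; apply/eqP.
  apply: puis_ext => e; rewrite pcoef0; apply/eqP/negPn/negP => he.
  have [k ek] := supp _ he.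
  by apply: ne; exists k; rewrite -ek.
exists (lat_pt p m (ex_minn exk)); case: ex_minnP => k hk kmin; split => // e he.
apply/eqP/negPn/negP => ue.
have [j ej] := supp _ ue.
move: ue he; rewrite ej => /kmin kj; rewrite /lat_pt ltr_pM2r ?invr_gt0 //.
by rewrite ltrD2l ltrN2 ltr_nat ltnNge kj.
Qed.

Lemma dle_lat u p m : (0 < p)%N -> in_laurent p u -> dle u (m%:~R / p%:R) ->
  pser u = lat p m (fun k => u (lat_pt p m k)).
Proof.
move=> p0 hp hd; have p0' : 0 < p%:R :> rat by rewrite ltr0n.
apply: eq_lat => // e he; have /intrP[z hz] := hp.1 _ he.
have her : e <= m%:~R / p%:R by rewrite leNgt; apply: contra he => /hd ->.
have zm : z <= m by rewrite -(ler_int rat) -hz -ler_pdivlMr.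
exists `|m - z|%N; rewrite /lat_pt -[`|_|%N%:R]/(`|m - z|%N%:Z%:~R).
by rewrite abszE ger0_norm ?subr_ge0 // -intrB subKr -hz mulfK // gt_eqF.
Qed.

Lemma has_deg_lat u r : has_deg_x u r -> exists p m,
  [/\ (0 < p)%N, r = m%:~R / p%:R & pser u = lat p m (fun k => u (lat_pt p m k))].
Proof.
move=> [h1 h2]; have [p p0 hp] := puiseuxP u; exists p.
have p0' : p%:R != 0 :> rat by rewrite pnatr_eq0 -lt0n.
have /intrP[m hm] := hp.1 _ h1; exists m.
have er : r = m%:~R / p%:R by rewrite -hm mulfK.
by split => //; apply: dle_lat => //; rewrite -er.
Qed.

End Degree.

Section DegreeDomain.
Variable A : idomainType.
Implicit Types u v : puiseux A.

Lemma has_degM u v r s :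
  has_deg_x u r -> has_deg_x v s -> has_deg_x (u * v : puiseux A) (r + s).
Proof.
move=> [u1 u2] [v1 v2]; split; last exact: dleM.
by rewrite coefM_top // mulf_neq0.
Qed.

Lemma has_deg_prod I (s : seq I) (F : I -> puiseux A) (d : I -> rat) :
  (forall i, has_deg_x (F i) (d i)) ->
  has_deg_x (\prod_(i <- s) F i : puiseux A) (\sum_(i <- s) d i).
Proof.
move=> h; elim: s => [|i s IH]; first by rewrite !big_nil; apply: has_deg1.
by rewrite !big_cons; apply: has_degM.
Qed.

Lemma has_degX u r n : has_deg_x u r -> has_deg_x (u ^+ n : puiseux A) (r *+ n).
Proof.
move=> h; elim: n => [|n IH]; first by rewrite mulr0n; apply: has_deg1.
by rewrite exprS mulrS; apply: has_degM.
Qed.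

End DegreeDomain.

Section Twist.
Variables (A B : comNzRingType) (g : rat -> A -> B).
Hypothesis gD : forall e x y, g e (x + y) = g e x + g e y.
Hypothesis gM : forall a b x y, g (a + b) (x * y) = g a x * g b y.

Lemma twist0 e : g e 0 = 0.
Proof. by apply: (@addrI _ (g e 0)); rewrite -gD !addr0. Qed.

Lemma in_laurent_twist p (phi : rat -> A) :
  in_laurent p phi -> in_laurent p (fun e => g e (phi e)).
Proof.
move=> [h1 [M h2]]; split; last by exists M => e /h2 ->; rewrite twist0.
move=> e he; apply: h1; apply: contraNneq he => ->.
by rewrite twist0.
Qed.

Lemma is_puiseux_twist (u : puiseux A) : is_puiseux (fun e => g e (u e)).
Proof. by have [p p0 h] := puiseuxP u; exists p => //; apply: in_laurent_twist. Qed.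

(** With [g] independent of the exponent this is a change of coefficients; with
    [g e x = chi e ^+ j * x] it is conjugation. *)
Definition twist u := mkP (is_puiseux_twist u).

Lemma twistD u v : twist (u + v) = twist u + twist v.
Proof. by apply: puis_ext => e /=; rewrite gD. Qed.

Lemma twistB u v : twist (u - v) = twist u - twist v.
Proof. by apply/eqP; rewrite -subr_eq opprK -twistD subrK. Qed.

Lemma twistM u v : twist (u * v) = twist u * twist v.
Proof.
have [p [m [U [V [p0 eu ev]]]]] := is_puiseux_lat2 (puiseuxP u) (puiseuxP v).
have tw (w : puiseux A) W : pser w = lat p m W ->
    pser (twist w) = lat p m (fun k => g (lat_pt p m k) (W k)).
  move=> ew; apply: eq_lat => // [k|e /=].
    by rewrite /= ew lat_in.
  move=> h; apply: (@lat_supp _ p m W) => //; rewrite -ew; apply: contraNneq h => ->.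
  by rewrite twist0.
suff E : pser (twist (u * v)) = pser (twist u * twist v) by exact: val_inj.
rewrite (coef_latM p0 (tw _ _ eu) (tw _ _ ev)).
apply: eq_lat => // [k|e he]; last first.
  apply: (@lat_supp _ p (m + m) (cauchy U V)) => //; rewrite -(coef_latM p0 eu ev).
  by apply: contraNneq he => /= ->; rewrite twist0.
rewrite /= [conv u v](coef_latM p0 eu ev) lat_in // /cauchy.
rewrite (big_morph _ (gD _) (twist0 _)); apply: eq_bigr => i _.
have ik : (i <= k)%N by rewrite -ltnS.
by rewrite -gM -(lat_pt_sub m m p0 ik) (addrC (lat_pt p m i)) subrK.
Qed.

Lemma dle_twist u r : dle u r -> dle (twist u) r.
Proof. by move=> h e /h /= ->; rewrite twist0. Qed.

End Twist.

Section MapPuiseux.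
Variables (A B : comNzRingType) (h : {rmorphism A -> B}).

Definition map_puis : puiseux A -> puiseux B :=
  @twist A B (fun _ => h) (fun=> rmorphD h).

Lemma map_puisE u e : map_puis u e = h (u e).
Proof. by []. Qed.

Fact map_puis_is_zmod_morphism : zmod_morphism map_puis.
Proof. exact: twistB. Qed.
Fact map_puis_is_monoid_morphism : monoid_morphism map_puis.
Proof.
split; last by move=> u v; apply: twistM => *; rewrite rmorphM.
by apply: puis_ext => e; rewrite map_puisE !pcoef1 rmorph_nat.
Qed.
HB.instance Definition _ := GRing.isZmodMorphism.Build _ _ map_puis
  map_puis_is_zmod_morphism.
HB.instance Definition _ := GRing.isMonoidMorphism.Build _ _ map_puis
  map_puis_is_monoid_morphism.

Lemma map_monoP d c : map_puis (monoP d c) = monoP d (h c).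
Proof. by apply: puis_ext => e /=; rewrite /mono; case: ifP; rewrite ?rmorph0. Qed.

Lemma dle_map u r : dle u r -> dle (map_puis u) r.
Proof. exact: dle_twist. Qed.

End MapPuiseux.

Section Substitution.
Variable A : comNzRingType.

Definition cstpuis : A -> puiseux A := monoP 0.

Fact cstpuis_is_zmod_morphism : zmod_morphism cstpuis.
Proof.
by move=> c d; apply: puis_ext => e; rewrite pcoefB /= /mono; case: ifP; rewrite ?subr0.
Qed.
Fact cstpuis_is_monoid_morphism : monoid_morphism cstpuis.
Proof. by split => // c d; rewrite /cstpuis monoPM addr0. Qed.
HB.instance Definition _ := GRing.isZmodMorphism.Build _ _ cstpuis cstpuis_is_zmod_morphism.
HB.instance Definition _ := GRing.isMonoidMorphism.Build _ _ cstpuis cstpuis_is_monoid_morphism.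

Lemma monoPX d n : monoP d (1 : A) ^+ n = monoP (d *+ n) 1.
Proof.
elim: n => [|n IH]; first by rewrite mulr0n.
by rewrite exprS IH monoPM mulr1 mulrS.
Qed.

Definition polyx : {poly A} -> puiseux A :=
  horner_eval (monoP 1 1 : puiseux A) \o map_poly cstpuis.
HB.instance Definition _ := GRing.RMorphism.copy polyx
  (horner_eval (monoP 1 1 : puiseux A) \o map_poly cstpuis).

Lemma polyxE (q : {poly A}) n : (size q <= n)%N ->
  polyx q = \sum_(a < n) monoP a%:R q`_a.
Proof.
move=> sq; rewrite /polyx /= /horner_eval (@horner_coef_wide _ n); last first.
  exact: leq_trans (size_poly _ _) sq.
apply: eq_bigr => a _; rewrite coef_map /cstpuis monoPX monoPM mulr1 add0r.
by rewrite -[1 *+ a]/(a%:R).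
Qed.

Lemma polyxC c : polyx c%:P = cstpuis c.
Proof. by rewrite /polyx /= map_polyC /= /horner_eval hornerC. Qed.

Lemma coef_polyx (q : {poly A}) (a : nat) : polyx q a%:R = q`_a.
Proof.
rewrite (@polyxE q (maxn (size q) a.+1)) ?leq_maxl // pcoef_sum.
have ha : (a < maxn (size q) a.+1)%N by rewrite leq_maxr.
rewrite (bigD1 (Ordinal ha)) //= /mono eqxx big1 ?addr0 // => i ia.
by rewrite eqr_nat eq_sym ifF //; apply/negbTE; apply: contra ia => /eqP ia; apply/eqP/val_inj.
Qed.

Lemma polyx_supp (q : {poly A}) e : polyx q e != 0 -> exists a : nat, e = a%:R.
Proof.
rewrite (@polyxE q (size q)) // pcoef_sum => h; apply: contrapT => ne.
move: h; rewrite big1 ?eqxx // => i _ /=; rewrite /mono ifF //.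
by apply/negP => /eqP ei; apply: ne; exists i.
Qed.

Lemma polyx_inj : injective polyx.
Proof. by move=> p q pq; apply/polyP => i; rewrite -!coef_polyx pq. Qed.

Lemma dle_polyx (q : {poly A}) (n : nat) : (size q <= n.+1)%N -> dle (polyx q) n%:R.
Proof.
move=> sq; rewrite (polyxE sq); apply: dle_sum => i _.
by apply: dleW (@dle_monoP _ _ _); rewrite ler_nat -ltnS.
Qed.

Lemma has_deg_polyx (q : {poly A}) : q != 0 -> has_deg_x (polyx q) (size q).-1%:R.
Proof.
move=> q0; split; first by rewrite coef_polyx -/(lead_coef q) lead_coef_eq0.
by apply: dle_polyx; rewrite prednK // size_poly_gt0.
Qed.

Lemma peval_horner (f : {poly {poly A}}) (u : puiseux A) e :
  peval f u e = (map_poly polyx f).[u] e.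
Proof.
rewrite (@horner_coef_wide _ (size f)) ?size_poly // pcoef_sum; apply: eq_bigr => b _.
have -> : (map_poly polyx f)`_b = \sum_(a < size f`_b) monoP a%:R f`_b`_a.
  by rewrite coef_map; apply: polyxE.
rewrite mulr_suml pcoef_sum.
by apply: eq_bigr => a _; rewrite coef_monoM pserX.
Qed.

End Substitution.

(** * The field of Puiseux series and Hensel's lemma *)

Definition latP (A : comNzRingType) (p : nat) (p0 : (0 < p)%N) (m : int)
  (U : nat -> A) : puiseux A := mkP (is_puiseux_lat m U p0).

Lemma pser_one (A : comNzRingType) p : (0 < p)%N ->
  pser (1 : puiseux A) = lat p 0 (fun k => (k == 0)%:R).
Proof.
move=> p0; have p0' : p%:R != 0 :> rat by rewrite pnatr_eq0 -lt0n.
apply: eq_lat => // [k|e].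
  rewrite pcoef1 /lat_pt sub0r mulf_eq0 invr_eq0 (negPf p0') orbF oppr_eq0.
  by rewrite pnatr_eq0.
rewrite pcoef1; case: (e =P 0) => [-> _|_]; last by rewrite eqxx.
by exists 0; rewrite /lat_pt subr0 mul0r.
Qed.

Section PuiseuxField.
Variable F : fieldType.

Lemma puis_inv_ex (u : puiseux F) : u != 0 -> exists v, v * u = 1.
Proof.
move=> /has_deg_ex[r hr]; have [p [m [p0 er eu]]] := has_deg_lat hr.
have U0 : u (lat_pt p m 0) != 0 by rewrite /lat_pt subr0 -er; case: hr.
move: (fun k => u _) eu U0 => /= U eu; rewrite eu lat_in // => U0.
(* The recursion solves \sum_(i <= k) V_i U_(k-i) = (k == 0) for V_k, dividing by the leading
   coefficient U_0. *)
pose step k (V : nat -> F) := (U 0%N)^-1 *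
  ((k == 0%N)%:R - \sum_(i < k) V i * U (k - i)%N).
have [|V hV] := @strong_recursion _ 0 step.
  move=> k g g' h; rewrite /step; congr (_ * (_ - _)); apply: eq_bigr => i _.
  by rewrite h.
exists (latP p0 (- m) V).
suff E : pser (latP p0 (- m) V * u) = pser 1 by exact: val_inj.
have ev : pser (latP p0 (- m) V) = lat p (- m) V by [].
rewrite (coef_latM p0 ev eu) addNr (pser_one _ p0); congr lat; apply/funext => k.
rewrite /cauchy big_ord_recr /= subnn [V k in X in _ + X]hV /step.
by rewrite mulrAC mulVf // mul1r addrC subrK.
Qed.

Definition puis_inv (u : puiseux F) : puiseux F :=
  if pselect (exists v, v * u = 1) is left h then projT1 (cid h) else 0.

Fact puis_mulVf (u : puiseux F) : u != 0 -> puis_inv u * u = 1.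
Proof.
by move=> /puis_inv_ex h; rewrite /puis_inv; case: pselect => // h'; case: cid.
Qed.

Fact puis_inv0 : puis_inv 0 = 0.
Proof.
rewrite /puis_inv; case: pselect => // h; have [v /eqP] := h.
by rewrite mulr0 eq_sym oner_eq0.
Qed.

HB.instance Definition _ := GRing.ComNzRing_isField.Build (puiseux F)
  puis_mulVf puis_inv0.

Lemma has_degV (u : puiseux F) r : has_deg_x u r -> has_deg_x ((u^-1)%R : puiseux F) (- r).
Proof.
move=> hu; have u0 := has_deg_neq0 hu.
have /has_deg_ex[s hs] : u^-1 != 0 by rewrite invr_eq0.
have := has_degM hu hs; rewrite mulfV // => h.
have rs := has_deg_inj h (has_deg1 F).
by suff -> : - r = s by []; lra.
Qed.

Lemma common_level (u : nat -> puiseux F) n :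
  exists2 p : nat, (0 < p)%N & forall i, (i < n)%N -> in_laurent p (u i).
Proof.
elim: n => [|n [p p0 hp]]; first by exists 1%N.
have [q q0 hq] := puiseuxP (u n); exists (p * q)%N; first by rewrite muln_gt0 p0.
move=> i; rewrite ltnS leq_eqVlt => /orP[/eqP ->|/hp h].
  by rewrite mulnC; apply: in_laurent_mono.
exact: in_laurent_mono.
Qed.

(** Bezout with degree control: the first cofactor is reduced modulo [g], and the bound on [r] then
    forces the bound on the second one. *)
Lemma coprime_split (g h r : {poly F}) : coprimep g h -> g != 0 -> h != 0 ->
  (size r < size (g * h)%R)%N ->
  exists xy : {poly F} * {poly F}, [/\ (size xy.1 < size g)%N, (size xy.2 < size h)%N
               & xy.1 * h + g * xy.2 = r].
Proof.
move=> /Bezout_coprimepP[[u v] /= huv] g0 h0 hr.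
have [c c0 huv1] : exists2 c : F, c != 0 & u * g + v * h = c%:P.
  by move: huv; rewrite -size_poly_eq1 => /size_poly1P.
pose z := c^-1 *: (r * v); pose y := c^-1 *: (r * u) + z %/ g * h.
have er : z %% g * h + g * y = r.
  have -> : z %% g = z - z %/ g * g by apply/eqP; rewrite eq_sym subr_eq addrC -divp_eq.
  transitivity (c^-1 *: (r * (u * g + v * h))).
    by rewrite /y /z -!mul_polyC; ring.
  by rewrite huv1 mulrC mul_polyC scalerA mulVf // scale1r.
have sx : (size (z %% g)%R < size g)%N by rewrite ltn_modp.
exists (z %% g, y); split => //=.
have [->|y0] := eqVneq y 0; first by rewrite size_poly0 size_poly_gt0.
have : (size (g * y)%R < size (g * h)%R)%N.
  have -> : g * y = r - z %% g * h by rewrite -er addrC addKr.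
  apply: leq_ltn_trans (size_polyD _ _) _; rewrite gtn_max hr size_polyN.
  have [->|x0] := eqVneq (z %% g) 0.
    by rewrite mul0r size_poly0 size_poly_gt0 mulf_neq0.
  rewrite !size_mul //; move: sx (size_poly_gt0 h); rewrite h0.
  by case: (size h) => // k; rewrite !addnS /= ltn_add2r.
rewrite !size_mul //; move: (size_poly_gt0 g); rewrite g0.
by case: (size g) => // k _; rewrite !addSn /= ltn_add2l.
Qed.

(** In order k > 0 the equation reads g_k h_0 + g_0 h_k = [rest], where [rest] involves lower orders
    only. It is solvable because g_0 and h_0 are coprime, with g_k and h_k of degrees below those of
    g_0 and h_0. *)
Lemma hensel_seq (a : nat -> {poly F}) (g0 h0 : {poly F}) :
  a 0%N = g0 * h0 -> coprimep g0 h0 -> g0 != 0 -> h0 != 0 ->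
  (forall k, (0 < k)%N -> (size (a k) < size (a 0))%N) ->
  exists g h : nat -> {poly F}, [/\ g 0%N = g0, h 0%N = h0,
    forall k, (0 < k)%N -> (size (g k) < size g0)%N,
    forall k, (0 < k)%N -> (size (h k) < size h0)%N
    & forall k, cauchy g h k = a k].
Proof.
move=> a0 cop g00 h00 hs.
have bezP (r : {poly F}) : {xy : {poly F} * {poly F} | (size r < size (g0 * h0)%R)%N ->
    [/\ (size xy.1 < size g0)%N, (size xy.2 < size h0)%N
      & xy.1 * h0 + g0 * xy.2 = r]}.
  apply: cid; case: (boolP (size r < size (g0 * h0)%R)%N) => [hr|_]; last by exists 0.
  by have [xy hxy] := coprime_split cop g00 h00 hr; exists xy.
pose rest (gh : nat -> {poly F} * {poly F}) k :=
  a k - \sum_(i < k.+1 | (0 < i < k)%N) (gh i).1 * (gh (k - i)%N).2.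
pose step k gh := if k == 0%N then (g0, h0) else sval (bezP (rest gh k)).
have [|gh hgh] := @strong_recursion _ (0, 0) step.
  move=> k g g' h; rewrite /step /rest; case: eqP => // _.
  congr (sval (bezP (_ - _))); apply: eq_bigr => i /andP[i0 ik].
  rewrite h // h //; lia.
have gh0 : gh 0%N = (g0, h0) by rewrite hgh.
have key k : (0 < k)%N -> [/\ (size (gh k).1 < size g0)%N,
    (size (gh k).2 < size h0)%N & (gh k).1 * h0 + g0 * (gh k).2 = rest gh k].
  elim/ltn_ind: k => k IH k0; rewrite [gh k]hgh /step gtn_eqF //.
  apply: (svalP (bezP (rest gh k))); rewrite -a0.
  apply: leq_ltn_trans (size_polyD _ _) _; rewrite gtn_max hs //= size_polyN.
  apply: leq_ltn_trans (size_sum _ _ _) _; rewrite -[X in (_ < X)%N]prednK; last first.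
    by rewrite size_poly_gt0 a0 mulf_neq0.
  rewrite ltnS; apply/bigmax_leqP => i /andP[i0 ik].
  have [s1 _ _] := IH _ ik i0.
  have ki0 : (0 < k - i)%N by rewrite subn_gt0.
  have kik : (k - i < k)%N by rewrite ltn_subrL i0.
  have [_ s2 _] := IH _ kik ki0.
  apply: leq_trans (size_polyMleq _ _) _.
  rewrite a0 size_mul //; move: s1 s2.
  move: (size (gh i).1) (size (gh (k - i)%N).2) (size g0) (size h0) => ? ? ? ?.
  by lia.
exists (fun k => (gh k).1), (fun k => (gh k).2); rewrite gh0; split => //=.
- by move=> k /key[].
- by move=> k /key[].
case=> [|k]; first by rewrite /cauchy big_ord_recl big_ord0 /= gh0 addr0 a0.
have [_ _ e] := key k.+1 isT.
rewrite /cauchy (bigD1 ord0) //= (bigD1 ord_max) //= subnn subn0 gh0 /=.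
rewrite addrA [_ + _ * h0]addrC e /rest -[RHS](subrK (\sum_(i < k.+2 | (0 < i < k.+1)%N)
  (gh i).1 * (gh (k.+1 - i)%N).2)); congr (_ + _).
apply: eq_bigl => i; rewrite -val_eqE /= -(val_eqE i) /= lt0n; congr (_ && _).
by rewrite ltn_neqAle -ltnS ltn_ord andbT.
Qed.

Lemma hensel (p : nat) (p0 : (0 < p)%N) (Q : {poly puiseux F}) (g0 h0 : {poly F}) :
  Q \is monic -> (forall i, in_laurent p Q`_i) -> (forall i, dle Q`_i 0) ->
  \poly_(i < size Q) (Q`_i 0) = g0 * h0 -> g0 \is monic -> h0 \is monic ->
  coprimep g0 h0 ->
  exists G H : {poly puiseux F}, [/\ Q = G * H, size G = size g0 & size H = size h0].
Proof.
move=> mQ lQ dQ eQ mg mh cop.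
have Qn : Q`_(size Q).-1 = 1 by exact/eqP.
have sQ : (0 < size Q)%N by rewrite size_poly_gt0 monic_neq0.
(* [a k] gathers the coefficients of x^(-k/p) in all coefficients of [Q]. As [Q] is monic, only
   [a 0] reaches the full degree. *)
pose a k := \poly_(i < size Q) (Q`_i (lat_pt p 0 k)).
have lat0 : lat_pt p 0 0 = 0 by rewrite /lat_pt subr0 mul0r.
have a0 : a 0%N = g0 * h0 by rewrite -eQ /a lat0.
have sa0 : size (a 0%N) = size Q.
  by rewrite size_poly_eq // lat0 Qn pcoef1 eqxx oner_eq0.
have ptn0 k : (0 < k)%N -> lat_pt p 0 k != 0.
  move=> k0; rewrite /lat_pt sub0r mulf_neq0 ?oppr_eq0 ?invr_eq0 ?pnatr_eq0 -?lt0n //.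
have Qlat m : pser Q`_m = lat p 0 (fun k => (a k)`_m).
  rewrite {1}(@dle_lat _ Q`_m p 0) ?mul0r //; congr lat; apply/funext => k.
  by rewrite coef_poly; case: ltnP => // /(nth_default 0) ->; rewrite pcoef0.
have [||k k0|g [h [g0E h0E sg sh gha]]] :=
    @hensel_seq a g0 h0 a0 cop; try exact: monic_neq0.
  rewrite sa0 -[X in (_ < X)%N](prednK sQ) ltnS; apply/leq_sizeP => j.
  rewrite leq_eqVlt => /orP[/eqP <-|jn].
    by rewrite coef_poly prednK // leqnn Qn pcoef1 (negPf (ptn0 _ k0)).
  by rewrite coef_poly -(prednK sQ) ltnS leqNgt jn.
pose lift (w : nat -> {poly F}) (n : nat) : {poly puiseux F} :=
  \poly_(i < n) latP p0 0 (fun k => (w k)`_i).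
have lift_coef (w : nat -> {poly F}) n m : (forall k, (size (w k) <= n)%N) ->
    pser (lift w n)`_m = lat p 0 (fun k => (w k)`_m).
  move=> hw; rewrite coef_poly; case: ltnP => // nm.
  apply: eq_lat => // [k|e]; last by rewrite pcoef0 eqxx.
  by rewrite pcoef0 nth_default // (leq_trans (hw k)).
have lift_size (w : nat -> {poly F}) w0 : w0 \is monic -> w 0%N = w0 ->
    (forall k, (0 < k)%N -> (size (w k) < size w0)%N) -> size (lift w (size w0)) = size w0.
  move=> mw ew sw; apply: size_poly_eq; apply/eqP => /(congr1 (fun u => pser u 0)).
  rewrite pcoef0 -lat0 [LHS]lat_in // ew -/(lead_coef w0) (monicP mw).
  by apply/eqP/oner_neq0.
have sgk k : (size (g k) <= size g0)%N.
  by case: k => [|k]; [rewrite g0E|apply/ltnW/sg].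
have shk k : (size (h k) <= size h0)%N.
  by case: k => [|k]; [rewrite h0E|apply/ltnW/sh].
exists (lift g (size g0)), (lift h (size h0)); split; last 2 first.
- exact: lift_size.
- exact: lift_size.
apply/polyP => m; rewrite coefM; apply: puis_ext => e; rewrite Qlat pcoef_sum.
transitivity (\sum_(i < m.+1)
    lat p 0 (cauchy (fun k => (g k)`_i) (fun k => (h k)`_(m - i)%N)) e); last first.
  apply: eq_bigr => i _.
  by rewrite (coef_latM p0 (lift_coef _ _ _ sgk) (lift_coef _ _ _ shk)) addr0.
rewrite /lat /=; case: ifP => _; last by rewrite big1.
rewrite -gha /cauchy coef_sum exchange_big /=; apply: eq_bigr => i _.
by rewrite coefM.
Qed.

End PuiseuxField.

(** * The Newton-Puiseux theorem *)

Lemma coef_exp_XsubC (R : comNzRingType) (c : R) n :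
  (('X - c%:P) ^+ n.+1)`_n = - c *+ n.+1.
Proof.
elim: n => [|n IH]; first by rewrite expr1 coefB coefX coefC /= sub0r.
have top : (('X - c%:P) ^+ n.+1)`_n.+1 = 1.
  have /monicP := monic_exp n.+1 (monicXsubC c).
  by rewrite /lead_coef size_exp_XsubC.
rewrite exprS mulrBl coefB coefXM coefCM /= IH top mulr1.
by rewrite [in RHS]mulrSr.
Qed.

Section NewtonPuiseux.
Variable F : numClosedFieldType.

(* Since Q`_n = 0, the reduction of Q is not a power of a linear polynomial. *)
Lemma newton_factor (Q : {poly puiseux F}) n :
  Q \is monic -> size Q = n.+2 -> Q`_n = 0 -> (forall i, dle Q`_i 0) ->
  (exists2 i : nat, (i < n.+1)%N & Q`_i 0 != 0) ->
  exists G H : {poly puiseux F}, Q = G * H /\ (1 < size G < n.+2)%N.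
Proof.
move=> mQ sQ Qn dQ [i0 i0n Qi0].
have [p p0 hp'] := common_level (fun i => Q`_i) (size Q).
have hp i : in_laurent p Q`_i.
  have [/hp'//|/(nth_default 0) ->] := ltnP i (size Q).
  by split; [move=> e; rewrite pcoef0 eqxx|exists 0 => e _; rewrite pcoef0].
pose q0 := \poly_(i < size Q) (Q`_i 0).
have Qtop : Q`_n.+1 = 1 by move/monicP: mQ; rewrite /lead_coef sQ.
have sq0 : size q0 = n.+2.
  by rewrite /q0 sQ size_poly_eq //= Qtop pcoef1 eqxx oner_eq0.
have mq0 : q0 \is monic.
  by apply/monicP; rewrite /lead_coef sq0 coef_poly sQ ltnSn Qtop pcoef1 eqxx.
have [|c rc] := closed_rootP q0 _; first by rewrite sq0.
have [m [q hq q0E]] := multiplicity_XsubC q0 c.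
have {hq} rq : ~~ root q c by apply: (implyP hq); exact: monic_neq0.
have mX : ('X - c%:P) ^+ m \is monic by rewrite monic_exp ?monicXsubC.
have mq : q \is monic by move: mq0; rewrite q0E monicMr.
have m0 : (0 < m)%N.
  by case: m {mX} q0E => // q0E; move: rc rq; rewrite q0E expr0 mulr1 => ->.
have sE : (size q + m = n.+2)%N.
  by move: sq0; rewrite q0E size_Mmonic ?monic_neq0 // size_exp_XsubC addnS.
have q0n : q0`_n = 0 by rewrite coef_poly sQ ltnW ?ltnSn // Qn pcoef0.
(* Otherwise the reduction is (X - c)^(n+1); its vanishing coefficient -(n+1) c gives c = 0 in
   characteristic 0, against the nonzero coefficient at [i0]. *)
have q1 : size q != 1%N.
  apply/eqP => s1; have mn : m = n.+1 by move: sE; rewrite s1; case.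
  have qE : q = 1.
    move: mq; rewrite (size1_polyC (eq_leq s1)) => /monicP.
    by rewrite lead_coefC => ->.
  move: q0n; rewrite q0E qE mul1r mn coef_exp_XsubC => /eqP.
  rewrite mulrn_eq0 /= oppr_eq0 => /eqP cE.
  move: Qi0; have -> : Q`_i0 0 = q0`_i0 by rewrite coef_poly sQ ltnW.
  by rewrite q0E qE mul1r mn cE subr0 coefXn ltn_eqF // eqxx.
have sq : (0 < size q)%N by rewrite size_poly_gt0 monic_neq0.
have cop : coprimep (('X - c%:P) ^+ m) q.
  by rewrite coprimep_expl // coprimep_sym coprimep_XsubC.
have q0E' : q0 = ('X - c%:P) ^+ m * q by rewrite mulrC.
have [G [H [QE sG _]]] := hensel p0 mQ hp dQ q0E' mX mq cop.
exists G, H; split => //; rewrite sG size_exp_XsubC ltnS m0 /=.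
by move: sE q1 sq; case: (size q) => [|[|k]] // <- _ _; rewrite addSn !ltnS leq_addl.
Qed.

(** [s] is the extreme slope of the Newton polygon, the largest deg P_i / (n - i). Scaling the
    unknown by x^s brings all coefficients to degree at most 0, with equality for one below the
    top. *)
Lemma sum_root_slope (P : {poly puiseux F}) n : P \is monic -> size P = n.+1 ->
  (exists2 i : nat, (i < n)%N & P`_i != 0) ->
  exists s : rat, (forall i, (i < n)%N -> dle P`_i (s * (n - i)%:R)) /\
    exists2 i : nat, (i < n)%N & has_deg_x P`_i (s * (n - i)%:R).
Proof.
move=> mP sP [i1 i1n Pi1].
pose dg (u : puiseux F) : rat :=
  if pselect (exists r, has_deg_x u r) is left h then projT1 (cid h) else 0.
have dgP (u : puiseux F) : u != 0 -> has_deg_x u (dg u).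
  by move=> /has_deg_ex h; rewrite /dg; case: pselect => // h'; case: cid.
pose sl (i : 'I_n) := dg P`_i / (n - i)%:R.
have Pi1' : P`_(Ordinal i1n) != 0 by [].
case: (@Order.TotalTheory.arg_maxP _ _ _ (Ordinal i1n) (fun i : 'I_n => P`_i != 0) sl Pi1').
move=> i Pi imax; have ni (j : 'I_n) : 0 < (n - j)%:R :> rat.
  by rewrite ltr0n subn_gt0.
exists (sl i); split; last first.
  by exists i => //; rewrite /sl divfK ?gt_eqF //; apply: dgP.
move=> j jn; have [->|Pj] := eqVneq P`_j 0; first exact: dle0.
have := imax (Ordinal jn) Pj; rewrite {1}/sl /= => h.
apply: dleW (dgP _ Pj).2; rewrite -ler_pdivrMr //; exact: (ni (Ordinal jn)).
Qed.

Lemma puiseux_closed (P : {poly puiseux F}) : (1 < size P)%N -> exists x, root P x.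
Proof.
have [N] := ubnP (size P); elim: N P => // N IH P sPN sP.
have {sPN IH} IH (G : {poly puiseux F}) : (1 < size G < size P)%N -> exists x, root G x.
  by case/andP => s1 s2; apply: IH => //; apply: leq_trans s2 _.
have P0 : P != 0 by rewrite -size_poly_gt0 ltnW.
wlog mP : P P0 sP IH / P \is monic.
  move=> W; have lc0 : (lead_coef P)^-1 != 0 by rewrite invr_eq0 lead_coef_eq0.
  have [||||x] := W ((lead_coef P)^-1 *: P).
  - by rewrite scaler_eq0 negb_or lc0.
  - by rewrite size_scale.
  - by rewrite size_scale.
  - by apply/monicP; rewrite lead_coefZ mulVf // lead_coef_eq0.
  by rewrite rootZ //; exists x.
have [n sPn] : exists n, size P = n.+2 by case: (size P) sP => [|[|n]] // _; exists n.
(* A translation of the unknown by -P_n / (n+1) removes the coefficient below the top; this uses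
   characteristic 0. *)
wlog Pn : P P0 sP IH mP sPn / P`_n = 0.
  move=> W; pose c := - (P`_n / n.+1%:R).
  pose P1 := P \Po ('X + c%:P).
  have s1 : size P1 = size P by rewrite size_comp_poly2 // size_XaddC.
  have m1 : P1 \is monic.
    apply/monicP; rewrite lead_coef_comp ?size_XaddC //.
    by rewrite lead_coefXaddC expr1n mulr1 (monicP mP).
  have P1n : P1`_n = 0.
    have PE : P = 'X^(n.+1) + P`_n *: 'X^n + \poly_(i < n) P`_i.
      apply/polyP => i; rewrite !coefD coefZ !coefXn coef_poly.
      have [ni|ni|->] := ltngtP i n.
      - by rewrite mulr0 ltn_eqF ?add0r // ltnW.
      - rewrite mulr0 !addr0; have [->|h] := eqVneq i n.+1.
          by move/monicP: mP; rewrite /lead_coef sPn.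
        by rewrite nth_default // sPn ltn_neqAle eq_sym h.
      by rewrite mulr1 ltn_eqF // add0r addr0.
    have Xc : 'X + c%:P = 'X - (- c)%:P by rewrite polyCN opprK.
    rewrite /P1 {1}PE !comp_polyD comp_polyZ !rmorphXn /= !comp_polyX Xc !coefD.
    rewrite coef_exp_XsubC opprK coefZ.
    have -> : (('X - (- c)%:P) ^+ n)`_n = 1.
      have /monicP := monic_exp n (monicXsubC (- c)).
      by rewrite /lead_coef size_exp_XsubC.
    have -> : ((\poly_(i < n) P`_i) \Po ('X - (- c)%:P))`_n = 0.
      by apply: nth_default; rewrite size_comp_poly2 ?size_XsubC // size_poly.
    have cE : c *+ n.+1 = - P`_n.
      rewrite -mulr_natr /c mulNr divfK //.
      by rewrite -(rmorph_nat (@cstpuis F)) fmorph_eq0 pnatr_eq0.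
    by rewrite addr0 mulr1 cE addNr.
  have [||||||x] := W P1; rewrite ?s1 //.
  - by rewrite monic_neq0.
  - by rewrite /P1 root_comp; exists ('X + c%:P).[x].
have [[i0 i0n Pi0]|allz] := pselect (exists2 i : nat, (i < n.+1)%N & P`_i != 0); last first.
  exists 0; rewrite rootE horner_coef0; apply/eqP; apply: contrapT => /eqP h.
  by apply: allz; exists 0.
have [s [sle [i1 i1n si1]]] := sum_root_slope mP sPn (ex_intro2 _ _ i0 i0n Pi0).
pose z : puiseux F := monoP s 1.
have zV : monoP (- s) 1 * z = 1 by rewrite monoPM addNr mulr1.
have zVX i : monoP (- s) 1 ^+ i * z ^+ i = 1 by rewrite -exprMn zV expr1n.
(* [Q] is P(x^s X) divided by x^(s (n+1)); a proper factor of [Q] has smaller degree, and its roots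
   give roots of [P]. *)
pose Q := \poly_(i < n.+2) (P`_i * monoP (- s) 1 ^+ (n.+1 - i)).
have Ptop : P`_n.+1 = 1 by move/monicP: mP; rewrite /lead_coef sPn.
have sQ : size Q = n.+2 by rewrite size_poly_eq //= subnn mulr1 Ptop oner_neq0.
have mQ : Q \is monic.
  by apply/monicP; rewrite /lead_coef sQ coef_poly ltnSn subnn mulr1.
have QP x : z ^+ n.+1 * Q.[x] = P.[z * x].
  rewrite (horner_coef_wide _ (eq_leq sQ)) (horner_coef_wide _ (eq_leq sPn)).
  rewrite mulr_sumr; apply: eq_bigr => i _; rewrite coef_poly ltn_ord exprMn.
  rewrite -[in z ^+ n.+1](subnK (ltn_ord i : (i <= n.+1)%N)) exprD.
  transitivity (P`_i * (z ^+ i * x ^+ i) *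
     (monoP (- s) 1 ^+ (n.+1 - i) * z ^+ (n.+1 - i))); first by ring.
  by rewrite zVX mulr1.
have mdeg i : has_deg_x ((monoP (- s) 1 : puiseux F) ^+ (n.+1 - i)) (- (s * (n.+1 - i)%:R)).
  rewrite monoPX -mulNr mulr_natr; apply: has_deg_monoP; exact: oner_neq0.
have [|i||G [H [QGH sG]]] := newton_factor mQ sQ.
- by rewrite coef_poly ltnW // Pn mul0r.
- rewrite coef_poly; case: ltnP => [i2|_]; last exact: dle0.
  move: i2; rewrite ltnS leq_eqVlt => /orP[/eqP->|i2].
    by rewrite Ptop subnn mulr1; apply: dle1.
  have := dleM (sle _ i2) (mdeg i).2.
  by rewrite subrr.
- exists i1 => //; rewrite coef_poly ltnW //.
  by have := has_degM si1 (mdeg i1); rewrite subrr => -[].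
have [|x Gx] := IH G; first by rewrite sPn.
exists (z * x); rewrite rootE -QP QGH hornerM (rootP Gx) mul0r mulr0 //.
Qed.

End NewtonPuiseux.

(** * Conjugates *)

(* Realized below by e |-> exp(2 pi i e).  Multiplying the coefficient of x^e by
   chi e ^+ j yields the j-th conjugate of a Puiseux series. *)
Record charQ (F : fieldType) := CharQ {
  chi :> rat -> F;
  chiD : forall a b, chi (a + b) = chi a * chi b;
  chi_int : forall e, (chi e == 1) = (e \is a Num.int) }.

Section Conjugation.
Variables (F : numClosedFieldType) (chi : charQ F).
Implicit Types u v : puiseux F.

Lemma chi0 : chi 0 = 1.
Proof. by apply/eqP; rewrite chi_int. Qed.

Lemma chi_neq0 e : chi e != 0.
Proof.
have : chi e * chi (- e) != 0 by rewrite -chiD subrr chi0 oner_neq0.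
by apply: contraNneq => ->; rewrite mul0r.
Qed.

Lemma chiN e : chi (- e) = (chi e)^-1.
Proof.
by apply: (mulfI (chi_neq0 e)); rewrite -chiD subrr chi0 mulfV // chi_neq0.
Qed.

Lemma chiX e n : chi e ^+ n = chi (e * n%:R).
Proof.
elim: n => [|n IH]; first by rewrite mulr0 chi0.
by rewrite exprS IH -chiD -[n.+1]add1n natrD mulrDr mulr1.
Qed.

Fact sig_subproof j e x y : chi e ^+ j * (x + y) = chi e ^+ j * x + chi e ^+ j * y.
Proof. exact: mulrDr. Qed.

Definition sig (j : nat) : puiseux F -> puiseux F :=
  @twist F F (fun e x => chi e ^+ j * x) (sig_subproof j).

Lemma sigE j u e : sig j u e = chi e ^+ j * u e.
Proof. by []. Qed.

Fact sig_is_zmod_morphism j : zmod_morphism (sig j).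
Proof. exact: twistB. Qed.
Fact sig_is_monoid_morphism j : monoid_morphism (sig j).
Proof.
split; last first.
  by move=> u v; apply: twistM => a b x y; rewrite chiD exprMn mulrACA.
apply: puis_ext => e; rewrite sigE !pcoef1; case: eqP => [->|_]; last exact: mulr0.
by rewrite chi0 expr1n mulr1.
Qed.
HB.instance Definition _ j := GRing.isZmodMorphism.Build _ _ (sig j)
  (sig_is_zmod_morphism j).
HB.instance Definition _ j := GRing.isMonoidMorphism.Build _ _ (sig j)
  (sig_is_monoid_morphism j).

Lemma sig0 u : sig 0 u = u.
Proof. by apply: puis_ext => e; rewrite sigE expr0 mul1r. Qed.

Lemma sigD i j u : sig (i + j) u = sig i (sig j u).
Proof. by apply: puis_ext => e; rewrite !sigE exprD mulrA. Qed.

Lemma sig_inj j : injective (sig j).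
Proof. exact: fmorph_inj. Qed.

Lemma dle_sig j u r : dle u r -> dle (sig j u) r.
Proof. exact: dle_twist. Qed.

Lemma has_deg_sig j u r : has_deg_x u r -> has_deg_x (sig j u) r.
Proof.
move=> [u1 u2]; split; last exact: dle_sig.
by rewrite sigE mulf_neq0 // expf_neq0 // chi_neq0.
Qed.

Lemma sig_monoP j d c : sig j (monoP d c) = monoP d (chi d ^+ j * c).
Proof.
apply: puis_ext => e; rewrite sigE /= /mono.
by case: eqP => [->|]; rewrite ?mulr0.
Qed.

Lemma sig_cstpuis j c : sig j (cstpuis c) = cstpuis c.
Proof. by rewrite /cstpuis sig_monoP chi0 expr1n mul1r. Qed.

Lemma sig_monoP_int j (z : int) c : sig j (monoP z%:~R c) = monoP z%:~R c.
Proof.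
rewrite sig_monoP; have /eqP -> : chi z%:~R == 1 by rewrite chi_int intr_int.
by rewrite expr1n mul1r.
Qed.

(** chi(e)^p = chi(p e) equals 1 exactly when p e is an integer. Denominators thus become a matter
    of fixed points. *)
Lemma in_laurent_sig p u : in_laurent p u <-> sig p u = u.
Proof.
split=> [[h _]|h].
  apply: puis_ext => e; rewrite sigE; have [->|/h he] := eqVneq (u e) 0.
    by rewrite mulr0.
  by rewrite chiX; move: he; rewrite -(chi_int chi) => /eqP ->; rewrite mul1r.
split; last by have [q _ []] := puiseuxP u.
move=> e ue; rewrite -(chi_int chi) -chiX; apply/eqP/(mulIf ue).
by rewrite mul1r -[in RHS]h.
Qed.

Lemma sig_int j u : in_laurent 1 u -> sig j u = u.
Proof.
move=> /in_laurent_sig h; elim: j => [|j IH]; first exact: sig0.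
by rewrite -addn1 sigD h IH.
Qed.

Lemma sig_polyx j (q : {poly F}) : sig j (polyx q) = polyx q.
Proof.
apply: sig_int; split; last by have [p _ []] := puiseuxP (polyx q).
by move=> e /polyx_supp[a ->]; rewrite mulr1 natr_int.
Qed.

Lemma is_polydromyP u n : is_polydromy u n <->
  [/\ (0 < n)%N, sig n u = u & forall m, (0 < m < n)%N -> sig m u != u].
Proof.
split=> [[n0 /in_laurent_sig h hmin]|[n0 /in_laurent_sig h hmin]].
  split => // m /andP[m0 mn]; apply: contraTneq mn => /in_laurent_sig.
  by move/(hmin _ m0); rewrite -leqNgt.
split => // m m0 /in_laurent_sig hm; rewrite leqNgt; apply/negP => mn.
by have := hmin m; rewrite m0 mn hm eqxx => /(_ isT).
Qed.

Lemma polydromy_ex u : exists n, is_polydromy u n.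
Proof.
have ex : exists n, (0 < n)%N && (sig n u == u).
  have [p p0 /in_laurent_sig hp] := puiseuxP u.
  by exists p; rewrite p0 hp eqxx.
exists (ex_minn ex); case: ex_minnP => n /andP[n0 /eqP hn] hmin.
apply/is_polydromyP; split => // m /andP[m0 mn]; apply: contraTneq mn => h.
by rewrite -leqNgt hmin // m0 h eqxx.
Qed.

Lemma polydromy_sig j u n : is_polydromy u n -> is_polydromy (sig j u) n.
Proof.
move=> /is_polydromyP[n0 hn hmin]; apply/is_polydromyP; split => //.
  by rewrite -sigD addnC sigD hn.
by move=> m /hmin; rewrite -sigD addnC sigD (inj_eq (@sig_inj j)).
Qed.

(** For [n] the polydromy order of [u], this is the minimal polynomial of [u] over C((1/x)). *)
Definition Nm n u : {poly puiseux F} := \prod_(j < n) ('X - (sig j u)%:P).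

Lemma Nm_monic n u : Nm n u \is monic.
Proof. by apply: monic_prod => i _; apply: monicXsubC. Qed.

Lemma NmE n u : Nm n u = \prod_(z <- [seq sig j u | j <- iota 0 n]) ('X - z%:P).
Proof.
have -> : iota 0 n = index_iota 0 n by rewrite /index_iota subn0.
by rewrite big_map big_mkord.
Qed.

Lemma size_Nm n u : size (Nm n u) = n.+1.
Proof. by rewrite NmE size_prod_XsubC size_map size_iota. Qed.

(* Equivalently, the coefficients of P lie in C((1/x)). *)
Definition sfix (P : {poly puiseux F}) := map_poly (sig 1) P = P.

Lemma sfix_coef P i : sfix P -> in_laurent 1 P`_i.
Proof.
by move=> h; apply/in_laurent_sig; rewrite -[in RHS]h coef_map.
Qed.

Lemma Nm_sfix n u : sig n u = u -> sfix (Nm n u).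
Proof.
move=> hn; rewrite /sfix /Nm rmorph_prod /=.
have -> : \prod_(i < n) map_poly (sig 1) ('X - (sig i u)%:P) =
    \prod_(i < n) ('X - (sig i.+1 u)%:P).
  by apply: eq_bigr => i _; rewrite rmorphB /= map_polyX map_polyC /= -sigD.
case: n hn => [|n] hn; first by rewrite !big_ord0.
by rewrite big_ord_recr big_ord_recl /= hn sig0 mulrC.
Qed.

Lemma root_sig P u j : sfix P -> root P u -> root P (sig j u).
Proof.
move=> fP rP; elim: j => [|j IH]; first by rewrite sig0.
by apply/rootP; rewrite -add1n sigD -[P]fP horner_map (rootP IH) rmorph0.
Qed.

(** The conjugates [sig j u] with j < n are distinct, since a coincidence would give a smaller
    positive index fixing [u]; all of them are roots of [P]. *)
Lemma Nm_dvd P u n : is_polydromy u n -> sfix P -> root P u -> Nm n u %| P.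
Proof.
move=> /is_polydromyP[n0 hn hmin] fP rP.
rewrite NmE; apply: uniq_roots_dvdp; first by apply/allP => z /mapP[j _ ->]; apply: root_sig.
rewrite uniq_rootsE map_inj_in_uniq ?iota_uniq // => i j.
rewrite !mem_iota !add0n /= => ilt jlt.
wlog ij : i j ilt jlt / (i <= j)%N.
  move=> W; have [/W|/ltnW ji e] := leqP i j; first exact.
  by apply/esym/W.
rewrite -[in sig j](subnKC ij) sigD => /sig_inj e.
move: ij; rewrite leq_eqVlt => /orP[/eqP//|ij].
have := hmin (j - i)%N; rewrite -e eqxx subn_gt0 ij /=.
by rewrite (leq_ltn_trans (leq_subr _ _) jlt) => /(_ isT).
Qed.

Lemma sfix_divisor P Q : P \is monic -> Q \is monic -> sfix (P * Q) -> sfix P -> sfix Q.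
Proof.
move=> mP mQ fPQ fP; apply: (mulfI (monic_neq0 mP)).
by rewrite -[in RHS]fPQ rmorphM /= fP.
Qed.

(** A monic polynomial over C((1/x)) is built from 1 by adding one full conjugacy class of roots at
    a time. *)
Lemma sfix_ind (K : {poly puiseux F} -> Prop) : K 1 ->
  (forall P u n, K P -> is_polydromy u n -> K (Nm n u * P)) ->
  forall P, P \is monic -> sfix P -> K P.
Proof.
move=> K1 KN P; have [N] := ubnP (size P); elim: N P => // N IH P sP mP fP.
have [s1|s1] := leqP (size P) 1.
  move: mP; rewrite (size1_polyC s1) => /monicP.
  by rewrite lead_coefC => ->.
have [u ru] := puiseux_closed s1; have [n hn] := polydromy_ex u.
have /dvdpP[Q PQ] := Nm_dvd hn fP ru.
have mN := Nm_monic n u.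
have mQ : Q \is monic by move: mP; rewrite PQ monicMr.
have [n0 un _] := (is_polydromyP u n).1 hn.
have fQ : sfix Q.
  by apply: (sfix_divisor mN mQ _ (Nm_sfix un)); rewrite mulrC -PQ.
rewrite PQ mulrC; apply: KN => //; apply: IH => //.
move: sP; rewrite PQ size_Mmonic ?monic_neq0 // size_Nm addnS /= ltnS.
by apply: leq_trans; rewrite -addn1 leq_add2l.
Qed.

Lemma puiseux_splits (P : {poly puiseux F}) : P \is monic ->
  exists s : seq (puiseux F), P = \prod_(z <- s) ('X - z%:P).
Proof.
have [N] := ubnP (size P); elim: N P => // N IH P sP mP.
have [s1|s1] := leqP (size P) 1.
  exists [::]; rewrite big_nil; move: mP; rewrite (size1_polyC s1) => /monicP.
  by rewrite lead_coefC => ->.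
have [u /factor_theorem[Q PQ]] := puiseux_closed s1.
have mQ : Q \is monic by move: mP; rewrite PQ monicMr ?monicXsubC.
have [|s Qs] := IH Q _ mQ.
  by move: sP; rewrite PQ size_Mmonic ?monicXsubC ?monic_neq0 // size_XsubC addn2.
by exists (u :: s); rewrite big_cons PQ Qs mulrC.
Qed.

Lemma sfix_Nm_eq P u n : is_polydromy u n -> sfix P -> root P u ->
  size P = n.+1 -> P = lead_coef P *: Nm n u.
Proof.
move=> hn fP rP sP; have /dvdpP[Q PQ] := Nm_dvd hn fP rP.
have P0 : P != 0 by rewrite -size_poly_gt0 sP.
have Q0 : Q != 0 by apply: contraNneq P0 => Q0; rewrite PQ Q0 mul0r.
have s1 : size Q = 1%N.
  move: sP; rewrite PQ size_Mmonic ?Nm_monic // size_Nm addnS /= -add1n.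
  by move/addIn.
move: PQ; rewrite (size1_polyC (eq_leq s1)) => ->.
by rewrite lead_coefM lead_coefC (monicP (Nm_monic _ _)) mulr1 mul_polyC.
Qed.

Definition fx (f : {poly {poly F}}) : {poly puiseux F} := map_poly (@polyx F) f.

Lemma fx_sfix f : sfix (fx f).
Proof. by apply/polyP => i; rewrite /fx !coef_map; apply: sig_polyx. Qed.

Lemma size_fx f : size (fx f) = size f.
Proof. by rewrite size_map_inj_poly ?rmorph0 //; apply: polyx_inj. Qed.

Lemma lead_coef_fx f : lead_coef (fx f) = polyx (lead_coef f).
Proof. by rewrite lead_coef_map_inj ?rmorph0 //; apply: polyx_inj. Qed.

Lemma fx_eq0 f : (fx f == 0) = (f == 0).
Proof. by rewrite -!size_poly_eq0 size_fx. Qed.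

Lemma is_puiseux_rootE f u : is_puiseux_root f u <-> root (fx f) u.
Proof.
split=> [[_ h]|/rootP h].
  by apply/rootP/puis_ext => e; rewrite -peval_horner h pcoef0.
split; first exact: puiseuxP.
by move=> e; rewrite peval_horner h pcoef0.
Qed.

End Conjugation.

(** * Curves with one place at infinity *)

Section Germ.
Variables (F : numClosedFieldType) (chi : charQ F).
Implicit Types u v : puiseux F.

(* G(u, 1/x) as a polynomial in u. *)
Definition loc : {poly {poly F}} -> {poly puiseux F} :=
  horner_eval (monoP (-1) 1 : puiseux F)%:P \o map_poly (map_poly (@cstpuis F)).
HB.instance Definition _ := GRing.RMorphism.copy loc
  (horner_eval (monoP (-1) 1 : puiseux F)%:P \o map_poly (map_poly (@cstpuis F))).

Lemma locC (q : {poly F}) : loc q%:P = map_poly (@cstpuis F) q.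
Proof. by rewrite /loc /= map_polyC /= /horner_eval hornerC. Qed.

Lemma locX : loc 'X = (monoP (-1) 1)%:P.
Proof. by rewrite /loc /= map_polyX /= /horner_eval hornerX. Qed.

Lemma coef_loc G m : (loc G)`_m = \sum_(n < size G) monoP (- n%:R) (G`_n`_m).
Proof.
rewrite /loc /= /horner_eval (@horner_coef_wide _ (size G)); last exact: size_poly.
rewrite coef_sum; apply: eq_bigr => n _; rewrite coef_map /= -rmorphXn /= coefMC.
rewrite coef_map /= /cstpuis monoPX monoPM mulr1 add0r.
by rewrite mulNrn.
Qed.

Lemma lat_pt1 n : lat_pt 1 0 n = - n%:R.
Proof. by rewrite /lat_pt sub0r divr1. Qed.

Lemma loc_at G m n : (loc G)`_m (lat_pt 1 0 n) = G`_n`_m.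
Proof.
rewrite coef_loc pcoef_sum lat_pt1 /=.
have [nG|nG] := ltnP n (size G); last first.
  rewrite [G`_n]nth_default // coef0 big1 // => i _; rewrite /mono eqr_opp eqr_nat.
  by rewrite gtn_eqF // (leq_trans (ltn_ord i)).
rewrite (bigD1 (Ordinal nG)) //= /mono eqxx big1 ?addr0 // => i ia.
rewrite eqr_opp eqr_nat eq_sym ifF //; apply/negbTE.
by apply: contra ia => /eqP ia; apply/eqP/val_inj.
Qed.

Lemma dle_loc G m : dle (loc G)`_m 0.
Proof.
rewrite coef_loc; apply: dle_sum => n _; apply: dleW (@dle_monoP _ _ _).
by rewrite oppr_le0 ler0n.
Qed.

Lemma loc_sfix G : sfix chi (loc G).
Proof.
apply/polyP => m; rewrite coef_map coef_loc.
rewrite raddf_sum; apply: eq_bigr => n _ /=.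
by have := sig_monoP_int chi 1 (- n%:Z) (G`_n`_m); rewrite rmorphN /=.
Qed.

(** Vanishing at v = 1/x = 0. Fractional exponents admit no uniform negative bound; for integral
    ones the degree is at most -1. *)
Definition sneg u := dle u 0 /\ u 0 = 0.

Lemma sneg_prod (s : seq (puiseux F)) : (forall z, z \in s -> sneg z) ->
  forall i, dle (\prod_(z <- s) ('X - z%:P))`_i 0 /\
    ((i < size s)%N -> (\prod_(z <- s) ('X - z%:P))`_i 0 = 0).
Proof.
elim: s => [|z s IH] hs i.
  split => //; rewrite big_nil coef1; case: eqP => _; [exact: dle1|exact: dle0].
have {IH} IH := IH (fun z' h => hs z' (mem_behead (s := z :: s) h)).
have [z1 z2] := hs z (mem_head _ _).
rewrite big_cons mulrBl coefB coefXM coefCM; set P := \prod_(_ <- _) _ in IH *.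
have zP : dle (z * P`_i) 0 by have := dleM z1 (IH i).1; rewrite addr0.
split.
  apply: dleB => //; case: eqP => _; [exact: dle0|by case: (IH i.-1)].
move=> si; have zP0 : (z * P`_i) 0 = 0.
  by have := coefM_top z1 (IH i).1; rewrite addr0 z2 mul0r.
rewrite pcoefB zP0 subr0; case: i si {zP zP0} => [_|i si]; last exact: (IH i).2.
by rewrite eqxx pcoef0.
Qed.

Lemma dle_neg1 u : in_laurent 1 u -> sneg u -> dle u (-1).
Proof.
move=> [h _] [u1 u2] e he; apply/eqP/negPn/negP => ue.
have /intrP[z ez] := h _ ue; rewrite mulr1 in ez; move: he ue; rewrite ez.
have [->|z0] := eqVneq z 0; first by rewrite u2 eqxx.
rewrite -[-1]/((-1)%:~R) ltr_int => z1; rewrite u1 ?eqxx // ltr0z; lia.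
Qed.

(** As for Weierstrass polynomials: at a root z of degree at least 0, the term c z^d would have
    larger degree than all others, whose coefficients have degree at most -1. *)
Lemma root_sneg (P : {poly puiseux F}) d (c : F) z : c != 0 -> size P = d.+1 ->
  lead_coef P = cstpuis c -> (forall m, (m < d)%N -> dle P`_m (-1)) ->
  root P z -> sneg z.
Proof.
move=> c0 sP lP hP /rootP Pz.
have [->|z0] := eqVneq z 0; first by split; [exact: dle0|rewrite pcoef0].
have [r hr] := has_deg_ex z0; have [r0|r0] := ltP r 0.
  by split; [apply: dleW hr.2; apply: ltW|apply: hr.2].
have Ez : P.[z] = cstpuis c * z ^+ d + \sum_(m < d) P`_m * z ^+ m.
  rewrite (horner_coef_wide _ (eq_leq sP)) big_ord_recr addrC /=.
  by rewrite -lP /lead_coef sP.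
have: has_deg_x (P.[z] : puiseux F) (0 + r *+ d).
  rewrite Ez.
  apply: (@has_degD _ _ _ _ (r *+ d - 1)); last by lra.
    by apply: has_degM; [exact: has_deg_monoP|exact: has_degX].
  apply: dle_sum => m _; apply: dleW (dleM (hP m (ltn_ord m)) (@dleX _ _ _ m hr.2)).
  by rewrite addrC lerD2r ler_wpMn2l // ltnW.
by rewrite Pz => -[]; rewrite pcoef0 eqxx.
Qed.

(* The factorization over C((v)), v = 1/x, has its coefficients in C[[v]], because
   all the roots vanish at v = 0. *)
Lemma germ_polydromy G d (c : F) rho p : irreducible_germ G -> c != 0 ->
  size (loc G) = d.+1 -> lead_coef (loc G) = cstpuis c ->
  (forall m, (m < d)%N -> G`_0`_m = 0) -> root (loc G) rho ->
  is_polydromy rho p -> p = d.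
Proof.
move=> [G0 G00 irr] c0 sP lP Gm rrho hp.
have cc0 : cstpuis c != 0 by rewrite fmorph_eq0.
have fP := loc_sfix G.
have [p0 rp _] := (is_polydromyP chi rho p).1 hp.
have Pneg m : (m < d)%N -> dle (loc G)`_m (-1).
  move=> md; apply: dle_neg1; first exact: sfix_coef fP.
  split; first exact: dle_loc.
  by have := loc_at G m 0; rewrite lat_pt1 oppr0 => ->; rewrite Gm.
have roots z : root (loc G) z -> sneg z := root_sneg c0 sP lP Pneg.
have /dvdpP[Q PQ] := Nm_dvd hp fP rrho.
have mN := Nm_monic chi p rho.
have lQ : lead_coef Q = cstpuis c.
  by rewrite -lP PQ lead_coefM (monicP mN) mulr1.
have Q0 : Q != 0 by rewrite -lead_coef_eq0 lQ.
have [s Qs] : exists s, Q = cstpuis c *: \prod_(z <- s) ('X - z%:P).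
  have [|s hs] := @puiseux_splits F ((cstpuis c)^-1 *: Q).
    by apply/monicP; rewrite lead_coefZ lQ mulVf.
  by exists s; rewrite -hs scalerA mulfV // scale1r.
have fQ : sfix chi Q.
  apply: (mulIf (monic_neq0 mN)); have := fP; rewrite /sfix PQ rmorphM /=.
  by rewrite (Nm_sfix rp).
have s_neg z : z \in s -> sneg z.
  move=> zs; apply: roots; rewrite PQ Qs rootM rootZ // root_prod_XsubC zs //.
have N_neg z : z \in [seq sig chi j rho | j <- iota 0 p] -> sneg z.
  by move=> /mapP[j _ ->]; apply: roots; apply: root_sig.
have Qle i : dle Q`_i 0.
  by rewrite Qs coefZ; have := dleM (@dle_monoP _ 0 c) (sneg_prod s_neg i).1; rewrite addr0.
have Nle i : dle (Nm chi p rho)`_i 0 by rewrite NmE; case: (sneg_prod N_neg i).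
have pt0 : lat_pt 1 0 0 = 0 by rewrite lat_pt1 oppr0.
have lat1 (R : {poly puiseux F}) i : sfix chi R -> dle R`_i 0 ->
    pser R`_i = lat 1 0 (fun n => R`_i (lat_pt 1 0 n)).
  by move=> fR dR; apply: dle_lat => //; apply: sfix_coef fR.
(* The two factors are read as power series in u and v: index i is the power of u, index j the power
   of v = 1/x. *)
have := irr (fun i j => (Nm chi p rho)`_i (lat_pt 1 0 j)) (fun i j => Q`_i (lat_pt 1 0 j)).
case.
- move=> m n; rewrite -loc_at PQ mulrC coefM pcoef_sum; apply: eq_bigr => i _.
  have e1 := lat1 _ i (Nm_sfix rp) (Nle i).
  have e2 := lat1 _ (m - i)%N fQ (Qle _).
  by rewrite (coef_latM _ e1 e2) // addr0 lat_in.
- move=> /eqP; case; rewrite pt0 NmE; apply: (sneg_prod N_neg 0).2.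
  by rewrite size_map size_iota.
(* The cofactor is a unit of the power series ring although all its roots vanish at v = 0. So it has
   no roots, and the norm has the full degree d. *)
move=> B0; have s0 : s = [::].
  case: s Qs s_neg {Qle} => // z s Qs s_neg; case/eqP: B0.
  rewrite pt0 Qs coefZ.
  have := coefM_top (@dle_monoP _ 0 c) (sneg_prod s_neg 0).1.
  by rewrite addr0 (sneg_prod s_neg 0).2 // mulr0.
by move: sP; rewrite PQ Qs s0 big_nil -scalerAl mul1r size_scale // size_Nm => -[].
Qed.

End Germ.

(** * Substitution of a Puiseux series of negative degree into a power series *)

Section Substitute.
Variable F : fieldType.
Implicit Types (w T S : puiseux F) (U V : nat -> F) (r : rat).

Definition tp w U K : puiseux F := \sum_(k < K) cstpuis (U k) * w ^+ k.

(* T = \sum_k U_k w^k, where deg w <= r < 0. *)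
Definition thetaR w r U T := forall K e, r * K%:R < e -> T e = tp w U K e.

Lemma dle_tp_term w r c k : dle w r -> dle (cstpuis c * w ^+ k) (r * k%:R).
Proof.
move=> hw; rewrite -[r * _]add0r mulr_natr.
by apply: dleM; [exact: dle_monoP|exact: dleX].
Qed.

Lemma tp_stable w r U K K' e : r < 0 -> dle w r -> r * K%:R < e ->
  (K <= K')%N -> tp w U K' e = tp w U K e.
Proof.
move=> r0 hw he KK'; rewrite /tp -!(big_mkord xpredT (fun k => cstpuis (U k) * w ^+ k)).
rewrite (big_cat_nat (n := K)) // pcoefD [X in _ + X]pcoef_sum.
rewrite [X in _ + X]big_nat [X in _ + X]big1 ?addr0 // => k /andP[Kk _].
apply: dle_tp_term hw _ _; apply: le_lt_trans he.
by rewrite ler_nM2l // ler_nat.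
Qed.

(** Terms of index at least K have degree at most r K, so each coefficient is settled by a finite
    partial sum; [Num.bound] supplies its length. *)
Lemma thetaR_ex w r U : r < 0 -> dle w r -> exists T, thetaR w r U T.
Proof.
move=> r0 hw.
have bndP e : r * (Num.bound `|e / r|)%:R < e.
  rewrite mulrC -ltr_ndivrMr //; apply: le_lt_trans (ler_norm _) _.
  exact: archi_boundP.
pose phi e := tp w U (Num.bound `|e / r|) e.
have phiE K e : r * K%:R < e -> phi e = tp w U K e.
  move=> he; rewrite /phi; have [KK|KK] := leqP K (Num.bound `|e / r|).
    exact: tp_stable he KK.
  by apply/esym/(tp_stable _ _ _ (bndP e) (ltnW KK)).
have hphi : is_puiseux phi.
  have [p p0 hp] := puiseuxP w; exists p => //; split; last first.
    by exists 0 => e e0; rewrite (phiE 0%N) ?mulr0 // /tp big_ord0 pcoef0.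
  move=> e; rewrite /phi; apply: contraNT => he; rewrite /tp pcoef_sum big1 // => k _.
  have wk (c : F) (n : nat) : in_laurent p (cstpuis c * w ^+ n).
    elim: n => [|m IH].
      rewrite mulr1; split; last by exists 0; apply: dle_monoP.
      by move=> e'; rewrite /= /mono; case: (e' =P 0) => [->|_]; rewrite ?mul0r ?eqxx.
    rewrite exprSr mulrA.
    have [m1 /(_ m1 (lexx _)) h1] := laurent_lat p0 IH.
    have [m2 /(_ m2 (lexx _)) h2] := laurent_lat p0 hp.
    by rewrite (coef_latM p0 h1 h2); apply: in_laurent_lat.
  by apply/eqP/negPn/negP => /(wk _ _).1; apply/negP.
by exists (mkP hphi).
Qed.

Lemma thetaR_uniq w r U T S : r < 0 -> thetaR w r U T -> thetaR w r U S -> T = S.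
Proof.
move=> r0 hT hS; apply: puis_ext => e.
have he : r * (Num.bound `|e / r|)%:R < e.
  rewrite mulrC -ltr_ndivrMr //; apply: le_lt_trans (ler_norm _) _.
  exact: archi_boundP.
by rewrite (hT _ _ he) (hS _ _ he).
Qed.

Lemma thetaR_le w r U T : thetaR w r U T -> dle T 0.
Proof. by move=> h e e0; rewrite (h 0%N) ?mulr0 // /tp big_ord0 pcoef0. Qed.

Lemma thetaR_approx w r U T K : thetaR w r U T -> dle (T - tp w U K) (r * K%:R).
Proof. by move=> h e he; rewrite pcoefB (h _ _ he) subrr. Qed.

Lemma thetaR_add w r U V T S : thetaR w r U T -> thetaR w r V S ->
  thetaR w r (fun k => U k + V k) (T + S).
Proof.
move=> hT hS K e he; rewrite pcoefD (hT _ _ he) (hS _ _ he) -pcoefD.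
by rewrite /tp -big_split; congr (pser _ e); apply: eq_bigr => i _; rewrite rmorphD mulrDl.
Qed.

Lemma thetaR_scale w r U T c : thetaR w r U T ->
  thetaR w r (fun k => c * U k) (cstpuis c * T).
Proof.
move=> hT K e he; rewrite coef_monoM subr0 (hT _ _ he).
have -> : tp w (fun k => c * U k) K = cstpuis c * tp w U K.
  by rewrite /tp mulr_sumr; apply: eq_bigr => k _; rewrite rmorphM mulrA.
by rewrite coef_monoM subr0.
Qed.

Lemma tp_horner w U K : tp w U K = (map_poly (@cstpuis F) (\poly_(i < K) U i)).[w].
Proof.
rewrite (@horner_coef_wide _ K); last exact: leq_trans (size_poly _ _) (size_poly _ _).
by apply: eq_bigr => k _; rewrite coef_map coef_poly ltn_ord.
Qed.

Lemma dle_horner w r (q : {poly F}) : r < 0 -> dle w r ->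
  dle (map_poly (@cstpuis F) q).[w] 0.
Proof.
move=> r0 hw; rewrite horner_coef; apply: dle_sum => k _; rewrite coef_map /=.
by apply: (@dleW _ _ (r * k%:R)); [rewrite nmulr_rle0 // ler0n|exact: dle_tp_term].
Qed.

Lemma thetaR_mul w r U V T S : r < 0 -> dle w r ->
  thetaR w r U T -> thetaR w r V S -> thetaR w r (cauchy U V) (T * S).
Proof.
move=> r0 hw hT hS K e he.
have dU := @dle_horner w r (\poly_(i < K) U i) r0 hw; rewrite -tp_horner in dU.
have E1 : (T * S) e = (tp w U K * tp w V K) e.
  apply/eqP; rewrite -subr_eq0 -pcoefB; apply/eqP.
  have -> : T * S - tp w U K * tp w V K = (T - tp w U K) * S + tp w U K * (S - tp w V K).
    by ring.
  rewrite pcoefD.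
  rewrite (dleM (thetaR_approx (K:=K) hT) (thetaR_le hS)) ?addr0 //.
  by rewrite (dleM dU (thetaR_approx (K:=K) hS)) ?add0r.
rewrite E1 !tp_horner -hornerM -rmorphM /=.
set pq := _ * _; have -> : \poly_(i < K) cauchy U V i = take_poly K pq.
  by apply/polyP => i; rewrite coef_poly coef_take_poly; case: ltnP => // /cauchyE ->.
have E2 : (map_poly (@cstpuis F) pq).[w] = (map_poly (@cstpuis F) (take_poly K pq)).[w] +
    (map_poly (@cstpuis F) (drop_poly K pq)).[w] * w ^+ K.
  rewrite -[in LHS](poly_take_drop K pq) rmorphD /= hornerD rmorphM /= map_polyXn.
  by rewrite hornerM hornerXn.
rewrite E2 pcoefD.
rewrite [X in _ + X](dleM (dle_horner (drop_poly K pq) r0 hw) (@dleX _ _ _ K hw)) ?addr0 //.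
by rewrite add0r -mulr_natr.
Qed.

Lemma thetaR_delta w r (c : F) n : r < 0 -> dle w r ->
  thetaR w r (fun k => if k == n then c else 0) (cstpuis c * w ^+ n).
Proof.
move=> r0 hw K e he; rewrite /tp.
have [nK|Kn] := ltnP n K.
  congr (pser _ e); rewrite (bigD1 (Ordinal nK)) //= eqxx big1 ?addr0 // => i.
  by rewrite -val_eqE /= => /negPf ->; rewrite rmorph0 mul0r.
rewrite big1 ?pcoef0; last first.
  by move=> i _; rewrite ltn_eqF ?rmorph0 ?mul0r // (leq_trans (ltn_ord i)).
apply: dle_tp_term hw _ _; apply: le_lt_trans he.
by rewrite ler_nM2l // ler_nat.
Qed.

(** If m is the first index with V_m nonzero, then V_m w^m has degree r m and no later term reaches
    it. *)
Lemma thetaR_inj w r V : r < 0 -> has_deg_x w r -> thetaR w r V 0 ->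
  forall k, V k = 0.
Proof.
move=> r0 hw h k; apply/eqP/negPn/negP => Vk.
have ex : exists j, V j != 0 by exists k.
case: (ex_minnP ex) => m Vm hm; move: Vm; apply/negP/negPn.
have /(h m.+1 (r * m%:R)) : r * m.+1%:R < r * m%:R by rewrite ltr_nM2l // ltr_nat.
have -> : tp w V m.+1 = cstpuis (V m) * w ^+ m.
  rewrite /tp big_ord_recr /= big1 ?add0r // => i _.
  have [->|/hm] := eqVneq (V i) 0; first by rewrite rmorph0 mul0r.
  by rewrite leqNgt ltn_ord.
rewrite pcoef0 => /esym/eqP; rewrite coef_monoM subr0 mulf_eq0 => /orP[//|].
by rewrite mulr_natr; have [/negPf ->] := has_degX m hw.
Qed.

Lemma thetaR_cmul w r U T z : thetaR (cstpuis z * w) r U T ->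
  thetaR w r (fun k => z ^+ k * U k) T.
Proof.
move=> h K e /h ->; rewrite /tp; congr (pser _ e); apply: eq_bigr => k _.
by rewrite exprMn rmorphM rmorphXn /= mulrCA !mulrA [cstpuis z ^+ k * _]mulrC.
Qed.

Lemma thetaR_has_deg w r U T : r < 0 -> thetaR w r U T -> U 0%N != 0 ->
  has_deg_x T 0.
Proof.
move=> r0 h U0; split; last exact: thetaR_le h.
by rewrite (h 1%N) ?mulr1 // /tp big_ord_recl big_ord0 addr0 mulr1 /= /mono eqxx.
Qed.

Definition theta w r U : puiseux F :=
  if pselect (exists T, thetaR w r U T) is left h then projT1 (cid h) else 0.

Lemma thetaP w r U : r < 0 -> dle w r -> thetaR w r U (theta w r U).
Proof.
by move=> r0 hw; rewrite /theta; case: pselect => [h|[]]; [case: cid|exact: thetaR_ex].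
Qed.

End Substitute.

Lemma thetaR_sig (F : numClosedFieldType) (chi : charQ F) p (w : puiseux F) r U T :
  thetaR w r U T -> thetaR (sig chi p w) r U (sig chi p T).
Proof.
move=> h K e /h E; rewrite sigE E -(sigE chi p (tp w U K) e).
congr (pser _ e); rewrite /tp rmorph_sum; apply: eq_bigr => k _.
by rewrite rmorphM rmorphXn /= sig_cstpuis.
Qed.

(** Homogeneity of the elementary symmetric functions of the roots; the factor q^a avoids a
    subtraction in the exponent. *)
Lemma prod_XsubC_scale (R : comNzRingType) (q : R) (s : seq R) a :
  q ^+ a * (\prod_(z <- s) ('X - (q * z)%:P))`_a =
  q ^+ size s * (\prod_(z <- s) ('X - z%:P))`_a.
Proof.
elim: s a => [|z s IH] a.
  rewrite !big_nil /= mul1r; case: a => [|a]; first by rewrite mul1r.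
  by rewrite coef1 mulr0.
rewrite !big_cons !mulrBl !coefB !coefXM !coefCM !mulrBr.
congr (_ - _); last by rewrite mulrCA IH /= exprS; ring.
case: a => [|a]; first by rewrite !mulr0.
by rewrite /= exprS -mulrA IH exprS mulrA.
Qed.

Section Inversion.
Variables (F : numClosedFieldType) (chi : charQ F).
Variables (d : nat) (d0 : (0 < d)%N).
Variables (w : puiseux F) (r : rat) (r0 : r < 0) (hw : dle w r).

Let S0 (u : puiseux F) := sig chi d u = u /\ dle u 0.
(** Substitution of [w] for x^(-1/d). It is a ring morphism on [S0], the power series in
    x^(-1/d). *)
Let Th (u : puiseux F) : puiseux F := theta w r (fun k => u (lat_pt d 0 k)).

Lemma S0_lat u : S0 u -> pser u = lat d 0 (fun k => u (lat_pt d 0 k)).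
Proof.
by move=> [/in_laurent_sig h1 h2]; apply: dle_lat => //; rewrite mul0r.
Qed.

Lemma S0M u v : S0 u -> S0 v -> S0 (u * v).
Proof.
move=> [h1 h2] [h3 h4]; split; first by rewrite rmorphM /= h1 h3.
by have := dleM h2 h4; rewrite addr0.
Qed.

Lemma ThD u v : Th (u + v) = Th u + Th v.
Proof. exact: (thetaR_uniq r0 (thetaP _ r0 hw) (thetaR_add (thetaP _ r0 hw) (thetaP _ r0 hw))). Qed.

Lemma ThM u v : S0 u -> S0 v -> Th (u * v) = Th u * Th v.
Proof.
move=> hu hv; have h := thetaR_mul r0 hw (thetaP (fun k => u (lat_pt d 0 k)) r0 hw)
  (thetaP (fun k => v (lat_pt d 0 k)) r0 hw).
apply: (thetaR_uniq r0 (thetaP _ r0 hw)); move: h.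
have -> // : cauchy (fun k => u (lat_pt d 0 k)) (fun k => v (lat_pt d 0 k)) =
  (fun k => (u * v) (lat_pt d 0 k)).
apply/funext => k.
by rewrite (coef_latM d0 (S0_lat hu) (S0_lat hv)) addr0 lat_in.
Qed.

Lemma Th_mono k c : Th (monoP (- (k%:R / d%:R)) c) = cstpuis c * w ^+ k.
Proof.
apply: (thetaR_uniq r0 (thetaP _ r0 hw)).
have := thetaR_delta c k r0 hw; congr thetaR; apply/funext => j.
rewrite /= /mono; have -> : - (k%:R / d%:R) = lat_pt d 0 k.
  by rewrite /lat_pt sub0r mulNr.
by rewrite (inj_eq (lat_pt_inj d0)).
Qed.

Lemma Th1 : Th 1 = 1.
Proof. by have := Th_mono 0 1; rewrite mul0r oppr0 mulr1. Qed.

Lemma ThN u : Th (- u) = - Th u.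
Proof.
have Th0 : Th 0 = 0 by apply: (@addrI _ (Th 0)); rewrite -ThD !addr0.
by apply/eqP; rewrite -addr_eq0 -ThD addNr Th0.
Qed.

Lemma Th0 : Th 0 = 0.
Proof. by rewrite -[X in Th X](subrr 1) ThD ThN subrr. Qed.

Lemma Th_sum I (s : seq I) (f : I -> puiseux F) :
  Th (\sum_(i <- s) f i) = \sum_(i <- s) Th (f i).
Proof. exact: (big_morph Th ThD Th0). Qed.

Lemma Th_prod (s : seq (puiseux F)) : (forall z, z \in s -> S0 z) -> forall a,
  S0 (\prod_(z <- s) ('X - z%:P))`_a /\
  Th (\prod_(z <- s) ('X - z%:P))`_a = (\prod_(z <- s) ('X - (Th z)%:P))`_a.
Proof.
have S00 : S0 0 by split; [exact: rmorph0|exact: dle0].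
have S01 : S0 1 by split; [exact: rmorph1|exact: dle1].
elim: s => [|z s IH] hs a.
  rewrite !big_nil !coef1; case: eqP => _; split => //; [exact: Th1|exact: Th0].
have hz := hs z (mem_head _ _).
have {IH} IH := IH (fun z' h => hs z' (mem_behead (s := z :: s) h)).
rewrite !big_cons !mulrBl !coefB !coefXM !coefCM.
set P := \prod_(_ <- _) _ in IH *; set Q := \prod_(_ <- _) _ in IH *.
have [ha1 ha2] := IH a; have hzP := S0M hz ha1.
have hb : S0 (if a == 0%N then 0 else P`_a.-1) /\
    Th (if a == 0%N then 0 else P`_a.-1) = (if a == 0%N then 0 else Q`_a.-1).
  by case: eqP => _; [split => //; exact: Th0|exact: IH].
split.
  split; first by rewrite rmorphB /= hb.1.1 hzP.1.
  by apply: dleB; [exact: hb.1.2|exact: hzP.2].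
by rewrite ThD ThN ThM // ha2 hb.2.
Qed.

End Inversion.

Lemma scaled_exponent (n d a b : nat) :
  (0 < d)%N -> (a <= d)%N -> (b * d <= (d - a) * n)%N ->
  - (n%:R / d%:R) *+ a + - (((d - a) * n - b * d)%N%:R / d%:R) =
  - (n%:R / d%:R) *+ d + b%:R :> rat.
Proof.
move=> d0 ad hb; have d0' : d%:R != 0 :> rat by rewrite pnatr_eq0 -lt0n.
rewrite natrB // !natrM natrB // -[_ *+ a]mulr_natr -[_ *+ d]mulr_natr.
by field.
Qed.

(* phi is an expansion of y in x and rho one of x in y along the same branch.  A
   suitable d-th root s of phi satisfies x = rho(s^d), so every automorphism of the
   Puiseux series over C((x^(-1/p))) multiplies s by a root of unity that fixes
   rho, that is, by 1.  Hence s lies in C((x^(-1/p))), and deg s = 1/n. *)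
Lemma inversion (F : numClosedFieldType) (chi : charQ F) (h : {poly {poly F}})
    (d n : nat) (c : F) (rho : puiseux F) (p : nat) (phi : puiseux F) (E : rat) :
  c != 0 -> is_polydromy rho d -> has_deg_x rho (n%:R / d%:R) -> (0 < n)%N ->
  fx h = cstpuis c *: Nm chi d rho ->
  (forall a b, (a <= d)%N -> h`_a`_b != 0 -> (b * d <= (d - a) * n)%N) ->
  has_deg_x phi E -> 0 < E -> in_laurent p phi ->
  \sum_(a < d.+1) \sum_(b < n.+1) cstpuis h`_a`_b * monoP 1 1 ^+ a * phi ^+ b = 0 ->
  (n %| p)%N.
Proof.
move=> c0 hrho drho n0 fxh supp dphi E0 lphi phi0.
have [d0 rhod _] := (is_polydromyP chi rho d).1 hrho.
have d0' : 0 < d%:R :> rat by rewrite ltr0n.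
have n0' : 0 < n%:R :> rat by rewrite ltr0n.
have cc0 : cstpuis c != 0 by rewrite fmorph_eq0.
(* [s] is a d-th root of y = phi; its inverse [w] will stand for y^(-1/d) in the expansion [rho] of
   x. *)
have [s sd] : exists s : puiseux F, s ^+ d = phi.
  have [|s /rootP] := @puiseux_closed F ('X^d - phi%:P).
    by rewrite size_XnsubC.
  by rewrite !hornerE => /eqP; rewrite subr_eq0 => /eqP; exists s.
have s0 : s != 0.
  by apply: contraTneq (has_deg_neq0 dphi) => s0; rewrite -sd s0 expr0n gtn_eqF //= eqxx.
have [eta deta] := has_deg_ex s0.
have etaE : eta * d%:R = E.
  by have := has_degX d deta; rewrite sd mulr_natr => /(has_deg_inj dphi).
have eta0 : 0 < eta by rewrite -(pmulr_lgt0 _ d0') etaE.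
pose w := s^-1; have dw : has_deg_x w (- eta) := has_degV deta.
have w0 : w != 0 by rewrite invr_eq0.
have r0 : - eta < 0 by rewrite oppr_lt0.
(* [rho] has degree n/d. Multiplied by [q], its conjugates become power series in x^(-1/d), to which
   the substitution applies. *)
pose q : puiseux F := monoP (- (n%:R / d%:R)) 1.
have q0 : q != 0 := has_deg_neq0 (has_deg_monoP _ (oner_neq0 F)).
pose zs := [seq sig chi j rho | j <- iota 0 d].
have szs : size zs = d by rewrite size_map size_iota.
have hR z : z \in zs -> sig chi d (q * z) = q * z /\ dle (q * z) 0.
  move=> /mapP[j _ ->]; split.
    rewrite rmorphM /= -sigD addnC sigD rhod; congr (_ * _).
    apply/in_laurent_sig; split; last by exists (- (n%:R / d%:R)); exact: dle_monoP.
    move=> e; rewrite /= /mono; case: (e =P _) => [-> _|]; last by rewrite eqxx.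
    by rewrite -mulNr divfK ?gt_eqF // rpredN natr_int.
  have := dleM (@dle_monoP _ (- (n%:R / d%:R)) (1 : F)) (@dle_sig F chi j _ _ drho.2).
  by rewrite addNr.
have hR' z : z \in [seq q * z | z <- zs] -> sig chi d z = z /\ dle z 0.
  by move=> /mapP[z' hz ->]; apply: hR.
pose Th (u : puiseux F) := theta w (- eta) (fun k => u (lat_pt d 0 k)).
have coefR a : (a <= d)%N ->
    (\prod_(z <- [seq q * z | z <- zs]) ('X - z%:P))`_a =
    \sum_(b < n.+1) monoP (- (((d - a) * n - b * d)%N%:R / d%:R)) (h`_a`_b / c).
  move=> ad; apply: (mulfI (expf_neq0 a q0)).
  rewrite big_map prod_XsubC_scale szs -NmE.
  have -> : (Nm chi d rho)`_a = (cstpuis c)^-1 * polyx h`_a.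
    have : (fx h)`_a = cstpuis c * (Nm chi d rho)`_a by rewrite fxh coefZ.
    by rewrite coef_map => ->; rewrite mulKf.
  have shn : (size (h`_a)%R <= n.+1)%N.
    apply/leq_sizeP => b nb; apply/eqP; apply: contraTT nb => /(supp _ _ ad) hb.
    rewrite -ltnNge ltnS -(leq_pmul2r d0); apply: leq_trans hb _.
    by rewrite [(n * d)%N]mulnC leq_mul2r leq_subr orbT.
  rewrite (polyxE shn) -fmorphV !mulr_sumr; apply: eq_bigr => b _.
  rewrite /q !monoPX /cstpuis !monoPM !mul1r add0r [c^-1 * _]mulrC.
  have [->|hab] := eqVneq h`_a`_b 0.
    by rewrite !mul0r; apply: puis_ext => e; rewrite /= /mono; do 2! case: ifP.
  congr (monoP _ _); apply/esym/scaled_exponent => //; exact: supp.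
(* Substituting [w] in the factorization of [h] gives, up to a power of w and the constant c, the
   given equation between x and phi. *)
have evalR : \prod_(z <- zs) (monoP 1 1 * w ^+ n - Th (q * z)) = 0.
  have -> : \prod_(z <- zs) (monoP 1 1 * w ^+ n - Th (q * z)) =
      (\prod_(z <- [seq q * z | z <- zs]) ('X - (Th z)%:P)).[monoP 1 1 * w ^+ n].
    by rewrite horner_prod big_map; apply: eq_bigr => z _; rewrite !hornerE.
  rewrite (@horner_coef_wide _ d.+1); last first.
    by rewrite size_prod_XsubC size_map szs.
  transitivity (w ^+ (n * d) * (cstpuis c)^-1 * \sum_(a < d.+1) \sum_(b < n.+1)
      cstpuis h`_a`_b * monoP 1 1 ^+ a * phi ^+ b); last by rewrite phi0 mulr0.
  rewrite mulr_sumr; apply: eq_bigr => a _; have ad : (a <= d)%N by rewrite -ltnS.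
  rewrite -(Th_prod d0 r0 dw.2 hR' a).2 coefR // (Th_sum d r0 dw.2).
  rewrite mulr_sumr mulr_suml; apply: eq_bigr => b _.
  rewrite (Th_mono d0 r0 dw.2) rmorphM fmorphV /=.
  have [->|hab] := eqVneq h`_a`_b 0; first by rewrite rmorph0 !(mul0r, mulr0).
  have hb := supp _ _ ad hab.
  rewrite -sd exprMn -!exprM.
  have -> : w ^+ (n * d) = w ^+ ((d - a) * n - b * d) * w ^+ (n * a) * w ^+ (d * b).
    rewrite -!exprD; congr (_ ^+ _).
    rewrite (mulnC d b) addnAC subnK // mulnBl (mulnC n a) subnK ?leq_mul2r ?ad ?orbT //.
    exact: mulnC.
  have ws : w ^+ (d * b) * s ^+ (d * b) = 1 by rewrite -exprMn mulVf // expr1n.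
  transitivity (cstpuis h`_a`_b * (cstpuis c)^-1 * w ^+ ((d - a) * n - b * d) *
    monoP 1 1 ^+ a * w ^+ (n * a) * (w ^+ (d * b) * s ^+ (d * b))); last by ring.
  by rewrite ws mulr1; ring.
(* One factor vanishes: x w^n = (q z)(w), which says that x is the value at y = s^d of the conjugate
   [z] of [rho]. *)
have [z zin xTh] : exists2 z, z \in zs & monoP 1 1 * w ^+ n = Th (q * z).
  move/eqP: evalR; rewrite prodf_seq_eq0 => /hasP[z zin /=]; rewrite subr_eq0 => /eqP.
  by exists z.
pose U k := (q * z) (lat_pt d 0 k); pose T : puiseux F := monoP 1 1 * w ^+ n.
have hT : thetaR w (- eta) U T by rewrite /T xTh; apply: thetaP => //; exact: dw.2.
have [hz zE] : is_polydromy z d /\ has_deg_x z (n%:R / d%:R).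
  move: zin => /mapP[j _ ->]; split; first exact: polydromy_sig.
  exact: has_deg_sig.
have qzE e : (q * z) e = z (e + n%:R / d%:R) by rewrite coef_monoM mul1r opprK.
(* T = x w^n has degree 1 - eta n, but also degree 0 since its expansion in w has a nonzero constant
   term. *)
have etan : eta * n%:R = 1.
  have U0 : U 0%N != 0.
    by rewrite /U qzE /lat_pt subr0 mul0r add0r; case: zE.
  have := has_degM (@has_deg_monoP F 1 1 (oner_neq0 _)) (has_degX n dw).
  move=> /(has_deg_inj (thetaR_has_deg r0 hT U0)).
  by rewrite -mulr_natr; lra.
have omega_prim : d.-primitive_root (chi d%:R^-1).
  rewrite /primitive_root_of_unity d0; apply/forallP => i; apply/eqP.
  rewrite unity_rootE chiX chi_int; apply/idP/eqP => [|->]; last first.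
    by rewrite mulVf ?gt_eqF.
  move=> /intrP[m hm]; have m0 : 0 < m.
    by rewrite -(ltr0z rat) -hm mulr_gt0 // ?invr_gt0 // ltr0n.
  have hm1 : i.+1%:R = m%:~R * d%:R :> rat by rewrite -hm mulrAC mulVf ?gt_eqF // mul1r.
  apply/eqP; rewrite eqn_leq ltn_ord -(ler_nat rat) hm1 /=.
  by apply: ler_peMl; [exact: ltW|rewrite ler1z -gtz0_ge1].
have cprim : d.-primitive_root (cstpuis (chi d%:R^-1)) by rewrite fmorph_primitive_root.
(* w^d = 1/phi is fixed by [sig p], so [sig p] multiplies [w] by a d-th root of unity, which is a
   power of chi(1/d). *)
have [i wi] : {i : 'I_d | sig chi p w / w = cstpuis (chi d%:R^-1) ^+ i}.
  apply: (prim_rootP cprim); rewrite expr_div_n -rmorphXn /=.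
  have -> : w ^+ d = phi^-1 by rewrite /w exprVn sd.
  rewrite fmorphV /= ((in_laurent_sig chi p phi).1 lphi) divff //.
  by rewrite invr_eq0 (has_deg_neq0 dphi).
pose zeta := chi (i%:R / d%:R).
have sw : sig chi p w = cstpuis zeta * w.
  rewrite -[LHS](divfK w0) wi -rmorphXn /= chiX; congr (cstpuis (chi _) * _).
  by rewrite mulrC.
have sT : sig chi p T = cstpuis (zeta ^+ n) * T.
  rewrite /T rmorphM rmorphXn /= sw (sig_monoP_int chi p 1) exprMn rmorphXn /=.
  by rewrite mulrCA.
(* [sig p] fixes x, so it multiplies T by zeta^n, and it multiplies the term U_k w^k by zeta^k.
   Uniqueness of the expansion in w compares the two. *)
have zU k : (zeta ^+ k - zeta ^+ n) * U k = 0.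
  have h1 : thetaR w (- eta) (fun k => zeta ^+ k * U k) (cstpuis (zeta ^+ n) * T).
    by apply: thetaR_cmul; rewrite -sw -sT; apply: thetaR_sig.
  have h2 := thetaR_add h1 (thetaR_scale (- zeta ^+ n) hT).
  rewrite rmorphN mulNr subrr in h2.
  by have := thetaR_inj r0 dw h2 k; rewrite -mulrDl.
(* An exponent e = (n - k)/d occurring in [z] has U_k nonzero, so chi(e)^i = zeta^n / zeta^k = 1. As
   [z] has polydromy order d, this will leave only i = 0. *)
have zi : sig chi i z = z.
  apply: puis_ext => e; rewrite sigE; have [->|ze] := eqVneq (z e) 0; first by rewrite mulr0.
  have e1 : (q * z) (e - n%:R / d%:R) = z e by rewrite qzE subrK.
  have [hq1 hq2] := hR z zin.
  have ql : pser (q * z) = lat d 0 U.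
    by apply: dle_lat => //; [exact/(in_laurent_sig chi)|rewrite mul0r].
  have [k ek] : exists k, e - n%:R / d%:R = lat_pt d 0 k.
    by apply: (@lat_supp _ d 0 U) => //; rewrite -ql e1.
  have /eqP := zU k; rewrite /U -ek e1 mulf_eq0 (negPf ze) orbF subr_eq0 => /eqP zkn.
  have -> : e = n%:R / d%:R - k%:R / d%:R.
    by move: ek; rewrite /lat_pt sub0r mulNr => <-; rewrite addrC subrK.
  rewrite chiX mulrBl chiD chiN.
  have zX m : chi (m%:R / d%:R * i%:R) = zeta ^+ m.
    by rewrite /zeta chiX; congr (chi _); ring.
  by rewrite !zX zkn mulfV ?mul1r // -zX chi_neq0.
have i0 : (i : nat) = 0%N.
  have [_ _ hmin] := (is_polydromyP chi z d).1 hz.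
  apply/eqP; apply: contraT; rewrite -lt0n => i0.
  by have := hmin i; rewrite i0 ltn_ord zi eqxx => /(_ isT).
have lw : in_laurent p w.
  by apply/(in_laurent_sig chi); rewrite sw /zeta i0 mul0r chi0 rmorph1 mul1r.
(* The degree of [w] is -1/n and lies in (1/p)Z. *)
have /intrP[m hm] := lw.1 _ dw.1.
have pm : (p%:Z = - m * n%:Z)%R.
  apply: (@intr_inj rat); rewrite rmorphM rmorphN /= -hm.
  transitivity (p%:R * (eta * n%:R) : rat); first by rewrite etan mulr1.
  by ring.
by apply/dvdnP; exists `|m|%N; rewrite -[p]/(`|p%:Z|%N) pm abszM abszN absz_nat.
Qed.

Lemma coef_prod_dle (F : fieldType) (s : seq (puiseux F)) (e : rat) :
  (forall z, z \in s -> dle z e) -> forall a,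
  dle (\prod_(z <- s) ('X - z%:P))`_a (((size s)%:R - a%:R) * e).
Proof.
elim: s => [|z s IH] hs a.
  rewrite big_nil coef1; case: eqP => [->|_]; last exact: dle0.
  by rewrite subrr mul0r; apply: dle1.
have hz := hs z (mem_head _ _).
have {IH} IH := IH (fun z' h => hs z' (mem_behead (s := z :: s) h)).
rewrite big_cons mulrBl coefB coefXM coefCM /=; apply: dleB; last first.
  have := dleM hz (IH a); congr dle; rewrite -[(size s).+1]addn1 natrD; ring.
case: a => [|a] /=; first exact: dle0.
have := IH a; congr dle; rewrite -addn1 -[a.+1]addn1 !natrD; ring.
Qed.

Section WideSums.
Variables (A : nzRingType) (V : nmodType).

(** With constant ranges the two sums can be interchanged, as the exchange of x and y requires. *)
Lemma sum_coef_wide (f : {poly {poly A}}) (g : nat -> nat -> V) m n :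
  (size f <= n)%N -> (forall b, (size (f`_b)%R <= m)%N) ->
  (forall a b, f`_b`_a = 0 -> g a b = 0) ->
  \sum_(b < size f) \sum_(a < size f`_b) g a b = \sum_(b < n) \sum_(a < m) g a b.
Proof.
move=> sn sm g0; have wide k l (G : nat -> V) : (k <= l)%N ->
    (forall i, (k <= i)%N -> G i = 0) -> \sum_(i < k) G i = \sum_(i < l) G i.
  move=> kl hG; rewrite (big_ord_widen l G kl) [RHS](bigID (fun i : 'I_l => (i < k)%N)) /=.
  by rewrite [X in _ + X]big1 ?addr0 // => i; rewrite -leqNgt => /hG.
rewrite -(wide (size f) n (fun b => \sum_(a < m) g a b)) //.
  apply: eq_bigr => b _; apply: (wide _ _ (g^~ (b : nat))) => // i hi.
  by apply: g0; rewrite nth_default.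
by move=> b hb; apply: big1 => a _; apply: g0; rewrite [f`_b]nth_default // coef0.
Qed.
End WideSums.

Section OnePlace.
Variables (F : numClosedFieldType) (chi : charQ F).
Implicit Types (f h : {poly {poly F}}) (phi : puiseux F).

(* With d the total degree of h, the germ of h = 0 at the point [1 : c : 0]; the
   point [0 : 1 : 0] is reduced to this case by exchanging x and y. *)
Definition locd (d : nat) (c : F) (n : nat) h : {poly {poly F}} :=
  \sum_(b < n) \sum_(a < n)
    cstP (h`_b`_a) * 'X^(d - a - b) * (('X + c%:P) ^+ b)%:P.

(** For d the total degree, this is the top form at x = 1: its roots c are the points [1 : c : 0] of
    the curve, and [0 : 1 : 0] is on the curve when the coefficient of X^d vanishes. *)
Definition top (d : nat) h : {poly F} := \poly_(b < d.+1) h`_b`_(d - b).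

Definition deg_bound (d : nat) h := forall a b, h`_b`_a != 0 -> (a + b <= d)%N.

Lemma locd0 d c n h : (d < n)%N -> deg_bound d h ->
  (locd d c n h)`_0 = top d h \Po ('X + c%:P).
Proof.
move=> dn hd; rewrite /locd coef_sum comp_polyE.
rewrite (eq_bigr (fun b : 'I_n => (top d h)`_b *: ('X + c%:P) ^+ b)).
  transitivity (\sum_(b < n)
      if (b < size (top d h))%N then (top d h)`_b *: ('X + c%:P) ^+ b else 0).
    by apply: eq_bigr => b _; case: ltnP => // hb; rewrite nth_default // scale0r.
  rewrite -big_mkcond /= [RHS](big_ord_widen n (fun b => (top d h)`_b *: ('X + c%:P) ^+ b)) //.
  exact: leq_trans (size_poly _ _) dn.
move=> b _; rewrite coef_sum coef_poly.
have term a : (cstP (h`_b`_a) * 'X^(d - a - b) * (('X + c%:P) ^+ b)%:P)`_0 =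
    if (a + b == d)%N then h`_b`_a *: ('X + c%:P) ^+ b else 0.
  rewrite coefMC /cstP coefCM coefXn eq_sym.
  have [->|hab] := eqVneq (h`_b`_a) 0.
    by rewrite scale0r polyC0 !mul0r; case: ifP.
  rewrite -subnDA subn_eq0 [(a + b == d)%N]eqn_leq (hd _ _ hab) /=.
  by case: leqP => _; rewrite ?mulr1 ?mulr0 ?mul0r ?mul_polyC.
transitivity (\sum_(a < n) if (a + b == d)%N then h`_b`_a *: ('X + c%:P) ^+ b else 0).
  by apply: eq_bigr => a _; apply: term.
rewrite ltnS.
have [bd|db] := leqP b d; last first.
  rewrite big1 ?scale0r // => a _; rewrite ifF //; apply/negbTE.
  by rewrite neq_ltn (leq_trans db) ?orbT // leq_addl.
have dbn : (d - b < n)%N by rewrite (leq_ltn_trans (leq_subr _ _)).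
rewrite (bigD1 (Ordinal dbn)) //= subnK // eqxx big1 ?addr0 // => a.
rewrite -val_eqE /= => ha; rewrite ifF //; apply: contraNF ha => /eqP <-.
by rewrite addnK.
Qed.

(** Putting v = 1/x in H(1, c + u, v) gives x^(-d) h(x, x (c + u)), so a root y of h corresponds to
    the root u = y/x - c. *)
Lemma loc_locd d c n h : (size h <= n)%N -> (forall b, (size (h`_b)%R <= n)%N) ->
  deg_bound d h ->
  loc (locd d c n h) =
    monoP (- d%:R) 1 *: (fx h \Po (monoP 1 1 *: ('X + (cstpuis c)%:P))).
Proof.
move=> sh sh' hd; rewrite /locd raddf_sum comp_polyE.
have locT (x : F) k (q : {poly F}) : loc (cstP x * 'X^k * q%:P) =
    (cstpuis x)%:P * (monoP (-1) 1)%:P ^+ k * map_poly (@cstpuis F) q.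
  by rewrite !rmorphM rmorphXn /= !locC locX map_polyC.
rewrite size_fx scaler_sumr.
transitivity (\sum_(b < n) monoP (- d%:R) 1 *:
    ((fx h)`_b *: (monoP 1 1 *: ('X + (cstpuis c)%:P)) ^+ b)); last first.
  rewrite [RHS](big_ord_widen n (fun b => monoP (- d%:R) 1 *:
    ((fx h)`_b *: (monoP 1 1 *: ('X + (cstpuis c)%:P)) ^+ b))) // [RHS]big_mkcond /=.
  apply: eq_bigr => b _; case: ltnP => // hb.
  by rewrite [(fx h)`_b]nth_default ?size_fx // scale0r scaler0.
apply: eq_bigr => b _; rewrite raddf_sum.
have -> : (fx h)`_b = \sum_(a < n) monoP a%:R h`_b`_a.
  by rewrite coef_map; apply: polyxE.
rewrite scaler_suml scaler_sumr; apply: eq_bigr => a _.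
apply: etrans (locT _ _ _) _; rewrite rmorphXn rmorphD /= map_polyX map_polyC /=.
have [->|hab] := eqVneq (h`_b`_a) 0.
  rewrite !rmorph0 !mul0r; have -> : monoP a%:R 0 = 0 :> puiseux F.
    by apply: puis_ext => e; rewrite /= /mono; do 2! case: ifP.
  by rewrite scale0r scaler0.
have ab := hd _ _ hab.
rewrite exprZn !scalerA -rmorphXn /= -rmorphM /= mul_polyC; congr (_ *: _).
rewrite /cstpuis !monoPX !monoPM !mulr1 !mul1r !add0r; congr (monoP _ _).
rewrite -subnDA mulNrn natrB // natrD; ring.
Qed.

(** The hypothesis on [top] makes [1 : c : 0] the only point at infinity. The change from y to u =
    y/x - c keeps the polydromy order, which irreducibility of the germ forces to be d. *)
Lemma germ_top d c c0 n h phi p : c0 != 0 ->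
  (size h <= n)%N -> (forall b, (size (h`_b)%R <= n)%N) -> (d < n)%N -> deg_bound d h ->
  top d h = c0 *: ('X - c%:P) ^+ d -> irreducible_germ (locd d c n h) ->
  root (fx h) phi -> is_polydromy phi p ->
  [/\ size h = d.+1, lead_coef h = c0%:P, p = d & fx h = cstpuis c0 *: Nm chi p phi].
Proof.
move=> c00 sh sh' dn hd htop irr rphi hp.
have hdd : h`_d = c0%:P.
  apply/polyP => -[|a].
    have := congr1 (fun P : {poly F} => P`_d) htop.
    rewrite coef_poly ltnSn subnn coefZ coefC eqxx => ->.
    have /monicP := monic_exp d (monicXsubC c).
    by rewrite /lead_coef size_exp_XsubC /= => ->; rewrite mulr1.
  rewrite coefC /=; apply/eqP; apply: contraT => /hd.
  by rewrite addSn ltnNge leq_addl.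
have szh : size h = d.+1.
  apply/eqP; rewrite eqn_leq; apply/andP; split.
    apply/leq_sizeP => b db; apply/polyP => a; rewrite coef0.
    apply/eqP; apply: contraT => /hd ab.
    by have := leq_trans db (leq_trans (leq_addl a b) ab); rewrite ltnn.
  rewrite ltnNge; apply/negP => /leq_sizeP /(_ d (leqnn d)) /eqP.
  by rewrite hdd polyC_eq0 (negPf c00).
have lh : lead_coef h = c0%:P by rewrite /lead_coef szh.
have lfh : lead_coef (fx h) = cstpuis c0 by rewrite lead_coef_fx lh polyxC.
pose x : puiseux F := monoP 1 1; pose xi : puiseux F := monoP (-1) 1.
have xxi : x * xi = 1 by rewrite monoPM subrr mulr1.
have x0 : x != 0 := has_deg_neq0 (has_deg_monoP _ (oner_neq0 F)).
have xi0 : xi != 0 := has_deg_neq0 (has_deg_monoP _ (oner_neq0 F)).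
pose G := locd d c n h; have locG : loc G = _ := loc_locd c sh sh' hd.
pose rho := xi * phi - cstpuis c.
have lin : lead_coef (x *: ('X + (cstpuis c)%:P)) = x.
  by rewrite lead_coefZ lead_coefXaddC mulr1.
have slin : size (x *: ('X + (cstpuis c)%:P)) = 2.
  by rewrite size_scale // size_XaddC.
have m0 : (monoP (- d%:R) 1 : puiseux F) != 0.
  exact: has_deg_neq0 (has_deg_monoP _ (oner_neq0 F)).
have rrho : root (loc G) rho.
  rewrite locG rootZ // root_comp; rewrite !hornerE /rho addrNK mulrA xxi mul1r.
  exact: rphi.
have hrho : is_polydromy rho p.
  have srho j : sig chi j rho = xi * sig chi j phi - cstpuis c.
    by rewrite rmorphB rmorphM /= sig_cstpuis (sig_monoP_int chi j (-1)).
  have [p0 pphi pmin] := (is_polydromyP chi phi p).1 hp.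
  apply/(is_polydromyP chi); split => //; first by rewrite srho pphi.
  by move=> m /pmin; rewrite srho /rho; apply: contraNneq => /addIr/(mulfI xi0) ->.
have pd : p = d.
  refine (germ_polydromy chi irr c00 _ _ _ rrho hrho).
  - by rewrite locG size_scale // size_comp_poly2 // size_fx.
  - rewrite locG lead_coefZ lead_coef_comp ?slin // lfh lin size_fx szh /=.
    rewrite mulrCA /x monoPX monoPM mulr1 addNr.
    exact: mulr1.
  move=> m md; rewrite locd0 // htop comp_polyZ rmorphXn /= comp_polyB comp_polyX.
  by rewrite comp_polyC addrK coefZ coefXn ltn_eqF // mulr0.
split => //; rewrite -lfh; apply: sfix_Nm_eq => //; first exact: fx_sfix.
by rewrite size_fx szh pd.
Qed.

End OnePlace.

Section OnePlaceFactor.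
Variables (F : numClosedFieldType) (chi : charQ F).
Implicit Types (f h : {poly {poly F}}) (phi : puiseux F).

Lemma tot_deg_bound f : deg_bound (tot_deg f) f.
Proof.
move=> a b hab; have fb0 : f`_b != 0 by apply: contraNneq hab => ->; rewrite coef0.
have bf : (b < size f)%N by rewrite ltnNge; apply: contra fb0 => hb; rewrite nth_default.
have := @leq_bigmax_cond _ (fun b : 'I_(size f) => f`_b != 0)
  (fun b : 'I_(size f) => ((size (f`_b)%R).-1 + b)%N) (Ordinal bf) fb0.
apply: leq_trans; rewrite /= leq_add2r.
have : (a < size (f`_b)%R)%N.
  by rewrite ltnNge; apply: contra hab => ha; rewrite nth_default.
by case: (size _).
Qed.

Lemma top_tot_deg_neq0 f : f != 0 -> top (tot_deg f) f != 0.
Proof.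
move=> f0; have sf : (0 < size f)%N by rewrite size_poly_gt0.
have sf' : ((size f).-1 < size f)%N by rewrite prednK.
pose A (b : 'I_(size f)) := f`_b != 0.
have card : (0 < #|A|)%N.
  apply/card_gt0P; exists (Ordinal sf'); rewrite unfold_in /A /=.
  by rewrite -/(lead_coef f) lead_coef_eq0.
have [b fb eb] := @eq_bigmax_cond _ A
  (fun b : 'I_(size f) => ((size (f`_b)%R).-1 + b)%N) card.
have -> : tot_deg f = ((size (f`_b)%R).-1 + b)%N by exact: eb.
apply/eqP => /(congr1 (fun P : {poly F} => P`_b)).
rewrite coef0 coef_poly ltnS leq_addl addnK -/(lead_coef f`_b) => /eqP.
by rewrite lead_coef_eq0 (negPf fb).
Qed.

Lemma local_eq_some f c n : (size f <= n)%N -> (forall b, (size (f`_b)%R <= n)%N) ->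
  local_eq f (Some c) = locd (tot_deg f) c n f.
Proof.
move=> sf sf'; rewrite /local_eq /locd; apply: (@sum_coef_wide _ _ f
  (fun a b => cstP (f`_b`_a) * 'X^(tot_deg f - a - b) * (('X + c%:P) ^+ b)%:P)) => //.
by move=> a b ->; rewrite /cstP !polyC0 !mul0r.
Qed.

Lemma local_eq_none f n : (size f <= n)%N -> (forall b, (size (f`_b)%R <= n)%N) ->
  local_eq f None = locd (tot_deg f) 0 n (swapXY f).
Proof.
move=> sf sf'; rewrite /local_eq /locd exchange_big /=.
rewrite (@sum_coef_wide _ _ f
  (fun a b => cstP (f`_b`_a) * 'X^(tot_deg f - a - b) * ('X ^+ a)%:P) n n) //; last first.
  by move=> a b ->; rewrite /cstP !polyC0 !mul0r.
apply: eq_bigr => b _; apply: eq_bigr => a _; rewrite coef_swapXY addr0.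
by rewrite -!subnDA addnC.
Qed.

Lemma coef_sizes_bound f : exists n, [/\ (size f <= n)%N, (forall b, (size (f`_b)%R <= n)%N),
  (size (swapXY f) <= n)%N & (forall b, (size ((swapXY f)`_b)%R <= n)%N)].
Proof.
pose m := (\max_(b < size f) size (f`_b)%R)%N; exists (size f + m)%N.
have h1 b : (size (f`_b)%R <= m)%N.
  have [bf|bf] := ltnP b (size f); last by rewrite nth_default // size_poly0.
  exact: (leq_bigmax (F := fun b : 'I_(size f) => size (f`_b)%R) (Ordinal bf)).
split.
- exact: leq_addr.
- by move=> b; apply: leq_trans (h1 b) (leq_addl _ _).
- apply/leq_sizeP => a ha; apply/polyP => b; rewrite coef_swapXY coef0 nth_default //.
  exact: leq_trans (h1 b) (leq_trans (leq_addl _ _) ha).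
move=> a; apply/leq_sizeP => b hb; rewrite coef_swapXY [f`_b]nth_default ?coef0 //.
exact: leq_trans (leq_addr _ _) hb.
Qed.

Lemma fx_eval h phi m n : (size h <= n)%N -> (forall a, (size (h`_a)%R <= m)%N) ->
  (fx h).[phi] = \sum_(a < n) \sum_(b < m) cstpuis h`_a`_b * monoP 1 1 ^+ b * phi ^+ a.
Proof.
move=> sh sh'; rewrite (@horner_coef_wide _ n) ?size_fx //; apply: eq_bigr => a _.
rewrite coef_map -mulr_suml; congr (_ * _); apply: etrans (polyxE (sh' a)) _.
by apply: eq_bigr => b _; rewrite /cstpuis monoPX monoPM mulr1 add0r.
Qed.

Lemma polyx_coef_le (q : {poly F}) e b : dle (polyx q) e -> q`_b != 0 -> b%:R <= e.
Proof.
move=> hq; rewrite -coef_polyx => qb; rewrite leNgt; apply: contra qb => /hq ->.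
exact: eqxx.
Qed.

(* The point at infinity is [0 : 1 : 0], so x is first expanded in y. *)
Lemma one_place_none f phi p t0 d : t0 != 0 -> (0 < d)%N -> deg_bound d f ->
  top d f = t0%:P -> fx (swapXY f) != 0 ->
  (forall rho n, root (fx (swapXY f)) rho -> is_polydromy rho n ->
     n = d /\ fx (swapXY f) = cstpuis t0 *: Nm chi d rho) ->
  size (swapXY f) = d.+1 -> lead_coef (swapXY f) = t0%:P ->
  root (fx f) phi -> is_polydromy phi p ->
  exists2 c : F, c != 0 & size f = p.+1 /\ lead_coef f = c%:P.
Proof.
move=> t00 d0 fd ft h0 hroots sh lh rphi hp; set h := swapXY f in h0 hroots sh lh.
have hf a b : h`_a`_b = f`_b`_a by rewrite coef_swapXY.
have f0 : f != 0.
  apply: contraNneq h0 => f0; rewrite fx_eq0 /h f0; apply/eqP/polyP => i.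
  by apply/polyP => j; rewrite coef_swapXY !coef0.
have [|rho rrho] := @puiseux_closed F (fx h); first by rewrite size_fx sh.
have [d' hd'] := polydromy_ex chi rho.
have [dd fxh] := hroots rho d' rrho hd'; rewrite {d'}dd in hd'.
have coefh a : polyx h`_a = cstpuis t0 * (Nm chi d rho)`_a.
  by have := congr1 (fun P : {poly puiseux F} => P`_a) fxh; rewrite coef_map coefZ.
have ct0 : cstpuis t0 != 0 by rewrite fmorph_eq0.
have hle e : dle rho e -> forall a, dle (polyx h`_a) ((d%:R - a%:R) * e).
  move=> he a; rewrite coefh NmE.
  have hs z : z \in [seq sig chi j rho | j <- iota 0 d] -> dle z e.
    by move=> /mapP[j _ ->]; apply: dle_sig.
  have := dleM (@dle_monoP _ 0 t0) (@coef_prod_dle _ _ _ hs a).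
  by rewrite add0r size_map size_iota.
(* Otherwise all coefficients of [h] would be constants, f would not involve y, and it could not
   have the root phi. *)
have rho_gt0 : ~ dle rho 0.
  move=> /hle hle0; have fC : f = (f`_0)%:P.
    apply/polyP => -[|b]; rewrite coefC //=; apply/polyP => a; rewrite coef0 -hf.
    apply/eqP; apply: contraT => /(polyx_coef_le (hle0 a)).
    by rewrite mulr0 lern0.
  have : polyx f`_0 == 0.
    by move: rphi; rewrite fC /fx map_polyC /= rootC coefC.
  rewrite -(rmorph0 (@polyx F)) => /eqP/polyx_inj fz.
  by move: f0; rewrite fC fz polyC0 eqxx.
have rho0 : rho != 0 by apply: contra_notN rho_gt0 => /eqP ->; apply: dle0.
have [e drho] := has_deg_ex rho0.
have e0 : 0 < e by rewrite ltNge; apply/negP => /dleW/(_ drho.2).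
have {}hle := hle e drho.2.
have d0' : 0 < d%:R :> rat by rewrite ltr0n.
(* Up to sign and the constant t0, h_0 is the product of the conjugates of [rho]. So d e is an
   integer n, which will be the degree of f in y. *)
have dh0 : has_deg_x (polyx h`_0) (d%:R * e).
  rewrite coefh -horner_coef0 NmE horner_prod big_map.
  have -> : d%:R * e = 0 + \sum_(j <- iota 0 d) e.
    rewrite add0r big_const_seq count_predT size_iota iter_addr_0 mulr_natl //.
  apply: has_degM; first exact: has_deg_monoP.
  apply: has_deg_prod => j; rewrite hornerXsubC sub0r.
  exact/has_degN/has_deg_sig.
have h00 : h`_0 != 0.
  by apply: contraNneq (has_deg_neq0 dh0) => ->; rewrite rmorph0.
pose n := (size (h`_0)%R).-1.
have ne : n%:R = d%:R * e := has_deg_inj (has_deg_polyx h00) dh0.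
have n0 : (0 < n)%N by rewrite -(ltr0n rat) ne mulr_gt0.
have eE : e = n%:R / d%:R by rewrite ne mulrAC mulfV ?mul1r // gt_eqF.
(* The Newton polygon of f lies under the segment from x^d to y^n, whence the coefficient of y^n is
   a constant and no higher power of y occurs. *)
have supp a b : (a <= d)%N -> h`_a`_b != 0 -> (b * d <= (d - a) * n)%N.
  move=> ad /(polyx_coef_le (hle a)); rewrite eE mulrA ler_pdivlMr //.
  by rewrite -natrB // -!natrM ler_nat.
have hbig a b : (d < a)%N -> h`_a`_b = 0.
  by move=> da; rewrite [h`_a]nth_default ?sh // coef0.
have fnE a : (0 < a)%N -> f`_n`_a = 0.
  move=> a0; rewrite -hf; have [ad|/hbig //] := leqP a d.
  apply/eqP; apply: contraT => /(supp _ _ ad); rewrite mulnC leq_pmul2r //.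
  by rewrite leqNgt ltn_subrL a0 d0.
have fn0 : f`_n`_0 != 0 by rewrite -hf -/(lead_coef h`_0) lead_coef_eq0.
have fnC : f`_n = (f`_n`_0)%:P.
  by apply/polyP => -[|a]; rewrite coefC //= fnE.
have sf : size f = n.+1.
  apply/eqP; rewrite eqn_leq; apply/andP; split.
    apply/leq_sizeP => b nb; apply/polyP => a; rewrite coef0 -hf.
    have [ad|/hbig //] := leqP a d.
    apply/eqP; apply: contraT => /(supp _ _ ad) bd.
    have := leq_trans bd (leq_mul (leq_subr a d) (leqnn n)).
    by rewrite mulnC leq_pmul2l // leqNgt nb.
  rewrite ltnNge; apply/negP => /leq_sizeP /(_ n (leqnn n)) /eqP.
  by rewrite fnC polyC_eq0 (negPf fn0).
have lf : lead_coef f = (f`_n`_0)%:P by rewrite /lead_coef sf.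
exists (f`_n`_0) => //; split => //; rewrite sf; congr _.+1.
have hd : h`_d = t0%:P by rewrite -lh /lead_coef sh.
have sumE : \sum_(a < d.+1) \sum_(b < n.+1) cstpuis h`_a`_b * monoP 1 1 ^+ a * phi ^+ b = 0.
  transitivity (fx f).[phi]; last exact: rootP.
  rewrite exchange_big (@fx_eval f phi d.+1 n.+1) ?sf //; last first.
    by move=> b; apply/leq_sizeP => a da; rewrite -hf hbig.
  by apply: eq_bigr => b _; apply: eq_bigr => a _; rewrite hf.
(* If phi had degree at most 0, the term t0 x^d would exceed all others in f(x, phi). *)
have phi_gt0 : ~ dle phi 0.
  have lastE : \sum_(b < n.+1) cstpuis h`_d`_b * monoP 1 1 ^+ d * phi ^+ b =
      cstpuis t0 * monoP (1 *+ d) 1.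
    rewrite big_ord_recl big1 => [|b _]; last by rewrite hd coefC /= rmorph0 !mul0r.
    by rewrite addr0 hd coefC eqxx mulr1 monoPX.
  move=> phi0; move: sumE; rewrite big_ord_recr /= lastE addrC.
  move=> /(congr1 (fun u : puiseux F => u d%:R)).
  have := @has_degD _ (cstpuis t0 * monoP (1 *+ d) 1)
    (\sum_(i < d) \sum_(b < n.+1) cstpuis h`_i`_b * monoP 1 1 ^+ i * phi ^+ b) d%:R (d%:R - 1).
  case.
  - by rewrite /cstpuis monoPM add0r mulr1; apply: has_deg_monoP.
  - apply: dle_sum => a _; apply: dle_sum => b _; rewrite monoPX /cstpuis monoPM add0r.
    have := dleM (@dle_monoP _ (1 *+ a) (h`_a`_b * 1)) (@dleX _ _ _ b phi0).
    rewrite mul0rn addr0; apply: dleW; rewrite lerBrDr natr1 ler_nat.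
    exact: ltn_ord.
  - by lra.
  by move=> /eqP hne _ hz; apply: hne; rewrite hz pcoef0.
have phi0 : phi != 0 by apply: contra_notN phi_gt0 => /eqP ->; apply: dle0.
have [E dphi] := has_deg_ex phi0.
have E0 : 0 < E by rewrite ltNge; apply/negP => /dleW/(_ dphi.2).
have drho' : has_deg_x rho (n%:R / d%:R) by rewrite -eE.
have [p0 lp _] := hp.
(* This gives n <= p; the converse holds because the norm of phi divides f. *)
have np : (n %| p)%N := inversion t00 hd' drho' n0 fxh supp dphi E0 lp sumE.
apply/eqP; rewrite eqn_leq (dvdn_leq p0 np) /=.
have := dvdp_leq _ (Nm_dvd hp (fx_sfix chi f) rphi).
by rewrite fx_eq0 f0 size_Nm size_fx sf ltnS; apply.
Qed.

Lemma one_place_Nm f phi p : one_place_at_infinity f -> root (fx f) phi ->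
  is_polydromy phi p ->
  exists2 c : F, c != 0 & [/\ size f = p.+1, lead_coef f = c%:P
                        & fx f = cstpuis c *: Nm chi p phi].
Proof.
move=> [P [meetP uniqP irr]] rphi hp.
suff [c c0 [sf lf]] : exists2 c : F, c != 0 & size f = p.+1 /\ lead_coef f = c%:P.
  exists c => //; split => //.
  have -> : cstpuis c = lead_coef (fx f) by rewrite lead_coef_fx lf polyxC.
  by apply: sfix_Nm_eq => //; [exact: fx_sfix|rewrite size_fx].
have [G0 _ _] := irr.
have f0 : f != 0.
  apply: contraNneq G0 => ->; rewrite /local_eq.
  by case: P {meetP uniqP irr} => [c|]; rewrite size_poly0 big_ord0.
have [n0 [sf0 sf0' sh0 sh0']] := coef_sizes_bound f.
set d := tot_deg f; pose n := (n0 + d).+1.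
have nn : (n0 <= n)%N by rewrite /n -addnS leq_addr.
have dn : (d < n)%N by rewrite ltnS leq_addl.
have {nn}[sf sf' sh sh'] : [/\ (size f <= n)%N, (forall b, (size (f`_b)%R <= n)%N),
  (size (swapXY f) <= n)%N & (forall b, (size ((swapXY f)`_b)%R <= n)%N)].
  split; [exact: leq_trans sf0 nn|move=> b|exact: leq_trans sh0 nn|move=> b].
    exact: leq_trans (sf0' b) nn.
  exact: leq_trans (sh0' b) nn.
have fd : deg_bound d f := @tot_deg_bound f.
have hd : deg_bound d (swapXY f).
  by move=> a b; rewrite coef_swapXY addnC; apply: fd.
have top0 : top d f != 0 := top_tot_deg_neq0 f0.
have meet_some c : meets_infinity f (Some c) <-> root (top d f) c.
  rewrite /meets_infinity (local_eq_some c sf sf') locd0 //.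
  rewrite -[X in X = 0]horner_coef0 horner_comp !hornerE.
  by split => [/eqP|/rootP].
have meet_none : meets_infinity f None <-> (top d f)`_d = 0.
  rewrite /meets_infinity (local_eq_none sf sf') locd0 //.
  rewrite -[X in X = 0 <-> _]horner_coef0 horner_comp !hornerE horner_coef0.
  by rewrite !coef_poly ltnSn subnn /= subn0 coef_swapXY.
case: P meetP uniqP irr {G0} => [c|] meetP uniqP irr.
  (* [0 : 1 : 0] is not on the curve, so the top form has full degree d; each of its roots is a
     point at infinity, hence equals c. *)
  have topd : (top d f)`_d != 0 by apply/eqP => /meet_none/uniqP.
  have st : size (top d f) = d.+1.
    apply/eqP; rewrite eqn_leq size_poly /= ltnNge; apply: contra topd => h.
    by rewrite nth_default.
  have [rs topE] := closed_field_poly_normal (top d f).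
  have rsc z : z \in rs -> z = c.
    move=> zrs; have : Some z = Some c; last by case.
    apply: uniqP; apply/meet_some; rewrite topE rootZ ?lead_coef_eq0 //.
    by rewrite root_prod_XsubC.
  have prodE : \prod_(z <- rs) ('X - z%:P) = ('X - c%:P) ^+ size rs.
    rewrite big_seq (eq_bigr (fun=> 'X - c%:P)); last by move=> z /rsc ->.
    by rewrite -big_seq big_const_seq count_predT iter_mulr_1.
  have srs : size rs = d.
    by move: st; rewrite topE size_scale ?lead_coef_eq0 // prodE size_exp_XsubC => -[].
  rewrite prodE srs in topE.
  rewrite (local_eq_some c sf sf') in irr.
  have l0 : lead_coef (top d f) != 0 by rewrite lead_coef_eq0.
  have [s1 l1 pd _] := germ_top chi l0 sf sf' dn fd topE irr rphi hp.
  by exists (lead_coef (top d f)) => //; rewrite pd.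
(* No point [1 : z : 0] is on the curve, so the top form has no roots and is a constant times
   x^d. *)
have st : size (top d f) = 1%N.
  apply/eqP; apply: contraT => /closed_rootP[z /meet_some/uniqP] //.
have [t0 t00 topE] : exists2 t0 : F, t0 != 0 & top d f = t0%:P.
  by exists (top d f)`_0; [rewrite -polyC_eq0 -size1_polyC ?st|rewrite -size1_polyC ?st].
have d0 : (0 < d)%N.
  rewrite lt0n; apply: contra t00 => /eqP d0; move/meet_none: meetP.
  by rewrite topE d0 coefC eqxx => ->.
have topE' : top d (swapXY f) = t0 *: ('X - 0%:P) ^+ d.
  apply/polyP => b; rewrite subr0 coefZ coefXn coef_poly coef_swapXY ltnS.
  case: leqP => [bd|db]; last by rewrite gtn_eqF // mulr0.
  have := congr1 (fun P : {poly F} => P`_(d - b)) topE.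
  rewrite coef_poly ltnS leq_subr subKn // => ->; rewrite coefC subn_eq0.
  by rewrite eqn_leq bd /=; case: leqP; rewrite ?mulr1 ?mulr0.
rewrite (local_eq_none sf sf') in irr.
have key rho m : root (fx (swapXY f)) rho -> is_polydromy rho m -> _ :=
  germ_top chi t00 sh sh' dn hd topE' irr.
have h0 : fx (swapXY f) != 0.
  rewrite fx_eq0; apply: contraNneq top0 => h0; apply/eqP/polyP => b.
  by rewrite coef_poly -coef_swapXY h0 !coef0; case: ifP.
have hdd : (swapXY f)`_d`_0 = t0.
  by rewrite coef_swapXY -[t0](coefC t0 0) -topE coef_poly /= subn0.
have sd : (d < size (swapXY f))%N.
  rewrite ltnNge; apply: contra t00 => hs; rewrite -hdd.
  by rewrite [(swapXY f)`_d]nth_default // coef0.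
have [|rho rrho] := @puiseux_closed F (fx (swapXY f)).
  by rewrite size_fx (leq_trans _ sd).
have [m hm] := polydromy_ex chi rho.
have [s1 l1 _ _] := key rho m rrho hm.
apply: (one_place_none t00 d0 fd topE h0 _ s1 l1 rphi hp).
by move=> rho' m' rr hm'; have [_ _ em ef] := key _ _ rr hm'; rewrite -[in Nm _ d]em.
Qed.

End OnePlaceFactor.

(** * Semidegrees and Puiseux roots *)

Section Generic.
Variables (F : numClosedFieldType) (chi : charQ F).

Definition lift_coef : puiseux F -> puiseux {poly F} := map_puis (@polyC F).
HB.instance Definition _ := GRing.RMorphism.copy lift_coef (map_puis (@polyC F)).

Definition gser (phi : puiseux F) (r : rat) : puiseux {poly F} :=
  lift_coef phi + monoP r 'X.

Lemma pser_gser phi r : pser (gser phi r) = generic_series phi r.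
Proof. by apply/funext => e; rewrite /gser pcoefD. Qed.

(** Evaluation at y = [S], after the constants are extended from F to F[xi]. *)
Definition at_ser (S : puiseux {poly F}) : {poly puiseux F} -> puiseux {poly F} :=
  horner_eval S \o map_poly lift_coef.
HB.instance Definition _ S := GRing.RMorphism.copy (at_ser S)
  (horner_eval S \o map_poly lift_coef).

Lemma lift_coef_polyx (q : {poly F}) :
  lift_coef (polyx q) = polyx (map_poly (@polyC F) q).
Proof.
rewrite (polyxE (leqnn _)) (polyxE (size_poly _ _)) raddf_sum; apply: eq_bigr => a _.
by rewrite coef_map; apply: map_monoP.
Qed.

Lemma peval_lift_xi (g : {poly {poly F}}) (S : puiseux {poly F}) :
  peval (lift_xi g) S = at_ser S (fx g).
Proof.
apply/funext => e; rewrite peval_horner /at_ser /= /horner_eval; congr (pser _ e).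
congr (_.[S]); apply/polyP => b; rewrite !coef_map /=.
by rewrite lift_coef_polyx.
Qed.

Lemma at_serC (S : puiseux {poly F}) u : at_ser S u%:P = lift_coef u.
Proof. by rewrite /at_ser /= map_polyC /= /horner_eval hornerC. Qed.

Lemma at_ser_XsubC (S : puiseux {poly F}) z : at_ser S ('X - z%:P) = S - lift_coef z.
Proof. by rewrite rmorphB /= at_serC /at_ser /= map_polyX /horner_eval hornerX. Qed.

Lemma has_deg_lift (u : puiseux F) e : has_deg_x u e -> has_deg_x (lift_coef u) e.
Proof. by move=> [h1 h2]; split; [rewrite /= polyC_eq0|apply: dle_map]. Qed.

Section OneSeries.
Variables (phi : puiseux F) (r : rat).
Let S := gser phi r.
Implicit Types z u : puiseux F.

Lemma gser_at z e : (S - lift_coef z) e = (phi e - z e)%:P + mono r 'X e.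
Proof. by rewrite /S /gser pcoefB pcoefD /= polyCB addrAC. Qed.

Lemma gser_deg_ex z : exists e, has_deg_x (S - lift_coef z : puiseux {poly F}) e.
Proof.
apply: has_deg_ex; apply/eqP => /(congr1 (fun u : puiseux {poly F} => u r)).
rewrite pcoef0 gser_at /mono eqxx addrC => /eqP; rewrite -size_poly_eq0.
by rewrite size_XaddC.
Qed.

Definition gdeg z : rat := projT1 (cid (gser_deg_ex z)).

Lemma gdegP z : has_deg_x (S - lift_coef z : puiseux {poly F}) (gdeg z).
Proof. by rewrite /gdeg; case: cid. Qed.

(** The coefficient of x^r involves xi, which [z] cannot cancel. *)
Lemma gdeg_ge z : r <= gdeg z.
Proof.
rewrite leNgt; apply/negP => /((gdegP z).2 r).
rewrite gser_at /mono eqxx addrC => /eqP; rewrite -size_poly_eq0.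
by rewrite size_XaddC.
Qed.

(** The ultrametric inequality for S - z' = (S - z) + (z - z'). *)
Lemma gdeg_le z z' c : dle (z - z') c -> c <= gdeg z -> gdeg z' <= gdeg z.
Proof.
move=> hz hc; apply: has_deg_le (gdegP z') _.
have -> : S - lift_coef z' = (S - lift_coef z) + lift_coef (z - z').
  by rewrite rmorphB /= addrA subrK.
by apply: dleD; [exact: (gdegP z).2|apply/dle_map/(dleW hc)].
Qed.

Lemma gdeg_eq z e : gdeg z < e -> z e = phi e.
Proof.
move=> he; have := (gdegP z).2 _ he; rewrite gser_at /mono gt_eqF; last first.
  exact: le_lt_trans (gdeg_ge z) he.
by rewrite addr0 => /eqP; rewrite polyC_eq0 subr_eq0 => /eqP.
Qed.

Lemma has_deg_Nm n u : has_deg_x (at_ser S (Nm chi n u)) (\sum_(a < n) gdeg (sig chi a u)).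
Proof.
rewrite /Nm rmorph_prod /=; apply: has_deg_prod => a; rewrite at_ser_XsubC.
exact: gdegP.
Qed.

End OneSeries.
End Generic.

Lemma sum_periodic (V : nmodType) (G : nat -> V) p m : (forall a, G (a + p)%N = G a) ->
  \sum_(a < m * p) G a = (\sum_(a < p) G a) *+ m.
Proof.
move=> hG; have hG' k a : G (a + k * p)%N = G a.
  elim: k => [|k IH]; first by rewrite addn0.
  by rewrite mulSn addnCA addnA [(p + a)%N]addnC -addnA addnCA addnC hG IH.
elim: m => [|m IH]; first by rewrite mul0n big_ord0.
rewrite mulSnr big_split_ord /= IH mulrSr; congr (_ + _).
by apply: eq_bigr => a _; rewrite addnC hG'.
Qed.

(** * Exchanging conjugacy classes of roots for classes of selected roots *)

Section Selection.
Variables (F : numClosedFieldType) (chi : charQ F).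
Variables (N : nat) (phi : 'I_N -> puiseux F) (r : 'I_N -> rat).
Variables (J : finType) (rt : J -> puiseux F) (pol : J -> nat).
Hypothesis rtP : forall j, is_polydromy (rt j) (pol j).
Hypothesis select : forall (u : puiseux F) n, is_polydromy u n -> (0 < N)%N ->
  exists j a0, (pol j %| n)%N /\
    forall k a, gdeg (phi k) (r k) (sig chi a (rt j))
                  <= gdeg (phi k) (r k) (sig chi a (sig chi a0 u)).

(** For the roots of the f_ij this becomes delta_k(f_ij) / delta_k(x). *)
Definition wt k j : rat := \sum_(a < pol j) gdeg (phi k) (r k) (sig chi a (rt j)).

Lemma Nm_sig n (u : puiseux F) a0 : is_polydromy u n -> Nm chi n (sig chi a0 u) = Nm chi n u.
Proof.
move=> hu; have [n0 un _] := (is_polydromyP chi u n).1 hu.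
have ru : root (Nm chi n u) u.
  by case: n n0 {hu un} => // n _; rewrite /Nm big_ord_recl rootM root_XsubC /= sig0 eqxx.
have := sfix_Nm_eq (polydromy_sig chi a0 hu) (Nm_sfix un)
  (root_sig a0 (Nm_sfix un) ru) (size_Nm chi n u).
by rewrite (monicP (Nm_monic _ _ _)) scale1r => ->.
Qed.

(** A class of n roots is exchanged for n / pol j copies of the class of [rt j]; by [select] the
    total degree grows along no generic series. *)
Lemma dominated (P : {poly puiseux F}) : P \is monic -> sfix chi P ->
  exists (beta : nat) (gamma : {ffun J -> nat}),
    (size P).-1 = (beta + \sum_j gamma j * pol j)%N /\
    forall k, exists2 t, has_deg_x (at_ser (gser (phi k) (r k)) P) t
      & gdeg (phi k) (r k) 0 *+ beta + \sum_j wt k j *+ gamma j <= t.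
Proof.
move=> mP fP; suff [] : P \is monic /\
  exists (beta : nat) (gamma : {ffun J -> nat}),
    (size P).-1 = (beta + \sum_j gamma j * pol j)%N /\
    forall k, exists2 t, has_deg_x (at_ser (gser (phi k) (r k)) P) t
      & gdeg (phi k) (r k) 0 *+ beta + \sum_j wt k j *+ gamma j <= t by [].
move: P mP fP; apply: (@sfix_ind _ chi) => [|P u n [mP [beta [gamma [sP IH]]]] hu].
  split; first exact: monic1.
  exists 0%N, [ffun=> 0%N]; split.
    by rewrite size_poly1 big1 // => j _; rewrite ffunE.
  move=> k; exists 0; first by rewrite rmorph1; apply: has_deg1.
  by rewrite mulr0n add0r big1 // => j _; rewrite ffunE.
split; first by rewrite monicMr // Nm_monic.
have sNP : (size (Nm chi n u * P)%R).-1 = (n + (size P).-1)%N.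
  rewrite size_monicM ?Nm_monic ?monic_neq0 // size_Nm addSn /=.
  by case: (size P) (size_poly_gt0 P); rewrite ?monic_neq0 // => m; rewrite addnS.
(* Without components at infinity there is nothing to dominate, and the whole degree goes to the
   power of y. *)
have [N0|N0] := posnP N.
  exists (n + beta)%N, gamma; split; first by rewrite sNP sP addnA.
  by move=> k; have := leq_ltn_trans (leq0n k) (ltn_ord k); rewrite lt0n N0.
have [j [a0 [/dvdnP[m nm] hj]]] := select hu N0.
pose delta i := if i == j then m else 0%N.
exists beta, [ffun i => gamma i + delta i]%N; split.
  have -> : (\sum_i [ffun i => gamma i + delta i] i * pol i =
      \sum_i gamma i * pol i + \sum_i delta i * pol i)%N.
    by rewrite -big_split; apply: eq_bigr => i _; rewrite ffunE mulnDl.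
  have -> : (\sum_i delta i * pol i = n)%N.
    rewrite (bigD1 j) //= /delta eqxx big1 ?addn0 // => i /negPf ->.
    by rewrite mul0n.
  by rewrite sNP sP addnC addnA.
move=> k; have [t ht le_t] := IH k.
exists ((\sum_(a < n) gdeg (phi k) (r k) (sig chi a (sig chi a0 u))) + t).
  rewrite -(Nm_sig a0 hu) rmorphM /=; apply: has_degM => //.
  exact: has_deg_Nm.
have -> : \sum_i wt k i *+ [ffun i => gamma i + delta i]%N i =
    \sum_i wt k i *+ gamma i + \sum_i wt k i *+ delta i.
  by rewrite -big_split; apply: eq_bigr => i _; rewrite ffunE mulrnDr.
have -> : \sum_i wt k i *+ delta i = wt k j *+ m.
  rewrite (bigD1 j) //= /delta eqxx big1 ?addr0 // => i /negPf ->.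
  by rewrite mulr0n.
rewrite addrA addrC; apply: lerD => //.
(* The n = m pol(j) conjugates of the given root are compared, index by index, with m rounds through
   the conjugates of [rt j]. *)
rewrite /wt -(@sum_periodic _ (fun a => gdeg (phi k) (r k) (sig chi a (rt j)))); last first.
  move=> a; congr gdeg; rewrite sigD.
  by have [_ -> _] := (is_polydromyP chi _ _).1 (rtP j).
by rewrite -nm; apply: ler_sum.
Qed.

End Selection.

Lemma prod_p_recr (s : seq (int * nat)) j : (j < size s)%N ->
  prod_p s j.+1 = (prod_p s j * (nth (0%R, 1%N) s j).2)%N.
Proof. by move=> js; rewrite /prod_p (take_nth (0, 1%N)) // big_rcons. Qed.

Lemma in_laurent_trunc (A : comNzRingType) (phi : puiseux A) p (P : pred rat) :
  (forall e, P e -> phi e != 0 -> e * p%:R \is a Num.int) ->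
  in_laurent p (fun e => if P e then phi e else 0).
Proof.
move=> h; have [q q0 [_ [M hM]]] := puiseuxP phi; split.
  by move=> e; case: ifP => [/h//|_]; rewrite eqxx.
by exists M => e /hM ->; case: ifP.
Qed.

(** The terms above the exponent have the smaller denominator and those including it do not, so the
    term at the exponent itself is present. *)
Lemma char_exp_coef (A : comNzRingType) (phi : puiseux A) s j :
  puiseux_pairs phi s -> (j < size s)%N -> phi (char_exp s j) != 0.
Proof.
move=> [_ h] js; have [_ _ h1 h2] := h j js; apply/negP => /eqP h0; apply: h2.
apply: (@in_laurent_trunc _ phi _ (fun e => char_exp s j <= e)) => e.
rewrite le_eqVlt => /orP[/eqP <-|he]; first by rewrite h0 eqxx.
by move=> phie; apply: h1.1; rewrite /trunc_gt he.
Qed.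

(** If n = m p_1 ... p_j, integrality of n q_(j+1) / (p_1 ... p_(j+1)) says that p_(j+1) divides m
    q_(j+1), hence m by coprimality. *)
Lemma pairs_divide (A : comNzRingType) (phi v : puiseux A) s n j :
  (0 < n)%N -> puiseux_pairs phi s -> in_laurent n v -> (j <= size s)%N ->
  (forall m, (m < j)%N -> v (char_exp s m) = phi (char_exp s m)) ->
  (prod_p s j %| n)%N.
Proof.
move=> n0 hs lv; elim: j => [|j IH] js hv; first by rewrite /prod_p take0 big_nil dvd1n.
have {IH} /dvdnP[m nm] := IH (ltnW js) (fun i ij => hv i (ltnW ij)).
have [co p2 _ _] := hs.2 j js; set qp := nth _ s j in co p2.
have vj : v (char_exp s j) != 0 by rewrite hv // (char_exp_coef hs).
have /intrP[z] := lv.1 _ vj; rewrite /char_exp -/qp prod_p_recr // -/qp nm.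
have P0 : (prod_p s j)%:R != 0 :> rat.
  by rewrite pnatr_eq0; apply: contraTneq n0 => P0; rewrite nm P0 muln0.
have p0 : qp.2%:R != 0 :> rat by rewrite pnatr_eq0 -lt0n (leq_trans _ p2).
rewrite !natrM => hz; have {}hz : qp.1 * m%:Z = z * qp.2%:Z.
  apply: (@intr_inj rat); rewrite !rmorphM /= -hz.
  by field; rewrite P0 p0.
rewrite mulnC dvdn_pmul2r //; last by rewrite lt0n -(eqr_nat rat).
have : (qp.2 %| `|qp.1| * m)%N.
  by apply/dvdnP; exists `|z|%N; rewrite -[m]/(`|m%:Z|%N) -abszM hz abszM.
by rewrite Gauss_dvdr // coprime_sym.
Qed.

Section SelectRoot.
Variables (F : numClosedFieldType) (chi : charQ F).
Variables (N : nat) (phi : 'I_N -> puiseux F) (r : 'I_N -> rat).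
Variables (l : 'I_N -> nat) (qp : forall i : 'I_N, (l i).+1.-tuple (int * nat)).
Hypothesis Hqp : forall i, formal_puiseux_pairs (phi i) (r i) (qp i).
Variable rt : IJ l -> puiseux F.
Hypothesis rt_pairs : forall i (j : 'I_(l i).+1),
  puiseux_pairs (rt (existT _ i j)) (take j (qp i)).
Hypothesis rt_agree : forall i (j : 'I_(l i).+1) e, char_exp (qp i) j < e ->
  rt (existT _ i j) e = phi i e.

Definition pol (ij : IJ l) : nat := prod_p (qp (tag ij)) (tagged ij).

Lemma pol_polydromy ij : is_polydromy (rt ij) (pol ij).
Proof.
case: ij => i j; have [h _] := rt_pairs j; move: h.
have sj : (j <= size (qp i))%N by rewrite size_tuple; exact: ltnW.
by rewrite /prod_p size_takel // take_oversize // size_takel.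
Qed.

Lemma select_root (u : puiseux F) n : is_polydromy u n -> (0 < N)%N ->
  exists j a0, (pol j %| n)%N /\
    forall k a, gdeg (phi k) (r k) (sig chi a (rt j))
                  <= gdeg (phi k) (r k) (sig chi a (sig chi a0 u)).
Proof.
move=> hu N0; have [n0 un _] := (is_polydromyP chi u n).1 hu.
pose G (ka : 'I_N * 'I_n) := gdeg (phi ka.1) (r ka.1) (sig chi ka.2 u).
(* Conjugates are periodic of period n, so the minimum over all of them is one over finitely many
   pairs. *)
case: (@Order.TotalTheory.arg_minP _ _ _ (Ordinal N0, Ordinal n0) xpredT G isT).
move=> [i a0] _ /=; rewrite {1}/G /=; set c := gdeg _ _ _ => hmin.
pose v := sig chi a0 u; have hv : is_polydromy v n := polydromy_sig chi a0 hu.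
have cmin k a : c <= gdeg (phi k) (r k) (sig chi a v).
  have -> : sig chi a v = sig chi ((a + a0) %% n) u.
    rewrite /v -sigD [in LHS](divn_eq (a + a0) n) addnC sigD.
    congr (sig _ _ _); elim: (_ %/ n)%N => [|m IH]; first by rewrite mul0n sig0.
    by rewrite mulSn sigD IH.
  exact: (hmin (k, Ordinal (ltn_pmod (a + a0) n0)) isT).
have vE e : c < e -> v e = phi i e by apply: gdeg_eq.
have [hpairs rE lp co] := Hqp i.
have ci : char_exp (qp i) (l i) <= c by rewrite -rE; apply: gdeg_ge.
(* The last index qualifies: its exponent is r_i, and c is at least r_i because of the term in
   xi. *)
have ex : exists j, char_exp (qp i) j <= c by exists (l i).
have [j hj jmin] := ex_minnP ex.
have jl : (j < (l i).+1)%N by rewrite ltnS; apply: jmin.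
exists (existT _ i (Ordinal jl)), a0; split; last first.
  move=> k a; apply: gdeg_le (cmin k a).
  rewrite -rmorphB; apply: dle_sig => e he.
  by rewrite pcoefB vE // rt_agree ?subrr //; apply: le_lt_trans he.
have st : size (take (l i) (qp i)) = l i by rewrite size_takel // size_tuple.
have -> : pol (existT _ i (Ordinal jl)) = prod_p (take (l i) (qp i)) j.
  by rewrite /pol /prod_p /= take_takel.
apply: (pairs_divide n0 hpairs (v := v)); [by case: hv|by rewrite st|].
move=> m mj; have ml : (m < l i)%N by apply: leq_trans mj _.
have -> : char_exp (take (l i) (qp i)) m = char_exp (qp i) m.
  by rewrite /char_exp nth_take // /prod_p take_takel.
(* By minimality of j the earlier characteristic exponents exceed c, and there [v] agrees with
   phi_i. *)
by apply: vE; rewrite ltNge; apply/negP => /jmin; rewrite leqNgt mj.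
Qed.

End SelectRoot.

(** * Semidegrees computed as degrees along generic series *)

Section DegreeFormula.
Variables (F : numClosedFieldType) (delta : Kxy F -> int) (r : rat).
Variables (phi : rat -> F).
Hypotheses (dx0 : 0 < delta (toK var_x)) (Hphi : is_generic_puiseux delta phi r).

Lemma finite_series_puiseux : is_puiseux phi.
Proof.
have [[fin lat] _ _ _] := Hphi; have /finite_seqP[s hs] := fin.
exists `|delta (toK var_x)|%N; first by rewrite absz_gt0 gt_eqF.
split.
  by move=> e /lat; rewrite natr_absz gtr0_norm.
exists (\sum_(x <- s) `|x|) => e he; apply/eqP; apply: contraTT he => pe.
have es : e \in s by have : [set` s] e by rewrite -hs.
rewrite -leNgt (big_rem e) //=; apply: le_trans (ler_norm _) _.
by rewrite lerDl sumr_ge0.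
Qed.

Definition gphi : puiseux F := mkP finite_series_puiseux.

Lemma delta_deg (g : Pxy F) t : g != 0 ->
  has_deg_x (at_ser (gser gphi r) (fx g)) t ->
  (delta (toK g))%:~R = (delta (toK var_x))%:~R * t.
Proof.
move=> g0 ht; have [_ _ _ h] := Hphi; have [dg [dh [h1 h2 h3]]] := h g 1 g0 (oner_neq0 _).
move: h1 h2 h3; rewrite -(pser_gser gphi r) !peval_lift_xi.
rewrite /fx rmorph1 rmorph1 => /(has_deg_inj ht) <- /(has_deg_inj (has_deg1 _)) <-.
by rewrite [toK 1]tofrac1 divr1 subr0.
Qed.

Lemma delta_deg_ex (g : Pxy F) : g != 0 ->
  exists t, has_deg_x (at_ser (gser gphi r) (fx g)) t.
Proof.
move=> g0; have [_ _ _ h] := Hphi; have [dg [dh [h1 _ _]]] := h g 1 g0 (oner_neq0 _).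
by exists dg; rewrite -peval_lift_xi pser_gser.
Qed.

Lemma deltaM (g h : Pxy F) : g != 0 -> h != 0 ->
  delta (toK (g * h)) = delta (toK g) + delta (toK h).
Proof.
move=> g0 h0; have [t ht] := delta_deg_ex g0; have [t' ht'] := delta_deg_ex h0.
apply: (@intr_inj rat); rewrite rmorphD /= (delta_deg g0 ht) (delta_deg h0 ht') -mulrDr.
apply: delta_deg; first by rewrite mulf_neq0.
by rewrite /fx !rmorphM; apply: has_degM.
Qed.

Lemma deltaD (g h : Pxy F) d : g != 0 -> h != 0 -> g + h != 0 ->
  delta (toK g) <= d -> delta (toK h) <= d -> delta (toK (g + h)) <= d.
Proof.
move=> g0 h0 gh0; have [t ht] := delta_deg_ex g0; have [t' ht'] := delta_deg_ex h0.
have [s hs] := delta_deg_ex gh0; have dx0' : 0 < (delta (toK var_x))%:~R :> rat by rewrite ltr0z.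
rewrite -!(ler_int rat) (delta_deg g0 ht) (delta_deg h0 ht') (delta_deg gh0 hs).
rewrite -!ler_pdivlMl // => td t'd; apply: has_deg_le hs _.
rewrite /fx !rmorphD; apply: dleD; [exact: dleW td ht.2|exact: dleW t'd ht'.2].
Qed.

Lemma delta_cst (c : F) : c != 0 -> delta (toK (cstP c)) = 0.
Proof.
move=> c0; apply: (@intr_inj rat); rewrite -[RHS](mulr0 (delta (toK var_x))%:~R).
apply: delta_deg; first by rewrite !polyC_eq0.
rewrite /fx /cstP map_polyC /= polyxC at_serC.
exact/has_deg_lift/has_deg_monoP.
Qed.

Lemma delta_var_y : (delta (toK var_y))%:~R = (delta (toK var_x))%:~R * gdeg gphi r 0.
Proof.
apply: delta_deg; first by rewrite polyX_eq0.
have -> : fx var_y = 'X - 0%:P :> {poly puiseux F} by rewrite /fx map_polyX subr0.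
by rewrite at_ser_XsubC; apply: gdegP.
Qed.

End DegreeFormula.

(** * Linear algebra *)

Section Spans.
Variable F : fieldType.
Implicit Types (V : set (Pxy F)).

(** [lin_span] admits lists with repetitions; collecting equal indices rewrites a combination over a
    prescribed duplicate-free list. *)
Lemma sum_count (V : nmodType) (I : eqType) (G : I -> V) (s u : seq I) :
  uniq u -> (forall i, i \in s -> i \in u) ->
  \sum_(i <- s) G i = \sum_(i <- u) G i *+ count_mem i s.
Proof.
move=> uu; elim: s => [|x s IH] su; first by rewrite big_nil big1.
rewrite big_cons IH => [|i si]; last by rewrite su // inE si orbT.
under [RHS]eq_bigr => i _ do rewrite /= mulrnDr.
rewrite big_split /=; congr (_ + _).
rewrite (bigD1_seq x) ?su ?mem_head //= eqxx big1 ?addr0 // => i.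
by rewrite eq_sym => /negPf ->.
Qed.

Variables (I : choiceType) (A : set I) (g : I -> Pxy F).

Lemma span0 : lin_span A g 0.
Proof. by exists [::], (fun=> 0); rewrite big_nil. Qed.

Lemma cstPMn (c : F) n : cstP c *+ n = cstP (c *+ n).
Proof. by rewrite /cstP !polyCMn. Qed.

Lemma spanD f h : lin_span A g f -> lin_span A g h -> lin_span A g (f + h).
Proof.
move=> [s [c [sA ->]]] [t [d [tA ->]]]; pose u := undup (s ++ t).
have uu : uniq u by apply: undup_uniq.
exists u, (fun i => c i *+ count_mem i s + d i *+ count_mem i t); split.
  by move=> i; rewrite mem_undup mem_cat => /orP[/sA|/tA].
rewrite (@sum_count _ _ _ s u uu); last by move=> i si; rewrite mem_undup mem_cat si.
rewrite (@sum_count _ _ _ t u uu); last first.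
  by move=> i si; rewrite mem_undup mem_cat si orbT.
rewrite -big_split; apply: eq_bigr => i _.
by rewrite /cstP !polyCD !polyCMn mulrDl !mulrnAl.
Qed.

Lemma span_gen i c : A i -> lin_span A g (cstP c * g i).
Proof.
by move=> Ai; exists [:: i], (fun=> c); split; [move=> j; rewrite inE => /eqP ->|rewrite big_seq1].
Qed.

End Spans.

Lemma spanS (F : fieldType) (I J : choiceType) (A : set I) (B : set J)
    (g : I -> Pxy F) (h : J -> Pxy F) (k : I -> J) :
  (forall i, A i -> B (k i) /\ g i = h (k i)) -> lin_span A g `<=` lin_span B h.
Proof.
move=> AB f [s [c [sA ->]]]; rewrite big_seq; apply: big_ind.
- exact: span0.
- exact: spanD.
by move=> i /sA/AB[Bk ->]; apply: span_gen.
Qed.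

(** With more vectors than generators, the matrix of coefficients has a nonzero vector in its left
    kernel, which contradicts freeness. *)
Lemma steinitz (F : fieldType) (I J : choiceType) (A : set I) (g : I -> Pxy F)
    (h : J -> Pxy F) (s : seq I) (t : seq J) :
  lin_free A g -> uniq s -> (forall i, i \in s -> A i) ->
  (forall i, i \in s -> lin_span [set` t] h (g i)) -> (size s <= size t)%N.
Proof.
move=> free us sA hs; apply: leq_trans (size_undup t); set u := undup t.
have uu : uniq u by apply: undup_uniq.
have [c hc] : exists c : I -> J -> F, forall i, i \in s ->
    g i = \sum_(j <- u) cstP (c i j) * h j.
  have /choice[c hc] : forall i, exists ci : J -> F, i \in s ->
      g i = \sum_(j <- u) cstP (ci j) * h j.
    move=> i; case: (boolP (i \in s)) => [si|_]; last by exists (fun=> 0).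
    have [s' [d [s't ->]]] := hs i si; exists (fun j => d j *+ count_mem j s') => _.
    rewrite (@sum_count _ _ _ s' u uu); last by move=> j /s't; rewrite mem_undup.
    by apply: eq_bigr => j _; rewrite -cstPMn mulrnAl.
  by exists c.
case: s us sA hs hc => // i0 s' us sA hs hc; set s := i0 :: s' in us sA hs hc *.
rewrite leqNgt; apply/negP => ut.
pose M : 'M[F]_(size s, size u) := \matrix_(i, j) c (nth i0 s i) (tnth (in_tuple u) j).
have : kermx M != 0.
  rewrite kermx_eq0 /row_free; apply: contraTneq ut => rM.
  by rewrite -leqNgt -rM rank_leq_col.
move=> /rowV0Pn[v /sub_kermxP vM v0].
pose d i := v 0 (insubd (Ordinal (isT : 0 < size s)%N) (index i s)).
have dE (i : 'I_(size s)) : d (nth i0 s i) = v 0 i.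
  rewrite /d index_uniq //; congr (v 0 _); apply/val_inj.
  by rewrite val_insubd ltn_ord.
suff h0 : \sum_(i <- s) cstP (d i) * g i = 0.
  have d0 := free s d us sA h0.
  move/eqP: v0; apply; apply/rowP => i; rewrite mxE -dE; apply: d0.
  exact: mem_nth.
rewrite (big_nth i0) big_mkord.
transitivity (\sum_(j <- u) cstP (\sum_(i < size s) v 0 i * c (nth i0 s i) j) * h j).
  under [RHS]eq_bigr => j _ do rewrite /cstP !raddf_sum mulr_suml.
  rewrite exchange_big; apply: eq_bigr => i _; rewrite dE hc ?mem_nth // mulr_sumr.
  by apply: eq_bigr => j _; rewrite /cstP mulrA -!polyCM.
rewrite big_tnth big1 // => j _.
have := congr1 (fun w : 'rV_(size u) => w 0 j) vM; rewrite !mxE => vMj.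
under eq_bigr => i _ do rewrite -[c _ _](mxE matrix_key (fun i j => c (nth i0 s i) (tnth (in_tuple u) j)) i j).
by rewrite -/M vMj /cstP !polyC0 mul0r.
Qed.

Lemma lin_free_nth (F : fieldType) (I : choiceType) (A : set I) (g : I -> Pxy F)
    (s : seq I) (i0 : I) : uniq s -> (forall i, i \in s -> A i) -> lin_free A g ->
  lin_free `I_(size s) (fun k => g (nth i0 s k)).
Proof.
move=> us sA free t c ut tI sum0 k kt.
have tk k' : k' \in t -> (k' < size s)%N by move=> /tI.
have := free [seq nth i0 s k' | k' <- t] (fun i => c (index i s)).
rewrite map_inj_in_uniq; last first.
  by move=> x y xt yt /eqP; rewrite nth_uniq ?tk // => /eqP.
move=> /(_ ut) hfree; rewrite -(index_uniq i0 (tk _ kt) us).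
apply: hfree; last exact: map_f.
  by move=> i /mapP[k' k't ->]; apply/sA/mem_nth/tk.
rewrite big_map -[RHS]sum0 big_seq [RHS]big_seq; apply: eq_bigr => k' k't.
by rewrite index_uniq // tk.
Qed.

Lemma basis_dim (F : fieldType) (I : choiceType) (A : set I) (g : I -> Pxy F)
    (V : set (Pxy F)) n : is_basis A g V -> (has_dim V n <-> (A #= `I_n)%card).
Proof.
move=> [spanA freeA]; split.
  move=> [b [spanb freeb]].
  have In : `I_n = [set` iota 0 n] by apply/seteqP; split=> k /=; rewrite mem_iota add0n.
  have le_n (s : seq I) : uniq s -> (forall i, i \in s -> A i) -> (size s <= n)%N.
    move=> us sA; rewrite -(size_iota 0 n); refine (steinitz (h := b) freeA us sA _).
    move=> i /sA Ai; rewrite -In spanb -spanA.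
    have := span_gen g 1 Ai; by rewrite /cstP !polyC1 mul1r.
  have finA : finite_set A.
    apply: contrapT => /(infinite_set_fset n.+1)[B BA Bn].
    have := le_n (finmap.enum_fset B) (finmap.fset_uniq B) (fun i iB => BA i iB); rewrite leqNgt.
    by rewrite (leq_trans _ Bn).
  have [m Am] := finA; pose s : seq I := finmap.enum_fset (fset_set A).
  have us : uniq s := finmap.fset_uniq _.
  have sA : A = [set` s] by apply/seteqP; split=> i /=; rewrite in_fset_set // inE.
  have sm : size s = m := card_fset_set Am.
  have mn : (m <= n)%N by rewrite -sm; apply: le_n => // i; rewrite sA.
  have nm : (n <= m)%N.
    rewrite -sm -{1}(size_iota 0 n).
    refine (steinitz (A := `I_n) (h := g) freeb (iota_uniq 0 n) _ _).
      by move=> k; rewrite mem_iota add0n.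
    move=> k; rewrite mem_iota add0n /= => kn; rewrite -sA spanA -spanb.
    have := @span_gen _ _ `I_n b k 1 kn; by rewrite /cstP !polyC1 mul1r.
  by have <- : m = n by apply/eqP; rewrite eqn_leq mn.
move=> An; have finA : finite_set A by exists n.
pose s : seq I := finmap.enum_fset (fset_set A); have us : uniq s := finmap.fset_uniq _.
have sA i : i \in s <-> A i by rewrite in_fset_set // inE.
have sn : size s = n := card_fset_set An.
(* The empty basis is treated apart, since [nth] needs a default index. *)
case: n An sn => [|n] An sn.
  exists (fun=> 0); split; last first.
    by move=> t c _ tI _ k /tI.
  rewrite -spanA; apply/seteqP; split=> [f [t [c [tI ->]]]|f [t [c [tA ->]]]].
    by rewrite big_seq big1; [exact: span0|move=> k /tI].
  rewrite big_seq big1; [exact: span0|move=> i /tA/sA].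
  by rewrite (size0nil sn).
have [i0 _] : exists i0, i0 \in s.
  by case: s sn {us sA} => // i0 s' _; exists i0; rewrite mem_head.
exists (fun k => g (nth i0 s k)); split; last first.
  by rewrite -sn; apply: lin_free_nth freeA => // i /sA.
rewrite -spanA; apply/seteqP; split.
  apply: (spanS (k := nth i0 s)) => k /= kn; split => //.
  by apply/sA/mem_nth; rewrite sn.
apply: (spanS (k := index^~ s)) => i /sA si /=; split.
  by rewrite -sn index_mem.
by rewrite nth_index.
Qed.

(** * Leading terms and the Cox ring *)

Section LeadingTerms.
Variables (F : fieldType) (N : nat) (delta : 'I_N -> Kxy F -> int).
Variables (l : 'I_N -> nat) (f : IJ l -> Pxy F).
Hypothesis dM : forall k (g h : Pxy F), g != 0 -> h != 0 ->
  delta k (toK (g * h)) = delta k (toK g) + delta k (toK h).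
Hypothesis dD : forall k (g h : Pxy F) d, g != 0 -> h != 0 -> g + h != 0 ->
  delta k (toK g) <= d -> delta k (toK h) <= d -> delta k (toK (g + h)) <= d.
Hypothesis dC : forall k (c : F), c != 0 -> delta k (toK (cstP c)) = 0.
Hypothesis f_lead : forall ij, exists2 c : F, c != 0 & lead_coef (f ij) = c%:P.
Hypothesis dom : forall g : Pxy F, g != 0 ->
  exists (beta : nat) (gamma : {ffun IJ l -> nat}),
    deg_y g = (beta + \sum_ij gamma ij * deg_y (f ij))%N /\
    forall k, (size (lead_coef g)).-1%:Z * delta k (toK var_x)
       + beta%:Z * delta k (toK var_y)
       + \sum_(ij : IJ l) (gamma ij)%:Z * delta k (toK (f ij)) <= delta k (toK g).

Lemma f_neq0 ij : f ij != 0.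
Proof. by have [c c0 h] := f_lead ij; rewrite -lead_coef_eq0 h polyC_eq0. Qed.

Lemma var_x_neq0 : (var_x : Pxy F) != 0.
Proof. by rewrite polyC_eq0 polyX_eq0. Qed.

Lemma var_y_neq0 : (var_y : Pxy F) != 0.
Proof. by rewrite polyX_eq0. Qed.

Lemma deg_yM (g h : Pxy F) : g != 0 -> h != 0 -> deg_y (g * h) = (deg_y g + deg_y h)%N.
Proof.
move=> g0 h0; rewrite /deg_y size_mul //.
move: (size_poly_gt0 g) (size_poly_gt0 h); rewrite g0 h0.
by case: (size g) (size h) => // m [] // n _ _; rewrite addnS.
Qed.

Lemma deg_yX (g : Pxy F) n : g != 0 -> deg_y (g ^+ n) = (n * deg_y g)%N.
Proof.
move=> g0; elim: n => [|n IH]; first by rewrite /deg_y size_poly1.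
by rewrite exprS deg_yM ?expf_neq0 // IH.
Qed.

Lemma deg_y_g_mon a b gamma :
  deg_y (g_mon f (a, b, gamma)) = (b + \sum_ij gamma ij * deg_y (f ij))%N.
Proof.
have p0 : \prod_ij f ij ^+ gamma ij != 0.
  by apply/prodf_neq0 => ij _; rewrite expf_neq0 // f_neq0.
rewrite /g_mon !deg_yM ?mulf_neq0 ?expf_neq0 ?var_x_neq0 ?var_y_neq0 //.
rewrite !deg_yX ?var_x_neq0 ?var_y_neq0 // {1}/deg_y size_polyC polyX_eq0 muln0.
rewrite {1}/deg_y size_polyX muln1 add0n; congr (_ + _)%N.
have [_ //] : \prod_ij f ij ^+ gamma ij != 0 /\
   deg_y (\prod_ij f ij ^+ gamma ij) = (\sum_ij gamma ij * deg_y (f ij))%N.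
elim/big_rec2: _ => [|ij m g _ [g0 <-]]; first by rewrite oner_neq0 /deg_y size_poly1.
by rewrite mulf_neq0 ?expf_neq0 ?f_neq0 // deg_yM ?expf_neq0 ?f_neq0 // deg_yX // f_neq0.
Qed.

(** The f_ij and y have constant leading coefficients in y, so only the power of x contributes and
    [a] is the exponent of x in the leading monomial. *)
Lemma lead_g_mon a b gamma :
  exists2 c : F, c != 0 & lead_coef (g_mon f (a, b, gamma)) = c *: 'X^a.
Proof.
have [c hc] : exists c : IJ l -> F, forall ij, c ij != 0 /\ lead_coef (f ij) = (c ij)%:P.
  have /choice[c hc] : forall ij, exists c : F, c != 0 /\ lead_coef (f ij) = c%:P.
    by move=> ij; have [c] := f_lead ij; exists c.
  by exists c.
exists (\prod_ij c ij ^+ gamma ij).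
  by apply/prodf_neq0 => ij _; rewrite expf_neq0 //; case: (hc ij).
rewrite /g_mon !lead_coefM !lead_coef_exp lead_coefC lead_coefX expr1n mulr1.
rewrite lead_coef_prod mulrC -mul_polyC rmorph_prod /=; congr (_ * _).
by apply: eq_bigr => ij _; rewrite lead_coef_exp (hc ij).2 rmorphXn.
Qed.

Lemma deltaX k (g : Pxy F) n : g != 0 -> delta k (toK (g ^+ n)) = n%:Z * delta k (toK g).
Proof.
move=> g0; elim: n => [|n IH]; first by rewrite mul0r expr0 -[1]/(cstP 1) dC ?oner_neq0.
by rewrite exprS dM ?expf_neq0 // IH -[n.+1]add1n PoszD mulrDl mul1r.
Qed.

Lemma delta_g_mon k e : delta k (toK (g_mon f e)) =
  e.1.1%:Z * delta k (toK var_x) + e.1.2%:Z * delta k (toK var_y)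
  + \sum_(ij : IJ l) (e.2 ij)%:Z * delta k (toK (f ij)).
Proof.
case: e => [[a b] gamma] /=.
have p0 : \prod_ij f ij ^+ gamma ij != 0.
  by apply/prodf_neq0 => ij _; rewrite expf_neq0 // f_neq0.
rewrite !dM ?mulf_neq0 ?expf_neq0 ?var_x_neq0 ?var_y_neq0 //.
rewrite !deltaX ?var_x_neq0 ?var_y_neq0 //; congr (_ + _).
have [_ //] : \prod_ij f ij ^+ gamma ij != 0 /\
   delta k (toK (\prod_ij f ij ^+ gamma ij)) = \sum_ij (gamma ij)%:Z * delta k (toK (f ij)).
elim/big_rec2: _ => [|ij m g _ [g0 <-]].
  by rewrite oner_neq0 -[1]/(cstP 1) dC ?oner_neq0.
by rewrite mulf_neq0 ?expf_neq0 ?f_neq0 // dM ?expf_neq0 ?f_neq0 // deltaX // f_neq0.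
Qed.

Lemma E_setP d e : E_set delta f d e <-> forall k, delta k (toK (g_mon f e)) <= d k.
Proof. by split=> h k; have := h k; rewrite delta_g_mon. Qed.

Lemma sections0 d : sections delta d 0. Proof. by left. Qed.

Lemma sectionsD d g h : sections delta d g -> sections delta d h ->
  sections delta d (g + h).
Proof.
move=> [->|hg]; first by rewrite add0r.
move=> [->|hh]; first by rewrite addr0; right.
have [->|g0] := eqVneq g 0; first by rewrite add0r; right.
have [->|h0] := eqVneq h 0; first by rewrite addr0; right.
have [->|gh0] := eqVneq (g + h) 0; first by left.
by right=> k; apply: dD.
Qed.

Lemma sectionsM d d' g h : sections delta d g -> sections delta d' h ->
  sections delta (d + d') (g * h).
Proof.
move=> [->|hg]; first by rewrite mul0r; left.
move=> [->|hh]; first by rewrite mulr0; left.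
have [->|g0] := eqVneq g 0; first by rewrite mul0r; left.
have [->|h0] := eqVneq h 0; first by rewrite mulr0; left.
by right=> k; rewrite dM // ffunE lerD.
Qed.

Lemma sections_cst (c : F) : sections delta 0 (cstP c).
Proof.
have [->|c0] := eqVneq c 0; first by left; rewrite /cstP !polyC0.
by right=> k; rewrite dC // ffunE.
Qed.

Lemma sectionsZ d (c : F) g : sections delta d g -> sections delta d (cstP c * g).
Proof. by rewrite -[d in X in _ -> X]add0r; apply/sectionsM/sections_cst. Qed.

Lemma sections_delta_vec g : sections delta (delta_vec delta g) g.
Proof. by right=> k; rewrite ffunE. Qed.

Lemma span_sections (I : choiceType) (A : set I) (g : I -> Pxy F) d :
  (forall i, A i -> sections delta d (g i)) -> lin_span A g `<=` sections delta d.
Proof.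
move=> hg _ [s [c [sA ->]]]; rewrite big_seq; apply: big_ind.
- exact: sections0.
- exact: sectionsD.
by move=> i /sA/hg; apply: sectionsZ.
Qed.

Section Basis.
Variables (d : {ffun 'I_N -> int}).
Variables (beta : nat * nat -> nat) (gamma : nat * nat -> {ffun IJ l -> nat}).
Hypothesis choose : forall ab, E'_set delta f d ab ->
  E_set delta f d (ab.1, beta ab, gamma ab) /\
  ab.2 = deg_y (g_mon f (ab.1, beta ab, gamma ab)).
Let g ab := g_mon f (ab.1, beta ab, gamma ab).

Lemma choose_coef ab : E'_set delta f d ab -> exists2 c : F, c != 0 &
  (forall b, (ab.2 < b)%N -> (g ab)`_b = 0) /\ (g ab)`_(ab.2) = c *: 'X^(ab.1).
Proof.
move=> hab; have [_ h2] := choose hab.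
have [c c0 hc] := lead_g_mon ab.1 (beta ab) (gamma ab).
exists c => //; split; last by rewrite -hc /lead_coef h2.
move=> b; rewrite {1}h2 /deg_y => hb; rewrite nth_default //.
by move: hb; rewrite -/(g ab); case: (size (g ab)).
Qed.

(** The monomial supplied by [dom] has the leading exponents of [h] and inherits the bounds on its
    pole orders. *)
Lemma sections_E' h : h != 0 -> sections delta d h ->
  E'_set delta f d ((size (lead_coef h)).-1, deg_y h).
Proof.
move=> h0 [h1|hs]; first by rewrite h1 eqxx in h0.
have [b [gm [e1 e2]]] := dom h0; exists b, gm; split => //.
  by move=> k; apply: le_trans (e2 k) (hs k).
by rewrite deg_y_g_mon.
Qed.

Lemma basis_span : lin_span (E'_set delta f d) g = sections delta d.
Proof.
apply/seteqP; split.
  by apply: span_sections => ab /choose[/E_setP h _]; right.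
(* Lexicographic induction: n bounds the size in y, and m the size in x of the coefficient of
   y^(n-1). *)
suff main n m (h : Pxy F) : (size h <= n)%N -> (size (h`_(n.-1))%R <= m)%N -> sections delta d h ->
    lin_span (E'_set delta f d) g h.
  by move=> h; apply: (main (size h)).
elim: n m h => [|n IHn] m h.
  by rewrite leqn0 size_poly_eq0 => /eqP -> _ _; apply: span0.
elim: m h => [|m IHm] h sh sm hs.
  apply: (IHn _ h _ (leqnn _) hs); apply/leq_sizeP => b.
  rewrite leq_eqVlt => /orP[/eqP <-|nb]; last by rewrite nth_default // (leq_trans sh).
  by apply/eqP; rewrite -size_poly_eq0 -leqn0.
have [sm'|sm'] := leqP (size (h`_n)%R) m; first exact: IHm.
have sn : size (h`_n)%R = m.+1 by apply/eqP; rewrite eqn_leq sm.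
have hn0 : h`_n != 0 by rewrite -size_poly_eq0 sn.
have shn : size h = n.+1.
  apply/eqP; rewrite eqn_leq sh ltnNge; apply: contra hn0 => h1.
  by rewrite nth_default.
have h0 : h != 0 by rewrite -size_poly_eq0 shn.
have lh : lead_coef h = h`_n by rewrite /lead_coef shn.
have := sections_E' h0 hs; rewrite lh sn /deg_y shn /= => hE.
have [c c0 [gbig gn]] := choose_coef hE; rewrite /= in gbig gn.
(* The multiple is chosen to cancel the leading monomial of [h] while remaining in the same space of
   sections. *)
pose x := - ((h`_n)`_m / c); pose h' := h + cstP x * g (m, n).
have -> : h = h' + cstP (- x) * g (m, n).
  by rewrite /h' -addrA -mulrDl /cstP -!polyCD subrr mul0r addr0.
apply: spanD; last exact: span_gen.
apply: IHm.
- apply/leq_sizeP => b nb; rewrite coefD coefCM gbig // mulr0 addr0.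
  by rewrite nth_default ?shn.
- apply/leq_sizeP => a ma; rewrite coefD coefCM gn coefD coefCM coefZ coefXn.
  move: ma; rewrite leq_eqVlt => /orP[/eqP <-|ma].
    by rewrite eqxx mulr1 mulNr divfK // subrr.
  by rewrite gtn_eqF // !mulr0 addr0 nth_default // sn.
apply: sectionsD => //; apply: sectionsZ.
by have [/E_setP ? _] := choose hE; right.
Qed.

Lemma basis_free : lin_free (E'_set delta f d) g.
Proof.
move=> s c us sE sum0.
(* [H n m] says that every index with nonzero coefficient is below (n, m), comparing y first.
   Distinct indices have distinct leading monomials, so the largest one can be removed; at each new
   n the bound in x restarts from [M]. *)
pose H n m := forall i, i \in s -> c i != 0 -> (i.2 < n)%N || ((i.2 == n) && (i.1 < m)%N).
pose M := (\sum_(i <- s) (i.1 + i.2))%N.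
have iM i : i \in s -> (i.1 + i.2 <= M)%N.
  by move=> si; rewrite /M (big_rem i) //= leq_addr.
have step n m : H n m.+1 -> H n m.
  move=> h i si ci; have := h i si ci.
  have [//|ni /=] := ltnP i.2 n; rewrite ltnS leq_eqVlt andb_orr => /orP[|//].
  move=> /andP[/eqP i2 /eqP i1].
  have [x x0 [_ gx]] := choose_coef (sE i si).
  have := congr1 (fun P : Pxy F => P`_n`_m) sum0.
  rewrite !coef0 coef_sum coef_sum (bigD1_seq i) //= -{1}i2 -{1}i1 coefCM gx coefCM coefZ.
  rewrite coefXn eqxx mulr1 big1_seq; last first.
    move=> j /andP[ji sj]; rewrite !coefCM.
    have [->|cj] := eqVneq (c j) 0; first by rewrite mul0r.
    have [y y0 [jbig jtop]] := choose_coef (sE j sj).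
    have := h j sj cj; case: (ltnP j.2 n) => [jn _|nj /=].
      by rewrite jbig // coef0 mulr0.
    move=> /andP[/eqP j2]; rewrite ltnS => j1.
    rewrite -j2 jtop coefZ coefXn; case: eqP => [mj|_]; last by rewrite !mulr0.
    by case/eqP: ji; rewrite (surjective_pairing j) (surjective_pairing i) i1 i2 j2 -mj.
  rewrite addr0 => /eqP; rewrite mulf_eq0 (negPf ci) (negPf x0) //.
have main n : H n 0%N -> forall i, i \in s -> c i = 0.
  elim: n => [|n IHn] h.
    by move=> i si; apply/eqP/negPn/negP => /(h i si); rewrite ltn0 andbF.
  apply: IHn; have : H n M.+1.
    move=> i si /(h i si); rewrite andbF orbF ltnS leq_eqVlt => /orP[->|->//].
    by rewrite ltnS (leq_trans (leq_addr _ _) (iM i si)) orbT.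
  by elim: {h} M.+1 => // m IHm /step.
apply: (main M.+1) => i si _; rewrite ltnS.
by rewrite (leq_trans (leq_addl _ _) (iM i si)).
Qed.

End Basis.

Lemma choose_E' d : exists (beta : nat * nat -> nat) (gamma : nat * nat -> {ffun IJ l -> nat}),
  forall ab, E'_set delta f d ab ->
    E_set delta f d (ab.1, beta ab, gamma ab) /\
    ab.2 = deg_y (g_mon f (ab.1, beta ab, gamma ab)).
Proof.
have /choice[bg hbg] : forall ab : nat * nat, exists bg : nat * {ffun IJ l -> nat},
    E'_set delta f d ab -> E_set delta f d (ab.1, bg.1, bg.2) /\
    ab.2 = deg_y (g_mon f (ab.1, bg.1, bg.2)).
  move=> ab; have [[b [gm [h1 _ h2]]]|h] := pselect (E'_set delta f d ab).
    by exists (b, gm).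
  by exists (0%N, [ffun=> 0%N]).
by exists (fun ab => (bg ab).1), (fun ab => (bg ab).2).
Qed.

Lemma span_E d : lin_span (E_set delta f d) (g_mon f) = sections delta d.
Proof.
apply/seteqP; split; first by apply: span_sections => e /E_setP h; right.
have [beta [gamma h]] := choose_E' d; rewrite -(basis_span h).
by apply: (spanS (k := fun ab => (ab.1, beta ab, gamma ab))) => ab /h[].
Qed.

Section CoxRing.
Let G := {ffun 'I_N -> int}.
Implicit Types (u v : G -> Pxy F) (d : G).

Lemma ffun_mulrn (v : G) n k : (v *+ n) k = n%:Z * v k.
Proof.
elim: n => [|n IH]; first by rewrite mulr0n ffunE mul0r.
by rewrite mulrS ffunE IH -[n.+1]add1n PoszD mulrDl mul1r.
Qed.

Lemma conv_mono_mono (d d' : G) (g h : Pxy F) :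
  conv (mono d g) (mono d' h) = mono (d + d') (g * h).
Proof.
apply/funext => e; rewrite conv_mono /mono subr_eq addrC.
by case: ifP; rewrite ?mulr0.
Qed.

Lemma cox_ring_mono d g : sections delta d g -> cox_ring delta (mono d g).
Proof.
move=> hg; split.
  apply: (sub_finite_set (B := [set d])) => // e; rewrite /= /mono.
  by case: (e =P d) => [//|_]; rewrite eqxx.
by move=> e; rewrite /mono; case: eqP => [->//|_]; apply: sections0.
Qed.

Lemma cox_ring_subalg : is_graded_subalg (cox_ring delta).
Proof.
split.
- by apply: cox_ring_mono; rewrite -[1]/(cstP 1); apply: sections_cst.
- move=> c u [fu su]; split; last by move=> d; apply: sectionsZ.
  by apply: sub_finite_set fu => d /=; apply: contraNN => /eqP ->; rewrite mulr0.
- move=> u v [fu su] [fv sv]; split; last by move=> d; apply: sectionsD.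
  apply: (sub_finite_set (B := [set d | u d != 0] `|` [set d | v d != 0])).
    move=> d /=; have [->|] := eqVneq (u d) 0; first by rewrite add0r; right.
    by left.
  by rewrite finite_setU.
move=> u v [fu su] [fv sv].
have [s us hs] : exists2 s : seq G, uniq s & forall d, (d \in s) = (u d != 0).
  exists (finmap.enum_fset (fset_set [set d | u d != 0])); first exact: finmap.fset_uniq.
  by move=> d; apply/idP/idP; rewrite in_fset_set // inE.
have cE d : conv u v d = \sum_(a <- s) u a * v (d - a).
  apply: conv_seq => // a; rewrite hs negbK => /eqP ->.
  by rewrite mul0r.
split; last first.
  move=> d; rewrite cE; apply: big_ind => [||a _]; [exact: sections0|exact: sectionsD|].
  by have := sectionsM (su a) (sv (d - a)); rewrite addrC subrK.
apply: (sub_finite_set _ (finite_image2 (fun a b : G => a + b) fu fv)) => d /=.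
rewrite cE => h; apply: contrapT => ne; move: h; rewrite big1 ?eqxx // => a _.
have [->|ua] := eqVneq (u a) 0; first by rewrite mul0r.
have [->|va] := eqVneq (v (d - a)) 0; first by rewrite mulr0.
by case: ne; exists a => //; exists (d - a) => //; rewrite addrC subrK.
Qed.

Lemma cox_generated : smallest (@is_graded_subalg F N) (cox_generators delta f) = cox_ring delta.
Proof.
apply/seteqP; split.
  apply: smallest_sub; first exact: cox_ring_subalg.
  move=> u [[ij ->]|->|->|[j ->]]; apply: cox_ring_mono; try exact: sections_delta_vec.
  right=> k; rewrite -[1]/(cstP 1) dC ?oner_neq0 // ffunE.
  by case: (k == j).
move=> u [fu su] M [[M1 MZ MD MM] genM].
have M0 : M (fun=> 0).
  by have := MZ 0 _ M1; congr M; apply/funext => d; rewrite /cstP !polyC0 mul0r.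
have Msum (I : eqType) (s : seq I) (U : I -> G -> Pxy F) :
    (forall i, i \in s -> M (U i)) -> M (fun d => \sum_(i <- s) U i d).
  elim: s => [|i s IH] hU.
    by rewrite (_ : (fun d => _) = fun=> 0) //; apply/funext => d; rewrite big_nil.
  rewrite (_ : (fun d => _) = fun d => U i d + \sum_(j <- s) U j d); last first.
    by apply/funext => d; rewrite big_cons.
  apply: MD; first by apply: hU; rewrite mem_head.
  by apply: IH => j sj; apply: hU; rewrite inE sj orbT.
have Mmul d d' g h : M (mono d g) -> M (mono d' h) -> M (mono (d + d') (g * h)).
  by move=> h1 h2; rewrite -conv_mono_mono; apply: MM.
have Mexp d g n : M (mono d g) -> M (mono (d *+ n) (g ^+ n)).
  move=> h; elim: n => [|n IH]; first by rewrite mulr0n.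
  by rewrite mulrS exprS; apply: Mmul.
have Mprod (I : finType) (D : I -> G) (g : I -> Pxy F) :
    (forall i, M (mono (D i) (g i))) -> M (mono (\sum_i D i) (\prod_i g i)).
  move=> h; elim/big_rec2: _ => // i d' h' _ IH.
  exact: Mmul.
have Mx : M (mono (delta_vec delta var_x) var_x) by apply: genM; apply: Or42.
have My : M (mono (delta_vec delta var_y) var_y) by apply: genM; apply: Or43.
have Mf ij : M (mono (delta_vec delta (f ij)) (f ij)).
  by apply: genM; apply: Or41; exists ij.
have M1j j : M (mono (unit_vec j) 1) by apply: genM; apply: Or44; exists j.
have Mmon e d : E_set delta f d e -> M (mono d (g_mon f e)).
  case: e => [[a b] gm] he.
  have h1 := Mmul _ _ _ _ (Mmul _ _ _ _ (Mexp _ _ a Mx) (Mexp _ _ b My))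
    (Mprod _ _ _ (fun ij => Mexp _ _ (gm ij) (Mf ij))).
  pose D : G := delta_vec delta var_x *+ a + delta_vec delta var_y *+ b +
    \sum_ij delta_vec delta (f ij) *+ gm ij.
  (* [D] is the vector of pole orders of the monomial. Powers of the (1)_(e_j) raise the degree from
     D to d, the exponents d_j - D_j being nonnegative by the definition of [E_set]. *)
  have h2 := Mprod _ _ _ (fun j => Mexp _ _ `|d j - D j|%N (M1j j)).
  have := Mmul _ _ _ _ h1 h2.
  rewrite [X in _ * X]big1 ?mulr1; last by move=> j _; rewrite expr1n.
  congr (M (mono _ _)); apply/ffunP => k; rewrite -/D ffunE sum_ffunE.
  have Dk : D k <= d k.
    apply: le_trans (he k); rewrite /D !ffunE sum_ffunE !ffun_mulrn !ffunE.
    rewrite lerD2l; apply/ler_sum => ij _; rewrite ffun_mulrn ffunE //.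
  rewrite (bigD1 k) //= ffun_mulrn [unit_vec _ _]ffunE eqxx big1; last first.
    by move=> j jk; rewrite ffun_mulrn [unit_vec _ _]ffunE eq_sym (negPf jk) mulr0.
  rewrite addr0 mulr1 gez0_abs ?subr_ge0 //.
  by rewrite (addrC (D k)) subrK.
have [s us hs] : exists2 s : seq G, uniq s & forall d, (d \in s) = (u d != 0).
  exists (finmap.enum_fset (fset_set [set d | u d != 0])); first exact: finmap.fset_uniq.
  by move=> d; apply/idP/idP; rewrite in_fset_set // inE.
(* An element is the finite sum of its homogeneous components, each spanned by monomials by
   [span_E]. *)
have -> : u = fun d => \sum_(a <- s) mono a (u a) d.
  apply/funext => d; have [ds|ds] := boolP (d \in s).
    rewrite (bigD1_seq d) //= /mono eqxx big1 ?addr0 // => i.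
    by rewrite eq_sym => /negPf ->.
  rewrite big1_seq => [|i /andP[_ si]].
    by apply/eqP; rewrite -[_ == _]negbK -hs.
  by rewrite /mono; case: eqP => // di; rewrite di si in ds.
apply: (Msum) => a _; have := su a; rewrite -span_E => -[t [c [tE ->]]].
have -> : mono a (\sum_(i <- t) cstP (c i) * g_mon f i) =
    fun d => \sum_(i <- t) (fun d => cstP (c i) * mono a (g_mon f i) d) d.
  apply/funext => d; rewrite /mono; case: eqP => // _.
  by rewrite big1 // => i _; rewrite mulr0.
by apply: Msum => e /tE/Mmon h; apply: MZ.
Qed.

End CoxRing.
End LeadingTerms.

(** * A character of the rationals with kernel the integers *)

Section CircleCharacter.
Variable R : realType.

Definition circle (e : rat) : complex R :=
  Complex (cos (pi *+ 2 * ratr e)) (sin (pi *+ 2 * ratr e)).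

Lemma circleD a b : circle (a + b) = circle a * circle b.
Proof.
apply/eqP; rewrite eq_complex /= rmorphD mulrDr cosD sinD eqxx /=.
by rewrite addrC.
Qed.

Lemma circle0 : circle 0 = 1.
Proof. by rewrite /circle rmorph0 mulr0 cos0 sin0. Qed.

Lemma circle_natr (n : nat) : circle n%:R = 1.
Proof.
elim: n => [|n IH]; first exact: circle0.
by rewrite -natr1 circleD IH mul1r /circle rmorph1 mulr1 cos2pi sin2pi.
Qed.

Lemma circle_intr (z : int) : circle z%:~R = 1.
Proof.
case: z => n; first exact: circle_natr.
have : circle (- n.+1%:R) * circle n.+1%:R = 1 by rewrite -circleD addNr circle0.
by rewrite circle_natr mulr1 NegzE rmorphN.
Qed.

(** If the fractional part x were in (0, 1), then 1 - cos(2 pi x) = 2 sin(pi x)^2 would be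
    positive. *)
Lemma circle_int e : (circle e == 1) = (e \is a Num.int).
Proof.
apply/eqP/intrP => [h|[z ->]]; last exact: circle_intr.
exists (Num.floor e); pose x := e - (Num.floor e)%:~R.
have hx : circle x = 1.
  by rewrite -[LHS]mulr1 -(circle_intr (Num.floor e)) -circleD subrK h circle_intr.
apply/eqP; rewrite -subr_eq0 -/x; apply/negPn/negP => x0.
have xgt0 : 0 < x by rewrite lt_neqAle eq_sym x0 /= subr_ge0 floor_le.
have xlt1 : x < 1 by have := floorD1_gt e; rewrite intrD /x; lra.
have s0 : 0 < sin (pi * ratr x : R).
  apply: sin_gt0_pi; rewrite mulr_gt0 ?pi_gt0 ?ltr0q //=.
  by rewrite gtr_pMr ?pi_gt0 // -(rmorph1 (@ratr R)) ltr_rat.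
have /(congr1 (@complex.Re _)) /= : circle x = 1 := hx.
rewrite mulrnAl cos_mulr2n cos2sin2 => hc.
have : 0 < sin (pi * ratr x : R) ^+ 2 by rewrite exprn_gt0.
by move: hc; lra.
Qed.

Definition circle_char : charQ (complex R) := CharQ circleD circle_int.

End CircleCharacter.

(** * Monomials with the leading exponents and no larger pole orders *)

Section Domination.
Variables (F : numClosedFieldType) (chi : charQ F) (N : nat).
Variable delta : 'I_N -> Kxy F -> int.
Hypothesis Hx : forall i, 0 < delta i (toK var_x).
Variables (phi : 'I_N -> rat -> F) (r : 'I_N -> rat).
Hypothesis Hphi : forall i, is_generic_puiseux (delta i) (phi i) (r i).
Variables (l : 'I_N -> nat) (qp : forall i : 'I_N, (l i).+1.-tuple (int * nat)).
Hypothesis Hqp : forall i, formal_puiseux_pairs (phi i) (r i) (qp i).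
Variable f : IJ l -> Pxy F.
Hypothesis Hf1 : forall ij, one_place_at_infinity (f ij).
Hypothesis Hf2 : forall (i : 'I_N) (j : 'I_(l i).+1),
  exists phi_ij : rat -> F,
    [/\ is_puiseux_root (f (existT _ i j)) phi_ij,
        puiseux_pairs phi_ij (take j (qp i))
      & exists2 psi : rat -> F,
          (forall e, char_exp (qp i) j < e -> psi e = 0)
        & forall e, phi_ij e = trunc_gt (phi i) (char_exp (qp i) j) e + psi e].

Let phiP i : puiseux F := gphi (Hx i) (Hphi i).

Lemma f_roots : exists rt : IJ l -> puiseux F,
  [/\ forall ij, root (fx (f ij)) (rt ij),
      forall i (j : 'I_(l i).+1), puiseux_pairs (rt (existT _ i j)) (take j (qp i))
    & forall i (j : 'I_(l i).+1) e, char_exp (qp i) j < e ->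
        rt (existT _ i j) e = phiP i e].
Proof.
have /choice[rt hrt] : forall ij : IJ l, exists u : puiseux F,
    [/\ root (fx (f ij)) u, puiseux_pairs u (take (tagged ij) (qp (tag ij)))
      & forall e, char_exp (qp (tag ij)) (tagged ij) < e -> u e = phi (tag ij) e].
  case=> i j; have [u [hu pu [psi psi0 uE]]] := Hf2 j.
  exists (mkP hu.1); split => //; first exact/is_puiseux_rootE.
  by move=> e he; rewrite /= uE psi0 // addr0 /trunc_gt he.
exists rt; split=> [ij|i j|i j e he].
- by have [] := hrt ij.
- by have [] := hrt (existT _ i j).
by have [_ _ ->] := hrt (existT _ i j).
Qed.

Lemma f_lead_coef ij : exists2 c : F, c != 0 & lead_coef (f ij) = c%:P.
Proof.
have [rt [h1 h2 _]] := f_roots.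
have [c c0 [_ lf _]] := one_place_Nm chi (Hf1 ij) (h1 ij) (pol_polydromy h2 ij).
by exists c.
Qed.

Lemma dominating_monomial (g : Pxy F) : g != 0 ->
  exists (beta : nat) (gamma : {ffun IJ l -> nat}),
    deg_y g = (beta + \sum_ij gamma ij * deg_y (f ij))%N /\
    forall k, (size (lead_coef g)).-1%:Z * delta k (toK var_x)
       + beta%:Z * delta k (toK var_y)
       + \sum_(ij : IJ l) (gamma ij)%:Z * delta k (toK (f ij)) <= delta k (toK g).
Proof.
move=> g0; have [rt [h1 h2 h3]] := f_roots.
have hpol := pol_polydromy h2.
have fE ij : exists2 c : F, c != 0 & [/\ size (f ij) = (pol qp ij).+1,
    lead_coef (f ij) = c%:P & fx (f ij) = cstpuis c *: Nm chi (pol qp ij) (rt ij)].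
  by have := one_place_Nm chi (Hf1 ij) (h1 ij) (hpol ij).
pose L := polyx (lead_coef g).
have lg0 : lead_coef g != 0 by rewrite lead_coef_eq0.
have L0 : L != 0 by rewrite /L -lead_coef_fx lead_coef_eq0 fx_eq0.
(* The leading coefficient adds its degree in x along every generic series, so the comparison
   concerns the monic part only. *)
pose P := L^-1 *: fx g.
have gP : fx g = L%:P * P by rewrite mul_polyC /P scalerA mulfV // scale1r.
have mP : P \is monic by apply/monicP; rewrite lead_coefZ lead_coef_fx mulVf.
have fP : sfix chi P.
  apply/polyP => i; have Pi : P`_i = L^-1 * polyx g`_i by rewrite coefZ coef_map.
  by rewrite coef_map /= Pi rmorphM fmorphV /= !sig_polyx.
have [beta [gamma [sP hk]]] := dominated (r := r) hpol (select_root (phi := phiP) chi Hqp h3) mP fP.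
have sPg : size P = size g by rewrite size_scale ?invr_eq0 // size_fx.
exists beta, gamma; split.
  rewrite /deg_y -sPg sP; congr (_ + _)%N; apply: eq_bigr => ij _.
  by have [c _ [-> _ _]] := fE ij.
move=> k; have [t ht le_t] := hk k.
have dx0 : 0 < (delta k (toK var_x))%:~R :> rat by rewrite ltr0z.
have hg : has_deg_x (at_ser (gser (phiP k) (r k)) (fx g)) ((size (lead_coef g)).-1%:R + t).
  rewrite gP rmorphM /= at_serC; apply: has_degM => //.
  exact/has_deg_lift/has_deg_polyx.
have df ij : (delta k (toK (f ij)))%:~R =
    (delta k (toK var_x))%:~R * wt chi phiP r rt (pol qp) k ij.
  have [c c0 [_ _ fc]] := fE ij.
  have f0 : f ij != 0.
    by rewrite -fx_eq0 fc scaler_eq0 negb_or fmorph_eq0 c0 monic_neq0 // Nm_monic.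
  have hf : has_deg_x (at_ser (gser (phiP k) (r k)) (fx (f ij)))
      (0 + wt chi phiP r rt (pol qp) k ij).
    rewrite fc -mul_polyC rmorphM /= at_serC; apply: has_degM.
      exact/has_deg_lift/has_deg_monoP.
    exact: has_deg_Nm.
  by rewrite (delta_deg f0 hf) add0r.
(* Divided by delta_k(x) > 0, both sides share the degree of the leading coefficient; what remains
   is the inequality [le_t]. *)
rewrite -(ler_int rat) (delta_deg g0 hg) !rmorphD !rmorphM /=.
rewrite (delta_var_y (Hx k) (Hphi k)) rmorph_sum /=.
rewrite (eq_bigr (fun ij => (delta k (toK var_x))%:~R *
    (wt chi phiP r rt (pol qp) k ij *+ gamma ij))); last first.
  by move=> ij _; rewrite rmorphM /= df -mulr_natl; ring.
rewrite -mulr_sumr [X in _ + X + _]mulrCA [X in X + _ + _]mulrC -!mulrDr.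
rewrite ler_pM2l // -addrA lerD2l; move: le_t.
by rewrite -mulr_natl.
Qed.

End Domination.

Theorem theorem4p5 (R : realType)
  (X : set (set (Kxy (complex R)))) (HX : normal_complete_surface X)
  (N : nat) (Gamma : 'I_N -> set (Kxy (complex R)))
  (HGamma : components_at_infinity X Gamma)
  (delta : 'I_N -> Kxy (complex R) -> int)
  (Hdelta : forall i, is_semidegree_along (Gamma i) (delta i))
  (Hx : forall i, 0 < delta i (toK var_x))
  (phi : 'I_N -> rat -> complex R) (r : 'I_N -> rat)
  (Hphi : forall i, is_generic_puiseux (delta i) (phi i) (r i))
  (l : 'I_N -> nat) (qp : forall i : 'I_N, (l i).+1.-tuple (int * nat))
  (Hqp : forall i, formal_puiseux_pairs (phi i) (r i) (qp i))
  (HS : in_S_pol delta)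
  (f : IJ l -> Pxy (complex R))
  (Hf1 : forall ij, one_place_at_infinity (f ij))
  (Hf2 : forall (i : 'I_N) (j : 'I_(l i).+1),
     exists phi_ij : rat -> complex R,
       [/\ is_puiseux_root (f (existT _ i j)) phi_ij,
           puiseux_pairs phi_ij (take j (qp i))
         & exists2 psi : rat -> complex R,
             (forall e, char_exp (qp i) j < e -> psi e = 0)
           & forall e, phi_ij e
                       = trunc_gt (phi i) (char_exp (qp i) j) e + psi e]) :
  [/\ smallest (@is_graded_subalg _ N) (cox_generators delta f)
        = cox_ring delta,
      forall d : {ffun 'I_N -> int},
        lin_span (E_set delta f d) (g_mon f) = sections delta d
    & forall d : {ffun 'I_N -> int},
        (forall n : nat, has_dim (sections delta d) n
                         <-> (E'_set delta f d #= `I_n)%card) /\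
        (forall (beta : nat * nat -> nat)
                (gamma : nat * nat -> {ffun IJ l -> nat}),
           (forall ab, E'_set delta f d ab ->
              E_set delta f d (ab.1, beta ab, gamma ab) /\
              ab.2 = deg_y (g_mon f (ab.1, beta ab, gamma ab))) ->
           is_basis (E'_set delta f d)
             (fun ab => g_mon f (ab.1, beta ab, gamma ab))
             (sections delta d))].
Proof.
pose chi := circle_char R.
have dM k := @deltaM _ _ _ _ (Hx k) (Hphi k).
have dD k := @deltaD _ _ _ _ (Hx k) (Hphi k).
have dC k := @delta_cst _ _ _ _ (Hx k) (Hphi k).
have lead := f_lead_coef chi Hx Hphi Hf1 Hf2.
have dom := dominating_monomial chi Hx Hphi Hqp Hf1 Hf2.
split; first exact: cox_generated dM dD dC lead dom.
  exact: span_E dM dD dC lead dom.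
move=> d.
have basis beta gamma : (forall ab, E'_set delta f d ab ->
    E_set delta f d (ab.1, beta ab, gamma ab) /\
    ab.2 = deg_y (g_mon f (ab.1, beta ab, gamma ab))) ->
    is_basis (E'_set delta f d) (fun ab => g_mon f (ab.1, beta ab, gamma ab))
      (sections delta d).
  move=> h; split; first exact (basis_span dM dD dC lead dom h).
  exact (basis_free lead h).
split=> [n|]; last exact: basis.
have [beta [gamma h]] := choose_E' delta f d.
exact: basis_dim (basis _ _ h).
Qed.
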